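(* Let $n=2$, so $(G,G')=(SL(3,\mathbb R),SL(2,\mathbb R))$. Put $$\Lambda_1=\{(\alpha,\alpha+m;\lambda,\lambda+m):\alpha\in\{\pm\},\ \lambda\in\mathbb C,\ m\in\mathbb Z_{\ge0}\},$$ $$\Lambda_+=\{(\alpha,\alpha+m;1-(m+\ell),1+\ell):\alpha\in\{\pm\},\ m\in\mathbb Z_{\ge0},\ \ell\in1+\mathbb Z_{\ge0}\}\subset\Lambda_1.$$ Then, for $(\alpha,\beta;\lambda,\nu)\in\{\pm\}^2\times\mathbb C^2$, $$\mathrm{Diff}_{G'}(I(\mathrm{triv},\lambda)^\alpha,J(\mathrm{triv},\nu)^\beta)=\begin{cases}\mathbb C\,\mathbb D_{(m,0)}&\text{if }(\alpha,\beta;\lambda,\nu)\in\Lambda_1\setminus\Lambda_+,\\ \mathbb C\,\mathbb D_{(m+2\ell,0)}\oplus\mathbb C\,\mathbb D_{(m,\ell)}&\text{if }(\alpha,\beta;\lambda,\nu)\in\Lambda_+,\\ \{0\}&\text{otherwise,}\end{cases}$$ where $m$ (resp. $m,\ell$) are the integers in the description of the parameter as an element of $\Lambda_1$ (resp. $\Lambda_+$).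
   Context: Groups: $G=SL(3,\mathbb R)$, $G'=\{\mathrm{diag}(g',1):g'\in SL(2,\mathbb R)\}\subset G$. With matrix units $E_{i,j}$ put $N_j^+=E_{1,j+1}$, $N_j^-=E_{j+1,1}$ ($j=1,2$), $\widetilde H_0=\frac12\mathrm{diag}(2,-1,-1)$, $\widetilde H_0'=\mathrm{diag}(1,-1,0)$. Let $N_\pm=\exp(\mathbb RN_1^\pm+\mathbb RN_2^\pm)$, $N_\pm'=\exp(\mathbb RN_1^\pm)$, $A=\exp(\mathbb R\widetilde H_0)$, $A'=\exp(\mathbb R\widetilde H_0')$, $M=\{\mathrm{diag}(\det(g)^{-1},g):g\in SL^\pm(2,\mathbb R)\}$ where $SL^\pm(2,\mathbb R)=\{\det=\pm1\}$, $M'=\{\mathrm{diag}(\epsilon,\epsilon,1):\epsilon=\pm1\}$. Then $P=MAN_+$, $P'=M'A'N'_+$ are parabolic subgroups of $G$, $G'$ with $G/P\simeq\mathbb{RP}^2$, $G'/P'\simeq\mathbb{RP}^1$, $P'\subset P$. Signs: $\{\pm\}\equiv\{\pm1\}$; for $\delta\in\{\pm\}$, $k\in\mathbb Z_{\ge0}$, $\delta+k$ denotes the sign $\delta\cdot(-1)^k$. Representations: $\mathbb C_\lambda$ is the character $\exp(t\widetilde H_0)\mapsto e^{\lambda t}$ of $A$, $\mathbb C_\nu$ the character $\exp(t\widetilde H'_0)\mapsto e^{\nu t}$ of $A'$. $\mathrm{sgn}^+$ is trivial; $\mathrm{sgn}^-$ is $\mathrm{diag}(\det(g)^{-1},g)\mapsto\det(g)$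 on $M$ and $\mathrm{diag}(\epsilon,\epsilon,1)\mapsto\epsilon$ on $M'$. $I(\mathrm{triv},\lambda)^\alpha=\mathrm{Ind}_P^G(\mathrm{sgn}^\alpha\boxtimes\mathbb C_\lambda)$ and $J(\mathrm{triv},\nu)^\beta=\mathrm{Ind}_{P'}^{G'}(\mathrm{sgn}^\beta\boxtimes\mathbb C_\nu)$ are unnormalized smooth induced representations ($N_+,N'_+$ acting trivially): $\mathrm{Ind}_P^G(\sigma)=\{f\in C^\infty(G):f(gp)=\sigma(p)^{-1}f(g)\ \forall p\in P\}$ with left translation, viewed as sections of line bundles over $G/P$, $G'/P'$. $\mathrm{Diff}_{G'}(I,J)$ is the space of $G'$-intertwining differential operators $I\to J$, where, for the inclusion $\iota:G'/P'\hookrightarrow G/P$, a continuous linear map $\mathbb D$ between smooth sections is a differential operator if $\iota(\mathrm{Supp}(\mathbb Df))\subset\mathrm{Supp}(f)$ for all $f$. Coordinates: via $\mathbb R^2\simeq N_-$, $(x_1,x_2)\mapsto\exp(x_1N_1^-+x_2N_2^-)$ and $\mathbb R\simeq N'_-$, $x_1\mapsto\exp(x_1N_1^-)$, restriction to $N_-$, $N_-'$ embeds $I(\mathrm{triv},\lambda)^\alpha\subset C^\infty(\mathbb R^2)$ and $J(\mathrm{triv},\nu)^\beta\subset C^\infty(\mathbb R)$. With $(\mathrm{Rest}_{x_2=0}f)(x_1)=f(x_1,0)$, $$\mathbb D_{(m,\ell)}=\mathrm{Rest}_{x_2=0}\circ\frac{\partial^m}{\partial x_2^m}\frac{\partial^\ell}{\partial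 x_1^\ell}\otimes\frac{y_1^\ell}{\ell!},$$ where the one-dimensional space $\mathbb Cy_1^\ell$ is identified with $\mathbb C$ by $y_1^\ell/\ell!\leftrightarrow1$; under this identification the representation $\mathrm{sgn}^{\beta+\ell}\otimes\mathrm{poly}_1^\ell$ of $M'\simeq\{\pm1\}$ on $\mathbb Cy_1^\ell$ is the same as $\mathrm{sgn}^\beta\otimes\mathrm{triv}$, so $J(\mathrm{poly}_1^\ell,\nu)^{\beta+\ell}=J(\mathrm{triv},\nu)^\beta$. *)

(* Defs.v *)
From HB Require Import structures.
From mathcomp Require Import all_boot all_order all_algebra.
From mathcomp Require Import all_classical all_reals all_analysis.
From mathcomp.real_closed Require Import complex.
From mathcomp Require Import ring.

Set Implicit Arguments.
Unset Strict Implicit.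
Unset Printing Implicit Defensive.

Import Order.TTheory GRing.Theory Num.Theory.
Import numFieldNormedType.Exports.
Local Open Scope classical_set_scope.
Local Open Scope complex_scope.
Local Open Scope ring_scope.

Section Smooth.
Variables (R : realType) (V : normedModType R).
Implicit Types (U : set V) (v : V).

(* [F] is of class C^k on the open set [U].  The values of [F] outside [U]
   play no role.  This is the usual notion only for finite-dimensional [V]. *)
Fixpoint Ck (k : nat) U (F : V -> R) : Prop :=
  (forall x, U x -> {for x, continuous F}) /\
  if k is k'.+1 then
    forall v, (forall x, U x -> derivable F x v) /\ Ck k' U ('D_v F)
  else True.

Definition smooth_on U (F : V -> R[i]) : Prop :=
  forall k, Ck k U (fun x => complex.Re (F x)) /\
            Ck k U (fun x => complex.Im (F x)).

Definition derivC v (F : V -> R[i]) : V -> R[i] := fun x =>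
  'D_v (fun y => complex.Re (F y)) x +i* 'D_v (fun y => complex.Im (F y)) x.

Lemma Ck_ext k U (F G : V -> R) : open U -> {in U, F =1 G} ->
  Ck k U F -> Ck k U G.
Proof.
move=> oU; elim: k F G => [|k IH] F G FG /= [cF dF].
all: have nFG x : U x -> \forall y \near x, F y = G y
  by move=> Ux; apply: filterS (open_nbhs_nbhs (conj oU Ux)) => y Uy;
     apply: FG; rewrite inE.
all: have cG x : U x -> {for x, continuous G}
  by move=> Ux; rewrite /prop_for /continuous_at -(FG x) ?inE//;
     apply: cvg_trans (cF x Ux); apply: near_eq_cvg; apply: nFG.
  by split.
split=> // v; have [dFv CF] := dF v; split.
  move=> x Ux; apply: (near_eq_derivable _ (dFv x Ux)).
  exact: nFG.
apply: IH CF => x; rewrite inE => Ux; apply: near_eq_derive; exact: nFG.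
Qed.

Lemma CkW k U U' (F : V -> R) : U' `<=` U -> Ck k U F -> Ck k U' F.
Proof.
move=> UU; elim: k F => [|k IH] F /= [cF dF]; split=> //;
  do ?[by move=> x /UU; apply: cF].
move=> v; have [dFv CF] := dF v; split; last exact: IH.
by move=> x /UU; apply: dFv.
Qed.

Lemma Ck_lin k U (F G : V -> R) (a b : R) : open U -> Ck k U F -> Ck k U G ->
  Ck k U (fun x => a * F x + b * G x).
Proof.
move=> oU; elim: k F G => [|k IH] F G /= [cF dF] [cG dG].
all: have cFG x : U x -> {for x, continuous (fun x => a * F x + b * G x)}
  by move=> Ux; apply: cvgD; (apply: cvgM; first exact: cvg_cst);
     [exact: cF|exact: cG].
  by split.
split=> // v; have [dFv CF] := dF v; have [dGv CG] := dG v.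
have D x : U x -> is_derive x v (fun x => a * F x + b * G x)
    (a *: 'D_v F x + b *: 'D_v G x).
  move=> Ux; have := is_deriveD (is_deriveZ a (derivableP (dFv x Ux)))
                               (is_deriveZ b (derivableP (dGv x Ux))).
  exact.
split; first by move=> x /D [].
by apply: Ck_ext (IH _ _ CF CG) => // x; rewrite inE => /D [_ ->].
Qed.

Lemma Ck_cst k U (c : R) : Ck k U (fun=> c).
Proof.
elim: k c => [|k IH] c /=; split=> //; do ?[by move=> x _; apply: cvg_cst].
move=> v; split=> [x _|]; first exact: derivable_cst.
have -> : 'D_v (fun _ : V => c) = (fun=> 0 : R).
  by apply/funext => x; rewrite derive_cst.
exact: IH.
Qed.

Lemma smooth_on0 U : smooth_on U (fun=> 0).
Proof. by move=> k; split; apply: Ck_cst. Qed.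

Lemma smooth_onW U U' F : U' `<=` U -> smooth_on U F -> smooth_on U' F.
Proof. by move=> UU sF k; have [? ?] := sF k; split; exact: (CkW UU). Qed.

Lemma smooth_on_lin U F G (c : R[i]) : open U ->
  smooth_on U F -> smooth_on U G -> smooth_on U (fun x => c * F x + G x).
Proof.
move=> oU sF sG k; have [rF iF] := sF k; have [rG iG] := sG k; case: c => a b.
have H := Ck_lin 1 1 oU (Ck_lin a (- b) oU rF iF) rG.
have K := Ck_lin 1 1 oU (Ck_lin b a oU rF iF) iG.
split; [apply: Ck_ext H|apply: Ck_ext K] => // x _; case: (F x) => ? ?;
  case: (G x) => ? ? /=; rewrite !mul1r ?mulNr //.
by congr (_ + _); rewrite addrC.
Qed.

Lemma Ck_comp k (L : {linear V -> V}) U (F : V -> R) : continuous L ->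
  Ck k U F -> Ck k (L @^-1` U) (F \o L).
Proof.
move=> cL; elim: k F => [|k IH] F /= [cF dF].
all: have cFL x : (L @^-1` U) x -> {for x, continuous (F \o L)}
  by move=> Ux; apply: continuous_comp; [exact: cL|exact: cF].
  by split.
have E v x : (fun h : R => h^-1 *: (((F \o L) \o shift x) (h *: v) - (F \o L) x))
  = (fun h => h^-1 *: ((F \o shift (L x)) (h *: L v) - F (L x))).
  by apply/funext => h /=; rewrite linearP.
split=> // v; have [dFv CF] := dF (L v); split.
  by move=> x Ux; rewrite /derivable E; exact: dFv.
have -> : 'D_v (F \o L) = 'D_(L v) F \o L; last exact: IH.
by apply/funext => x; rewrite /derive E.
Qed.

Lemma smooth_on_comp (L : {linear V -> V}) U F : continuous L ->
  smooth_on U F -> smooth_on (L @^-1` U) (F \o L).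
Proof. by move=> cL sF k; have [? ?] := sF k; split;
  [exact: (Ck_comp (F := fun y => complex.Re (F y)))|
   exact: (Ck_comp (F := fun y => complex.Im (F y)))]. Qed.

End Smooth.

Lemma mulmx_continuous (R : realType) m n p (A : 'M[R]_(m, n)) :
  continuous (mulmx A : 'M[R]_(n, p) -> 'M[R]_(m, p)).
Proof.
move=> B W [P PW sPW].
have H (i : 'I_m) (j : 'I_p) : \forall B' \near B, P i j ((A *m B') i j).
  have : {for B, continuous (fun B' : 'M[R]_(n, p) => (A *m B') i j)}.
    have -> : (fun B' : 'M[R]_(n, p) => (A *m B') i j) =
              (fun B' => \sum_k A i k * B' k j) by apply/funext => B'; rewrite mxE.
    apply: continuous_big => [|k _ C]; first exact: add_continuous.
    apply: (@cvgM _ _ _ _ (cst (A i k)) (fun B1 : 'M[R]_(n, p) => B1 k j)).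
    - exact: (nbhs_filter C).
    - exact: (@cvg_cst _ _ _ (nbhs C) (nbhs_filter C)).
    - exact: coord_continuous.
  by move=> C; exact: (C _ (PW i j)).
have PB : \forall B' \near B, forall i j, P i j ((A *m B') i j).
  apply: (@filter_forall _ _ _ _ (nbhs_filter B)) => i.
  apply: (@filter_forall _ _ _ _ (nbhs_filter B)) => j; exact: H.
exact: (@filterS _ (nbhs B) (nbhs_filter B) _ _ (fun B' PB' => sPW _ PB') PB).
Qed.

Section SpecialLinear.
Variable R : realType.

Definition SL n := {g : 'M[R]_n | \det g == 1}.

HB.instance Definition _ n := SubChoice.on (SL n).

Section Group.
Variable n : nat.

Lemma SL_det (g : SL n) : \det (val g) = 1. Proof. exact/eqP/(valP g). Qed.

Lemma SL_unit (g : SL n) : val g \in unitmx.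
Proof. by rewrite unitmxE SL_det unitr1. Qed.

Fact SL_one_subproof : \det (1%:M : 'M[R]_n) == 1. Proof. by rewrite det1. Qed.
Fact SL_mul_subproof (g h : SL n) : \det (val g *m val h) == 1.
Proof. by rewrite det_mulmx !SL_det mulr1. Qed.
Fact SL_inv_subproof (g : SL n) : \det (invmx (val g)) == 1.
Proof. by rewrite det_inv SL_det invr1. Qed.

Definition SL_one : SL n := Sub 1%:M SL_one_subproof.
Definition SL_mul (g h : SL n) : SL n := Sub (val g *m val h) (SL_mul_subproof g h).
Definition SL_inv (g : SL n) : SL n := Sub (invmx (val g)) (SL_inv_subproof g).

Fact SL_mulA : associative SL_mul.
Proof. by move=> g h k; apply/val_inj; rewrite /= mulmxA. Qed.
Fact SL_mul1 : left_id SL_one SL_mul.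
Proof. by move=> g; apply/val_inj; rewrite /= mul1mx. Qed.
Fact SL_mulr1 : right_id SL_one SL_mul.
Proof. by move=> g; apply/val_inj; rewrite /= mulmx1. Qed.
Fact SL_mulV : left_inverse SL_one SL_inv SL_mul.
Proof. by move=> g; apply/val_inj; rewrite /= mulVmx ?SL_unit. Qed.
Fact SL_mulrV : right_inverse SL_one SL_inv SL_mul.
Proof. by move=> g; apply/val_inj; rewrite /= mulmxV ?SL_unit. Qed.

HB.instance Definition _ :=
  isGroup.Build (SL n) SL_mulA SL_mul1 SL_mulr1 SL_mulV SL_mulrV.

HB.instance Definition _ :=
  Topological.copy (SL n) (initial_topology (val : SL n -> 'M[R]_n)).

(* Smooth functions on the closed submanifold [SL n] of ['M_n]: those which
   locally extend to smooth functions on open sets of matrices. *)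
Definition smoothSL (f : SL n -> R[i]) : Prop :=
  forall g : SL n, exists U : set 'M[R]_n, exists F : 'M[R]_n -> R[i],
    [/\ open U, U (val g), smooth_on U F &
      forall h : SL n, U (val h) -> F (val h) = f h].

Definition ltrans (h : SL n) (f : SL n -> R[i]) : SL n -> R[i] :=
  fun g => f (h^-1 * g)%g.

Lemma smoothSL0 : smoothSL (fun=> 0).
Proof.
move=> g; exists setT, (fun=> 0); split=> //; [exact: openT|exact: smooth_on0].
Qed.

Lemma smoothSL_lin (c : R[i]) f1 f2 : smoothSL f1 -> smoothSL f2 ->
  smoothSL (fun g => c * f1 g + f2 g).
Proof.
move=> s1 s2 g; have [U1 [F1 [oU1 U1g sF1 E1]]] := s1 g.
have [U2 [F2 [oU2 U2g sF2 E2]]] := s2 g.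
exists (U1 `&` U2), (fun x => c * F1 x + F2 x); split=> //.
- exact: openI.
- apply: smooth_on_lin; [exact: openI|apply: smooth_onW sF1|apply: smooth_onW sF2];
  by move=> ? [].
- by move=> h [/E1 -> /E2 ->].
Qed.

Lemma smoothSL_ltrans h f : smoothSL f -> smoothSL (ltrans h f).
Proof.
move=> sf g; have [U [F [oU Ug sF E]]] := sf (h^-1 * g)%g.
pose L : {linear 'M[R]_n -> 'M[R]_n} := mulmx (val (h^-1)%g).
have cL : continuous L by exact: mulmx_continuous.
exists (L @^-1` U), (F \o L); split.
- by move/continuousP: cL; apply.
- exact: Ug.
- exact: smooth_on_comp.
- by move=> k Uk; rewrite /= /ltrans -E.
Qed.

End Group.
End SpecialLinear.

Section InducedRepresentation.
Variables (R : realType) (n : nat).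

(* [n = 2] gives G = SL(3,R) and P = M A N_+; [n = 1] gives SL(2,R), identified
   with G' through [iotaG] below, and P' = M' A' N'_+. *)

Definition cexp (z : R[i]) : R[i] :=
  (expR (complex.Re z))%:C *
  (cos (complex.Im z) +i* sin (complex.Im z)).

(* Below, [1 + n] splits off the first coordinate, as in diag(det(g)^-1, g).
   - [Amx t] is exp(t diag(1, -1/n, ..., -1/n)); the generator is
     1/2 diag(2, -1, -1) for n = 2 and diag(1, -1) for n = 1.
   - [Nmx] and [Nbar_mx] are the exponentials 1 + X of the matrices X of square
     zero \sum_j u_j E_(1,j+1), resp. \sum_j x_j E_(j+1,1).
   - For n = 1, [Mmx k] with det k = eps = +-1 is diag(eps, eps). *)
Definition Mmx (k : 'M[R]_n) : 'M[R]_n.+1 :=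
  block_mx ((\det k)^-1)%:M 0 0 k : 'M[R]_(1 + n).

Definition Amx (t : R) : 'M[R]_n.+1 :=
  block_mx (expR t)%:M 0 0 (expR (- t / n%:R))%:M : 'M[R]_(1 + n).

Definition Nmx (u : 'rV[R]_n) : 'M[R]_n.+1 :=
  block_mx 1%:M u 0 1%:M : 'M[R]_(1 + n).

Definition Nbar_mx (x : 'cV[R]_n) : 'M[R]_n.+1 :=
  block_mx 1%:M 0 x 1%:M : 'M[R]_(1 + n).

Definition MAN k t u (p : SL R n.+1) : Prop :=
  `|\det k| = 1 /\ val p = Mmx k *m Amx t *m Nmx u.

Definition parabolic : set (SL R n.+1) := [set p | exists k t u, MAN k t u p].

Fact Nbar_subproof x : \det (Nbar_mx x) == 1.
Proof. by rewrite /Nbar_mx (@det_lblock _ 1 n) !det1 mulr1. Qed.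

Definition Nbar x : SL R n.+1 := Sub (Nbar_mx x) (Nbar_subproof x).

(* A sign is a boolean, [true] standing for -. *)
Variables (alpha : bool) (lam : R[i]).

(* The character sgn^alpha * C_lam of M A N_+ at [Mmx k *m Amx t *m Nmx u]. *)
Definition sigma (k : 'M[R]_n) (t : R) : R[i] :=
  ((\det k) ^+ alpha)%:C * cexp (lam * t%:C).

Definition equivariant (f : SL R n.+1 -> R[i]) : Prop :=
  forall g k t u p, MAN k t u p -> f (g * p)%g = (sigma k t)^-1 * f g.

Definition Ind_pred : {pred SL R n.+1 -> R[i]} :=
  mem [set f | smoothSL f /\ equivariant f].

Fact Ind_submod_closed : submod_closed Ind_pred.
Proof.
split; first by rewrite inE; split=> [|g k t u p _]; [exact: smoothSL0|rewrite mulr0].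
move=> c f1 f2; rewrite !inE => -[s1 e1] [s2 e2]; split.
  exact: smoothSL_lin.
move=> g k t u p H; rewrite -![(_ + _ : _ -> _) _]/(_ + _) -![(_ *: _) _]/(_ * _).
by rewrite (e1 _ _ _ _ _ H) (e2 _ _ _ _ _ H) mulrDr mulrCA.
Qed.

HB.instance Definition _ :=
  GRing.isSubmodClosed.Build _ _ Ind_pred Ind_submod_closed.

Definition Ind := {f : SL R n.+1 -> R[i] | f \in Ind_pred}.

HB.instance Definition _ := SubChoice.on Ind.
HB.instance Definition _ := [SubChoice_isSubLmodule of Ind by <:].

Definition Ind_fun (f : Ind) : SL R n.+1 -> R[i] := val f.
Coercion Ind_fun : Ind >-> Funclass.

Fact act_subproof (h : SL R n.+1) (f : Ind) : ltrans h f \in Ind_pred.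
Proof.
have := valP f; rewrite !inE => -[sf ef]; split; first exact: smoothSL_ltrans.
by move=> g k t u p H; rewrite /ltrans mulgA; exact: ef H.
Qed.

Definition act (h : SL R n.+1) (f : Ind) : Ind := Sub (ltrans h f) (act_subproof h f).

(* A subset of G/P is represented by its preimage in G, which is right
   P-invariant, and is closed in G iff the subset is closed for the quotient
   topology.  [Supp f] thus represents the support in G/P of the section [f]. *)
Definition Supp (f : Ind) : set (SL R n.+1) :=
  \bigcap_(Z in [set Z : set (SL R n.+1) | [/\ closed Z,
                           forall g p, Z g -> parabolic p -> Z (g * p)%g &
                           [set g | f g != 0] `<=` Z]]) Z.

(* The section [f] in the chart x |-> g exp(\sum_j x_j N_j^-) P of G/P;
   for [g = 1] this is the restriction to N_-. *)
Definition chart (g : SL R n.+1) (f : Ind) : 'cV[R]_n -> R[i] :=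
  fun x => f (g * Nbar x)%g.

Definition pd (s : seq 'I_n) (F : 'cV[R]_n -> R[i]) : 'cV[R]_n -> R[i] :=
  foldr (fun j => derivC (delta_mx j 0)) F s.

(* The Frechet topology on smooth sections over the compact manifold G/P: uniform
   convergence on compact sets of all partial derivatives in all charts. *)
Definition jets (f : Ind) :
    prod_topology (fun _ : SL R n.+1 * seq 'I_n => {family compact, 'cV[R]_n -> R * R}) :=
  fun i x => let z := pd i.2 (chart i.1 f) x in (complex.Re z, complex.Im z).

HB.instance Definition _ := Topological.copy Ind (initial_topology jets).

End InducedRepresentation.
Arguments Ind {R} n alpha lam.

Section SL3_SL2.
Variable R : realType.

Fact iotaG_subproof (g : SL R 2) :
  \det (block_mx (val g) 0 0 1%:M : 'M[R]_(2 + 1)) == 1.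
Proof. by rewrite det_ublock SL_det det1 mulr1. Qed.

(* The embedding g' |-> diag(g', 1). *)
Definition iotaG (g : SL R 2) : SL R 3 :=
  Sub (block_mx (val g) 0 0 1%:M : 'M[R]_(2 + 1)) (iotaG_subproof g).

(* The sign alpha * (-1)^k. *)
Definition addsgn (alpha : bool) (k : nat) : bool := alpha (+) odd k.

Definition lambda1 alpha (lam : R[i]) m : bool * bool * R[i] * R[i] :=
  (alpha, addsgn alpha m, lam, lam + m%:R).

Definition lambda_plus alpha m l : bool * bool * R[i] * R[i] :=
  (alpha, addsgn alpha m, 1 - (m + l)%:R, 1 + l%:R).

Definition Lambda1 : set (bool * bool * R[i] * R[i]) :=
  [set q | exists alpha lam m, q = lambda1 alpha lam m].

Definition Lambda_plus : set (bool * bool * R[i] * R[i]) :=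
  [set q | exists alpha m l, (1 <= l)%N /\ q = lambda_plus alpha m l].

Lemma Lambda_plus_sub : Lambda_plus `<=` Lambda1.
Proof.
move=> _ [alpha [m [l [_ ->]]]].
exists alpha, (1 - (m + l)%:R), (m + 2 * l)%N; rewrite /lambda1 /lambda_plus.
congr (_, _, _, _); first by rewrite /addsgn oddD oddM addbF.
by rewrite (natrD _ m l) (natrD _ m (2 * l)) natrM; ring.
Qed.

Variables (alpha beta : bool) (lam nu : R[i]).

Definition Diff : set {linear Ind 2 alpha lam -> Ind 1 beta nu} :=
  [set D : {linear Ind 2 alpha lam -> Ind 1 beta nu} |
            [/\ continuous D,
               forall (h : SL R 2) f, D (act (iotaG h) f) = act h (D f) &
               forall f, iotaG @` Supp (D f) `<=` Supp f]].

(* [D] as an operator with values in functions on the line, via the embedding of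
   J(nu)^beta given by restriction to N'_-. *)
Definition restrJ (D : Ind 2 alpha lam -> Ind 1 beta nu) :
    Ind 2 alpha lam -> R -> R[i] :=
  fun f x1 => chart 1%g (D f) (x1 *: delta_mx 0 0).

(* Rest_(x_2 = 0) o (d/dx_2)^m o (d/dx_1)^l, on restrictions to N_-; the factor
   y_1^l / l! is identified with 1. *)
Definition DD (m l : nat) : Ind 2 alpha lam -> R -> R[i] := fun f x1 =>
  iter m (derivC (delta_mx 1 0)) (iter l (derivC (delta_mx 0 0)) (chart 1%g f))
    (x1 *: delta_mx 0 0).

End SL3_SL2.

Arguments Diff {R} alpha beta lam nu.
Arguments DD {R} alpha lam m l.
Arguments lambda_plus R alpha m l.

(* Main.v *)
Require Import Defs.
From HB Require Import structures.
From mathcomp Require Import all_boot all_order all_algebra.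
From mathcomp Require Import all_classical all_reals all_analysis.
From mathcomp.real_closed Require Import complex.
From mathcomp Require Import ring lra zify.

(* A section f in I(triv, lam)^alpha is a function Phi on R^3 \ 0 with
   Phi(c v) = sgn(c)^alpha |c|^(-lam) Phi(v), through f(g) = Phi(g e_0), where
   e_0, e_1, e_2 is the standard basis.  In these terms D_(m,l) extends to G' as
   f |-> (h |-> (d/d(h e_1))^l (d/de_2)^m Phi (h e_0)), which is P'-equivariant
   for l > 0 exactly in the degree where Bol's lemma applies.

   Conversely D is determined by the functional L f = (D f)(1), which only
   depends on the germ of Phi at e_0.  If Phi vanishes to order N along the line
   R e_0, then the family Phi o diag(1, eps^2, eps), cut off away from the line,
   is O(eps^N) with all its derivatives; up to a scalar, diag(1, eps^2, eps) lies
   in the torus A', so covariance and continuity give L f = 0 as soon as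
   N > Re(nu - lam).  Hence L f = \sum c_ij (d/de_1)^i (d/de_2)^j Phi (e_0), a
   finite sum.  Covariance under M'A', tested on functions with one nonzero jet,
   gives nu - lam = 2i + j and beta = alpha + j if c_ij != 0; covariance under the
   shear e_1 |-> e_1 + e_0 gives lam = 1 - (i + j) if moreover i > 0. *)

Set Implicit Arguments.
Unset Strict Implicit.
Unset Printing Implicit Defensive.

Import Order.TTheory GRing.Theory Num.Theory.
Import numFieldNormedType.Exports.
Local Open Scope classical_set_scope.
Local Open Scope complex_scope.
Local Open Scope ring_scope.

Local Notation derivC := Defs.derivC.

(** * Differential calculus *)

(** Differential operators are given by supports and continuity alone, so finite order has to be
    proved. The exponents in diag(1, eps^2, eps) are the weights of A' on the two tangent directions
    at the base point of G/P; both are at least 1, so vanishing to order N gains at least eps^N,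
    while L f is L of the dilated function times a scalar of modulus eps^(-Re(nu - lam)). Continuity
    of L is usable only if every derivative in every chart is controlled, uniformly on compact sets.
    The cutoff is forced: diag(1, eps^2, eps) v tends to v_0 e_0, which is 0 on the hyperplane v_0 =
    0, where Phi may be singular. Locality of L makes the cutoff invisible.

    The conditions 2i + j = nu - lam and i + j = 1 - lam leave only i = nu - 1, j = 2 - lam - nu, so
    at most one operator with i > 0 joins the one with i = 0. The value 1 - (i + j) comes from the
    monomial v_1^(i-1) v_2^j, which L kills because its weight is wrong: the shear turns its factor
    v_0^(-(lam + i - 1 + j)) into the same power of v_0 + v_1, whose derivative along e_1 must then
    vanish. *)

Lemma dist_triangle (R : realDomainType) (p q r : R) :
  `|p - q| <= `|p - r| + `|q - r|.
Proof. by rewrite [`|q - r|]distrC ler_distD. Qed.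

Section Calculus.
Variables (R : realType) (V : normedModType R).
Implicit Types (U : set V) (v w x : V) (F G : V -> R).

Lemma is_derive_line F x v (t : R) : derivable F (t *: v + x) v ->
  is_derive t (1 : R) (fun s : R => F (s *: v + x)) ('D_v F (t *: v + x)).
Proof.
move=> d.
have E : (fun h : R => h^-1 *: (((fun s : R => F (s *: v + x)) \o shift t) (h *: 1) -
            F (t *: v + x))) =
         (fun h => h^-1 *: ((F \o shift (t *: v + x)) (h *: v) - F (t *: v + x))).
  apply/funext => h /=; congr (_ *: (F _ - _)).
  by rewrite [h *: 1]mulr1 scalerDl addrA.
by split; rewrite /derivable /derive E.
Qed.

(** The sign of [a] is left free, so the intermediate point is located only by its absolute value;
    the two cases put the endpoints in the order that [MVT_segment] requires. *)
Lemma line_MVT F x v (a : R) :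
  (forall t : R, `|t| <= `|a| -> derivable F (t *: v + x) v) ->
  exists2 t : R, `|t| <= `|a| & F (a *: v + x) - F x = a * 'D_v F (t *: v + x).
Proof.
move=> dF; pose f (s : R) := F (s *: v + x).
have df (t : R) : `|t| <= `|a| -> is_derive t (1 : R) f ('D_v F (t *: v + x)).
  by move=> /dF; exact: is_derive_line.
have f0 : f 0 = F x by rewrite /f scale0r add0r.
have fc (b c : R) : (forall t, t \in `[b, c] -> `|t| <= `|a|) ->
    {within `[b, c], continuous f}.
  move=> bc; apply: derivable_within_continuous => t /bc /df dt; exact: ex_derive.
have [a0|a0] := leP 0 a.
  have sub t : t \in `[0, a] -> `|t| <= `|a|.
    by rewrite in_itv /= => /andP[t0 ta]; rewrite !ger0_norm.
  have [|c cI E] := @MVT_segment _ f (fun t => 'D_v F (t *: v + x)) _ _ a0 _ (fc _ _ sub).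
    by move=> t tI; apply: df; apply: sub; apply: subset_itv_oo_cc tI.
  by exists c; [exact: sub|rewrite -f0 [LHS]E subr0 mulrC].
have sub t : t \in `[a, 0] -> `|t| <= `|a|.
  by rewrite in_itv /= => /andP[t0 ta]; rewrite (ler0_norm ta) (ltr0_norm a0) lerN2.
have [|c cI E] := @MVT_segment _ f (fun t => 'D_v F (t *: v + x)) _ _ (ltW a0) _ (fc _ _ sub).
  by move=> t tI; apply: df; apply: sub; apply: subset_itv_oo_cc tI.
exists c; first exact: sub.
by rewrite -f0 -[LHS]opprB [X in - X]E sub0r mulrN opprK mulrC.
Qed.

Lemma CkS k U F : Ck k.+1 U F -> Ck k U F.
Proof.
elim: k F => [|k IH] F [cF dF]; first by split.
split=> // v; have [dFv CF] := dF v; split=> //; exact: IH.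
Qed.

Lemma Ck_continuous k U F x : Ck k U F -> U x -> {for x, continuous F}.
Proof. by case: k => [|k] [+ _]; apply. Qed.

Lemma Ck_derivable k U F x v : Ck k.+1 U F -> U x -> derivable F x v.
Proof. by move=> [_ /(_ v)[+ _]]; apply. Qed.

Lemma Ck_derive k U F v : Ck k.+1 U F -> Ck k U ('D_v F).
Proof. by move=> [_ /(_ v)[]]. Qed.

(** [Ck] is a condition at each point of [U] on derivatives taken in all of [V], so it can be
    checked one point at a time, on any set containing the point. *)
Lemma Ck_loc k U F :
  (forall x, U x -> exists2 U', U' x & Ck k U' F) -> Ck k U F.
Proof.
elim: k F => [|k IH] F H /=.
  by split=> // x /H[U' U'x [+ _]]; apply.
split; first by move=> x /H[U' U'x [+ _]]; apply.
move=> v; split; first by move=> x /H[U' U'x] /Ck_derivable; apply.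
by apply: IH => x /H[U' U'x C]; exists U' => //; apply: Ck_derive.
Qed.

Lemma Ck_mul k U F G : open U -> Ck k U F -> Ck k U G ->
  Ck k U (fun x => F x * G x).
Proof.
move=> oU; elim: k F G => [|k IH] F G CF CG.
  split=> // x Ux; apply: cvgM; [exact: Ck_continuous CF Ux|exact: Ck_continuous CG Ux].
split.
  move=> x Ux; apply: cvgM; [exact: Ck_continuous CF Ux|exact: Ck_continuous CG Ux].
move=> v.
have D x : U x -> is_derive x v (fun x => F x * G x) (F x *: 'D_v G x + G x *: 'D_v F x).
  move=> Ux; have := is_deriveM (derivableP (Ck_derivable (v := v) CF Ux))
     (derivableP (Ck_derivable (v := v) CG Ux)); exact.
split; first by move=> x /D[].
have H1 := IH _ _ (CkS CF) (Ck_derive v CG).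
have H2 := IH _ _ (CkS CG) (Ck_derive v CF).
apply: Ck_ext (Ck_lin 1 1 oU H1 H2) => // x; rewrite inE => /D [_ ->].
by rewrite !mul1r.
Qed.

Lemma Ck_scale k U F (a : R) : open U -> Ck k U F -> Ck k U (fun x => a * F x).
Proof. by move=> oU CF; apply: Ck_mul => //; exact: Ck_cst. Qed.

Lemma Ck_add k U F G : open U -> Ck k U F -> Ck k U G -> Ck k U (fun x => F x + G x).
Proof.
move=> oU CF CG; apply: Ck_ext (Ck_lin 1 1 oU CF CG) => // x _.
by rewrite !mul1r.
Qed.

Lemma Ck_sum (I : Type) (s : seq I) k U (F : I -> V -> R) : open U ->
  (forall i, Ck k U (F i)) -> Ck k U (fun x => \sum_(i <- s) F i x).
Proof.
move=> oU CF; elim: s => [|i s IH].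
  by apply: Ck_ext (Ck_cst k U (0 : R)) => // x _; rewrite big_nil.
by apply: Ck_ext (Ck_add oU (CF i) IH) => // x _; rewrite big_cons.
Qed.

Lemma Ck_exp k U F n : open U -> Ck k U F -> Ck k U (fun x => F x ^+ n).
Proof.
move=> oU CF; elim: n => [|n IH]; first exact: (Ck_cst k U (1 : R)).
by apply: Ck_ext (Ck_mul oU CF IH) => // x _; rewrite exprS.
Qed.

Lemma derive_linear (l : {linear V -> R}) v x : is_derive x v l (l v).
Proof.
have E : (fun h : R => h^-1 *: ((l \o shift x) (h *: v) - l x)) @ 0^' --> l v.
  apply: (@cvg_trans _ ((fun=> l v) @ 0^')); last exact: cvg_cst.
  apply: near_eq_cvg; near=> h => /=.
  rewrite (linearP l) addrK scalerA mulVf ?scale1r //.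
  near: h; exact: nbhs_dnbhs_neq.
by split; [apply: cvgP E|apply: cvg_lim E].
Unshelve. all: by end_near. Qed.

Lemma Ck_linear k U (l : {linear V -> R}) : continuous l -> Ck k U l.
Proof.
move=> cl; case: k => [|k]; (split; first by move=> x _; apply: cl) => //.
move=> v; split; first by move=> x _; have [] := derive_linear l v x.
have -> : 'D_v l = (fun=> l v).
  by apply/funext => x; have [_ ->] := derive_linear l v x.
exact: Ck_cst.
Qed.

(** A first-order expansion whose base point [y t] moves: [r t] is the derivative at an intermediate
    point of the segment, hence converges by continuity of ['D_e F]. The moving base point is what
    lets [derive_path] change one direction at a time. *)
Lemma increment (T : Type) (FF : set_system T) {PF : ProperFilter FF} U F x e
  (y : T -> V) (c : T -> R) : open U -> Ck 1 U F -> U x ->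
  y @ FF --> x -> c @ FF --> (0 : R) ->
  exists2 r : T -> R, r @ FF --> 'D_e F x &
    \forall t \near FF, F (c t *: e + y t) - F (y t) = c t * r t.
Proof.
move=> oU CF Ux yx c0.
(* Where [F] is not derivable along the whole segment, [r] defaults to 0; [nearP] shows that this
   eventually stops happening. *)
have H t : exists r, (forall s : R, `|s| <= `|c t| -> derivable F (s *: e + y t) e) ->
    exists2 s : R, `|s| <= `|c t| & r = 'D_e F (s *: e + y t) /\
      F (c t *: e + y t) - F (y t) = c t * r.
  have [h|nh] := pselect (forall s : R, `|s| <= `|c t| -> derivable F (s *: e + y t) e).
    by have [s sc E] := line_MVT h; exists ('D_e F (s *: e + y t)) => _; exists s.
  by exists 0.
have [r rP] := choice H.
have nearP (P : V -> Prop) : (\forall z \near x, P z) ->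
    \forall t \near FF, forall s : R, `|s| <= `|c t| -> P (s *: e + y t).
  move=> /nbhs_ballP[d d0 dP].
  have yn : \forall t \near FF, ball x (d / 2) (y t).
    by apply: yx; apply: nbhsx_ballx; rewrite divr_gt0.
  have cn : \forall t \near FF, `|c t| * `|e| < d / 2.
    have H0 : (fun t => `|c t| * `|e|) @ FF --> `|0 : R| * `|e|.
      by apply: cvgM; [exact: cvg_norm|exact: cvg_cst].
    by rewrite normr0 mul0r in H0; apply: cvgr_lt H0 _ _; rewrite divr_gt0.
  near=> t => s sc; apply: dP.
  rewrite [d]splitr; apply: (@ball_triangle _ _ (y t)); first by near: t.
  rewrite -ball_normE /= opprD addrCA subrr addr0 normrN normrZ.
  by apply: le_lt_trans (near cn t _) => //; rewrite ler_wpM2r.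
have dn : \forall z \near x, derivable F z e.
  apply: filterS (open_nbhs_nbhs (conj oU Ux)) => z Uz.
  exact: Ck_derivable CF Uz.
exists r; last first.
  apply: filterS (nearP _ dn) => t /(rP t)[s _ [_ ->]] //.
move=> W WD; have CD := Ck_continuous (Ck_derive e CF) Ux.
have WD' : \forall z \near x, W ('D_e F z) by exact: CD.
apply: filterS2 (nearP _ dn) (nearP _ WD') => t /(rP t)[s sc [E _]] /(_ _ sc).
by rewrite -E.
Unshelve. all: by end_near. Qed.

(** The chain rule along a curve, from continuous directional derivatives only: the increment
    telescopes over [s], and each term is an instance of [increment]. *)
Lemma derive_path (I : Type) (s : seq I) U F x (e : I -> V) (c : I -> R -> R)
    (c' : I -> R) : open U -> Ck 1 U F -> U x ->
  (forall i, (fun h => h^-1 * c i h) @ 0^' --> c' i) ->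
  (fun h => h^-1 * (F (\sum_(i <- s) c i h *: e i + x) - F x)) @ 0^' -->
    \sum_(i <- s) c' i * 'D_(e i) F x.
Proof.
move=> oU CF Ux cP.
have c0 i : c i @ 0^' --> (0 : R).
  have H : (fun h : R => h * (h^-1 * c i h)) @ 0^' --> 0 * c' i.
    by apply: cvgM => //; exact: nbhs_dnbhs.
  rewrite mul0r in H; apply: cvg_trans H; apply: near_eq_cvg.
  near=> h; rewrite mulVKf //; near: h; exact: nbhs_dnbhs_neq.
have y0 (s' : seq I) : (fun h => \sum_(i <- s') c i h *: e i + x) @ 0^' --> x.
  elim: s' => [|i s' IH].
    under eq_fun do rewrite big_nil add0r; exact: cvg_cst.
  under eq_fun do rewrite big_cons -addrA.
  have H : (fun h => c i h *: e i + (\sum_(j <- s') c j h *: e j + x)) @ 0^' -->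
      (0 : R) *: e i + x.
    by apply: cvgD IH; apply: cvgZr_tmp; exact: c0.
  by rewrite scale0r add0r in H.
elim: s => [|i s IH].
  under eq_fun do rewrite !big_nil add0r subrr mulr0.
  rewrite big_nil; exact: cvg_cst.
have [r rD rE] := @increment _ _ _ U F x (e i) _ _ oU CF Ux (y0 s) (c0 i).
rewrite big_cons.
have H : (fun h : R => h^-1 * c i h * r h +
    h^-1 * (F (\sum_(i <- s) c i h *: e i + x) - F x)) @ 0^' -->
    c' i * 'D_(e i) F x + \sum_(i <- s) c' i * 'D_(e i) F x.
  by apply: cvgD => //; apply: cvgM.
apply: cvg_trans H; apply: near_eq_cvg; apply: filterS rE => h E.
by rewrite big_cons -mulrA -E -mulrDr -!addrA; congr (_ * (_ + _)); rewrite addKr.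
Unshelve. all: by end_near. Qed.

Lemma derive_dir_sum (I : Type) (s : seq I) U F x (e : I -> V) (c : I -> R) :
  open U -> Ck 1 U F -> U x ->
  'D_(\sum_(i <- s) c i *: e i) F x = \sum_(i <- s) c i * 'D_(e i) F x.
Proof.
move=> oU CF Ux; apply: cvg_lim => //=.
have H := @derive_path I s U F x e (fun i h => h * c i) c oU CF Ux.
apply: cvg_trans (H _); last first.
  move=> i; apply: (@cvg_trans _ ((fun=> c i) @ 0^')); last exact: cvg_cst.
  apply: near_eq_cvg; near=> h; rewrite mulKf //; near: h; exact: nbhs_dnbhs_neq.
apply: near_eq_cvg; near=> h => /=; congr (_ * (F (_ + _) - _)).
by rewrite scaler_sumr; apply: eq_bigr => i _; rewrite scalerA.
Unshelve. all: by end_near. Qed.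

Lemma derive_dirP U F x v w (a : R) : open U -> Ck 1 U F -> U x ->
  'D_(a *: v + w) F x = a * 'D_v F x + 'D_w F x.
Proof.
move=> oU CF Ux.
have := @derive_dir_sum _ [:: (a, v); (1, w)] U F x snd fst oU CF Ux.
by rewrite !big_cons !big_nil /= !addr0 scale1r mul1r.
Qed.

(** The mean value theorem is applied in direction [v] to the difference [G], then in direction [w]
    to ['D_v F]. The left side is symmetric in [v] and [w], which yields Schwarz's theorem in
    [derive_comm]. *)
Lemma second_difference U F x v w (h : R) : Ck 2 U F ->
  (forall s t : R, `|s| <= `|h| -> `|t| <= `|h| -> U (s *: w + (t *: v + x))) ->
  exists s t : R, [/\ `|s| <= `|h|, `|t| <= `|h| &
    F (h *: w + (h *: v + x)) - F (h *: v + x) - (F (h *: w + x) - F x) =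
    h * (h * 'D_w ('D_v F) (s *: w + (t *: v + x)))].
Proof.
move=> CF HU; pose G y := F (h *: w + y) - F y.
have dS (z y : V) : derivable F (z + y) v ->
    is_derive y v (fun y => F (z + y)) ('D_v F (z + y)).
  move=> d; have E : (fun h : R => h^-1 *: (((fun y => F (z + y)) \o shift y) (h *: v)
     - F (z + y))) = (fun h => h^-1 *: ((F \o shift (z + y)) (h *: v) - F (z + y))).
    by apply/funext => k /=; rewrite addrCA.
  by split; rewrite /derivable /derive E.
have dG (t : R) : `|t| <= `|h| -> is_derive (t *: v + x) v G
    ('D_v F (h *: w + (t *: v + x)) - 'D_v F (t *: v + x)).
  move=> th; apply: is_deriveB.
    by apply: dS; apply: (Ck_derivable CF); apply: HU.
  apply: derivableP; apply: (Ck_derivable CF).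
  by have := HU 0 t; rewrite scale0r add0r normr0; apply.
have [|t th E] := @line_MVT G x v h; first by move=> t /dG[].
rewrite -/(G _) -/(G _) {}E; have [_ ->] := dG t th.
have [s sh E|s sh ->] := @line_MVT ('D_v F) (t *: v + x) w h.
  by apply: (Ck_derivable (Ck_derive v CF)); apply: HU.
by exists s, t.
Qed.

Lemma derive_comm U F x v w : open U -> Ck 2 U F -> U x ->
  'D_w ('D_v F) x = 'D_v ('D_w F) x.
Proof.
move=> oU CF Ux.
apply/eqP; rewrite -subr_eq0 -normr_le0; apply/ler_addgt0Pr => e e0.
rewrite add0r; have e2 : 0 < e / 2 by rewrite divr_gt0.
have cont v1 w1 : \forall z \near x, `|'D_w1 ('D_v1 F) x - 'D_w1 ('D_v1 F) z| < e / 2.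
  have := Ck_continuous (Ck_derive w1 (Ck_derive v1 CF)) Ux.
  by move/cvgrPdist_lt/(_ _ e2).
have /nbhs_ballP[d d0 dP] : \forall z \near x, [/\ U z,
    `|'D_w ('D_v F) x - 'D_w ('D_v F) z| < e / 2 &
    `|'D_v ('D_w F) x - 'D_v ('D_w F) z| < e / 2].
  by apply: filterS3 (open_nbhs_nbhs (conj oU Ux)) (cont v w) (cont w v) => z.
(* The [+ 1] keeps the denominator positive when [v] and [w] both vanish; with this [h] the
   parallelogram at [x] stays in the ball of radius [d]. *)
pose h := d / (2 * (`|v| + `|w| + 1)).
have D0 : 0 < `|v| + `|w| + 1 by rewrite ltr_wpDl.
have h0 : 0 < h by rewrite divr_gt0 // mulr_gt0.
have hb (a b : V) (s t : R) : `|a| + `|b| <= `|v| + `|w| ->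
    `|s| <= `|h| -> `|t| <= `|h| -> ball x d (s *: a + (t *: b + x)).
  move=> ab sh th; rewrite -ball_normE /= addrA opprD addrCA subrr addr0 normrN.
  apply: (@le_lt_trans _ _ (h * (`|v| + `|w|))).
    apply: le_trans (ler_normD _ _) _; rewrite !normrZ.
    rewrite (gtr0_norm h0) in sh th.
    apply: (@le_trans _ _ (h * (`|a| + `|b|))); last by rewrite (ler_wpM2l (ltW h0)).
    by rewrite mulrDr lerD // ler_wpM2r.
  rewrite /h mulrAC ltr_pdivrMr ?mulr_gt0 // ltr_pM2l //.
  by have := normr_ge0 v; have := normr_ge0 w; lra.
have [s [t [sh th E]]] : exists s t : R, _ := @second_difference U F x v w h CF
   (fun s t sh th => let: And3 u _ _ := dP _ (hb w v s t ltac:(by rewrite addrC) sh th) in u).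
have [s' [t' [sh' th' E']]] : exists s t : R, _ := @second_difference U F x w v h CF
   (fun s t sh th => let: And3 u _ _ := dP _ (hb v w s t (lexx _) sh th) in u).
have [_ H1 _] := dP _ (hb w v s t ltac:(by rewrite addrC) sh th).
have [_ _ H2] := dP _ (hb v w s' t' (lexx _) sh' th').
have EE : 'D_w ('D_v F) (s *: w + (t *: v + x)) = 'D_v ('D_w F) (s' *: v + (t' *: w + x)).
  apply: (@mulfI _ h); first by rewrite gt_eqF.
  apply: (@mulfI _ h); first by rewrite gt_eqF.
  apply: etrans (esym E) _; apply: etrans _ E'; rewrite [h *: v + (h *: w + x)]addrCA.
  have ABCD (p q r u : R) : p - q - (r - u) = p - r - (q - u) by ring.
  exact: ABCD.
rewrite [e]splitr; apply: le_trans (ltW (ltrD H1 H2)); rewrite EE.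
set p := 'D_w ('D_v F) x; set q := 'D_v ('D_w F) x; set r := 'D_v _ _.
exact: dist_triangle.
Unshelve. all: by end_near. Qed.


Lemma is_derive_comp1 (g : R -> R) F x v (a b : R) :
  is_derive (F x) (1 : R) g a -> is_derive x v F b -> is_derive x v (g \o F) (a * b).
Proof.
move=> dg dF.
have H : is_derive (0 : R) (1 : R) (fun t : R => F (t *: v + x)) b.
  have d0 : derivable F ((0 : R) *: v + x) v by rewrite scale0r add0r; case: dF.
  apply: is_derive_eq (is_derive_line d0) _.
  by rewrite scale0r add0r; case: dF.
have dg0 : is_derive (F ((0 : R) *: v + x)) (1 : R) g a by rewrite scale0r add0r.
have [D E] := is_derive1_comp dg0 H.
have Q : (fun h : R => h^-1 *: (((g \o F) \o shift x) (h *: v) - (g \o F) x)) =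
   (fun h : R => h^-1 *: (((g \o (fun t : R => F (t *: v + x))) \o shift 0) (h *: 1)
       - (g \o (fun t : R => F (t *: v + x))) 0)).
  by apply/funext => h /=; rewrite addr0 [h *: 1]mulr1 scale0r add0r.
by split; [rewrite /derivable Q|rewrite /derive Q -E].
Qed.

(** The whole sequence of derivatives is given at once, so that [Ck_comp1] can run its induction on
    the order simultaneously for all terms [d n]. *)
Definition smooth1 (I : set R) (f : R -> R) :=
  exists2 d : nat -> R -> R, d 0 = f &
    forall n (x : R), I x -> is_derive x (1 : R) (d n) (d n.+1 x).

Lemma Ck_comp1 k U (I : set R) (f : R -> R) F : open U -> smooth1 I f ->
  (forall x, U x -> I (F x)) -> Ck k U F -> Ck k U (fun x => f (F x)).
Proof.
move=> oU [d <- dP] UI; elim: k 0 => [|k IH] n CF.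
  split=> // x Ux; apply: continuous_comp; first exact: Ck_continuous CF Ux.
  apply/differentiable_continuous/derivable1_diffP.
  by have [] := dP n _ (UI _ Ux).
split.
  move=> x Ux; apply: continuous_comp; first exact: Ck_continuous CF Ux.
  apply/differentiable_continuous/derivable1_diffP.
  by have [] := dP n _ (UI _ Ux).
move=> v.
have D x : U x -> is_derive x v (fun x => d n (F x)) (d n.+1 (F x) * 'D_v F x).
  move=> Ux; apply: is_derive_comp1; first exact: dP (UI _ Ux).
  apply: derivableP; exact: Ck_derivable CF Ux.
split; first by move=> x /D[].
apply: Ck_ext (Ck_mul oU (IH n.+1 (CkS CF)) (Ck_derive v CF)) => // x.
by rewrite inE => /D [_ ->].
Qed.

End Calculus.

(** * Composition with matrix-valued maps *)

Section ChainRule.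
Variables (R : realType) (W : normedModType R) (p q : nat).
Implicit Types (phi : W -> 'M[R]_(p, q)) (F : 'M[R]_(p, q) -> R).

Lemma mx_continuous phi x :
  (forall i j, {for x, continuous (fun y => phi y i j)}) -> {for x, continuous phi}.
Proof.
move=> cphi A [P PA sPA].
have H : \forall y \near x, forall i j, P i j (phi y i j).
  apply: filter_forall => i; apply: filter_forall => j; exact: cphi (PA i j).
by apply: filterS H => y Py; exact: sPA.
Qed.

Lemma is_derive_chain phi F U x v : open U -> Ck 1 U F -> U (phi x) ->
  (forall i j, derivable (fun y => phi y i j) x v) ->
  is_derive x v (F \o phi)
    (\sum_ij 'D_v (fun y => phi y ij.1 ij.2) x * 'D_(delta_mx ij.1 ij.2) F (phi x)).
Proof.
move=> oU CF Ux dphi.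
have H := @derive_path _ _ _ (index_enum ('I_p * 'I_q)%type) U F (phi x)
  (fun ij => delta_mx ij.1 ij.2)
  (fun ij h => phi (h *: v + x) ij.1 ij.2 - phi x ij.1 ij.2)
  (fun ij => 'D_v (fun y => phi y ij.1 ij.2) x) oU CF Ux _.
have {}H := H (fun ij => dphi ij.1 ij.2).
have E : (fun h : R => h^-1 *: (((F \o phi) \o shift x) (h *: v) - (F \o phi) x)) =
  (fun h => h^-1 * (F (\sum_ij (phi (h *: v + x) ij.1 ij.2 - phi x ij.1 ij.2) *:
    delta_mx ij.1 ij.2 + phi x) - F (phi x))).
  apply/funext => h /=; congr (_ *: (F _ - _)).
  rewrite -[phi (h *: v + x) in LHS](subrK (phi x)); congr (_ + _).
  rewrite [LHS]matrix_sum_delta pair_big /=; apply: eq_bigr => -[i j] _ /=.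
  by rewrite !mxE.
by split; rewrite /derivable /derive E; [apply: cvgP H|apply: cvg_lim H].
Qed.

Lemma Ck_chain k phi F U U' : open U -> open U' -> Ck k U F ->
  (forall x, U' x -> U (phi x)) -> (forall i j, Ck k U' (fun x => phi x i j)) ->
  Ck k U' (F \o phi).
Proof.
move=> oU oU'; elim: k F => [|k IH] F CF UU Cphi.
all: have cc x : U' x -> {for x, continuous (F \o phi)}
  by move=> Ux; apply: continuous_comp;
    [apply: mx_continuous => i j; exact: Ck_continuous (Cphi i j) Ux
    |exact: Ck_continuous CF (UU _ Ux)].
  by split.
split=> // v.
have C1 : Ck 1 U F.
  elim: (k) CF => [|k' IH'] // /CkS; exact: IH'.
have D x (Ux : U' x) := is_derive_chain oU C1 (UU _ Ux)
  (fun i j => Ck_derivable (v := v) (Cphi i j) Ux).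
split; first by move=> x /D[].
apply: Ck_ext (Ck_sum (index_enum _) oU' (F := fun ij y => 'D_v (fun y => phi y ij.1 ij.2) y *
   'D_(delta_mx ij.1 ij.2) F (phi y)) _) => //.
  by move=> x; rewrite inE => /D[_ ->].
move=> ij; apply: Ck_mul => //; first exact: Ck_derive.
apply: (IH ('D_(delta_mx ij.1 ij.2) F)) => //; first exact: Ck_derive.
by move=> i j; apply: CkS.
Qed.

End ChainRule.

(** * Complex-valued functions *)

Section ComplexCalculus.
Variable R : realType.

Lemma Re_add (x y : R[i]) : complex.Re (x + y) = complex.Re x + complex.Re y.
Proof. by case: x; case: y. Qed.
Lemma Im_add (x y : R[i]) : complex.Im (x + y) = complex.Im x + complex.Im y.
Proof. by case: x; case: y. Qed.
Lemma Re_mul (x y : R[i]) : complex.Re (x * y) =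
  complex.Re x * complex.Re y - complex.Im x * complex.Im y.
Proof. by case: x; case: y. Qed.
Lemma Im_mul (x y : R[i]) : complex.Im (x * y) =
  complex.Re x * complex.Im y + complex.Im x * complex.Re y.
Proof. by case: x; case: y. Qed.
Lemma complex_eq (x y : R[i]) :
  complex.Re x = complex.Re y -> complex.Im x = complex.Im y -> x = y.
Proof. by case: x => ? ?; case: y => ? ? /= -> ->. Qed.

Section Basics.
Variable V : normedModType R.
Implicit Types (U : set V) (v w x : V) (F G : V -> R[i]) (f g : V -> R).

Lemma smooth_on_ext U F G : open U -> (forall x, U x -> F x = G x) ->
  smooth_on U F -> smooth_on U G.
Proof.
move=> oU FG sF k; have [rF iF] := sF k.
by split; [apply: Ck_ext rF|apply: Ck_ext iF] => // x; rewrite inE => /FG ->.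
Qed.

Lemma smooth_on_loc U F :
  (forall x, U x -> exists2 U', U' x & smooth_on U' F) -> smooth_on U F.
Proof.
move=> H k; split; apply: Ck_loc => x /H[U' U'x sF]; exists U' => //;
  by have [] := sF k.
Qed.

Lemma smooth_on_cst U (c : R[i]) : smooth_on U (fun=> c).
Proof. by move=> k; split; apply: Ck_cst. Qed.

Lemma smooth_on_real U f : (forall k, Ck k U f) -> smooth_on U (fun x => (f x)%:C).
Proof. by move=> sf k; split; [exact: sf|exact: Ck_cst]. Qed.

Lemma smooth_on_mul U F G : open U -> smooth_on U F -> smooth_on U G ->
  smooth_on U (fun x => F x * G x).
Proof.
move=> oU sF sG k; have [rF iF] := sF k; have [rG iG] := sG k.
split.
  apply: Ck_ext (Ck_lin 1 (-1) oU (Ck_mul oU rF rG) (Ck_mul oU iF iG)) => // x _.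
  by rewrite Re_mul mul1r mulN1r.
apply: Ck_ext (Ck_lin 1 1 oU (Ck_mul oU rF iG) (Ck_mul oU iF rG)) => // x _.
by rewrite Im_mul !mul1r.
Qed.

Lemma smooth_on_scale U F (c : R[i]) : open U -> smooth_on U F ->
  smooth_on U (fun x => c * F x).
Proof. by move=> oU sF; apply: smooth_on_mul => //; exact: smooth_on_cst. Qed.

Lemma smooth_on_add U F G : open U -> smooth_on U F -> smooth_on U G ->
  smooth_on U (fun x => F x + G x).
Proof.
move=> oU sF sG; apply: smooth_on_ext (smooth_on_lin 1 oU sF sG) => // x _.
by rewrite mul1r.
Qed.

Lemma smooth_on_derivC U F v : smooth_on U F -> smooth_on U (derivC v F).
Proof. by move=> sF k; have [rF iF] := sF k.+1; split; apply: Ck_derive. Qed.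

Lemma smooth_on_iter U F v n : smooth_on U F -> smooth_on U (iter n (derivC v) F).
Proof. by move=> sF; elim: n => //= n IH; exact: smooth_on_derivC. Qed.

Lemma near_derivC F G x v : (\forall y \near x, F y = G y) ->
  derivC v F x = derivC v G x.
Proof.
by move=> FG; rewrite /derivC; congr (_ +i* _); apply: near_eq_derive;
  apply: filterS FG => y ->.
Qed.

Lemma derivC_ext U F G v : open U -> (forall x, U x -> F x = G x) ->
  forall x, U x -> derivC v F x = derivC v G x.
Proof.
move=> oU FG x Ux; apply: near_derivC.
by apply: filterS (open_nbhs_nbhs (conj oU Ux)) => y; exact: FG.
Qed.

Lemma iter_derivC_ext U F G v n : open U -> (forall x, U x -> F x = G x) ->
  forall x, U x -> iter n (derivC v) F x = iter n (derivC v) G x.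
Proof. by move=> oU FG; elim: n => //= n IH; exact: derivC_ext. Qed.

Lemma derivC_cst (c : R[i]) x v : derivC v (fun=> c) x = 0.
Proof. by rewrite /derivC !derive_cst. Qed.

Lemma derivC_real f x v : derivC v (fun x => (f x)%:C) x = ('D_v f x)%:C.
Proof. by rewrite /derivC /= derive_cst. Qed.

Lemma derivC_mul U F G x v : smooth_on U F -> smooth_on U G -> U x ->
  derivC v (fun x => F x * G x) x = derivC v F x * G x + F x * derivC v G x.
Proof.
move=> sF sG Ux; have [rF iF] := sF 1%N; have [rG iG] := sG 1%N.
have D (f g : V -> R) : Ck 1 U f -> Ck 1 U g -> is_derive x v (fun x => f x * g x)
    (f x * 'D_v g x + g x * 'D_v f x).
  move=> Cf Cg; have := is_deriveM (derivableP (Ck_derivable (v := v) Cf Ux))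
     (derivableP (Ck_derivable (v := v) Cg Ux)); exact.
apply: complex_eq.
  rewrite Re_add !Re_mul /=.
  have -> : (fun y => complex.Re (F y * G y)) = (fun y => complex.Re (F y) *
    complex.Re (G y) - complex.Im (F y) * complex.Im (G y)).
    by apply/funext => y; rewrite Re_mul.
  have [_ ->] := is_deriveB (D _ _ rF rG) (D _ _ iF iG).
  ring.
rewrite Im_add !Im_mul /=.
have -> : (fun y => complex.Im (F y * G y)) = (fun y => complex.Re (F y) *
  complex.Im (G y) + complex.Im (F y) * complex.Re (G y)).
  by apply/funext => y; rewrite Im_mul.
have [_ ->] := is_deriveD (D _ _ rF iG) (D _ _ iF rG).
ring.
Qed.

Lemma derivC_add U F G x v : smooth_on U F -> smooth_on U G -> U x ->
  derivC v (fun x => F x + G x) x = derivC v F x + derivC v G x.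
Proof.
move=> sF sG Ux; have [rF iF] := sF 1%N; have [rG iG] := sG 1%N.
rewrite /derivC; apply: complex_eq.
  have -> : (fun y => complex.Re (F y + G y)) =
    (fun y => complex.Re (F y) + complex.Re (G y)).
    by apply/funext => y; rewrite Re_add.
  rewrite Re_add /=; by rewrite deriveD //; apply: Ck_derivable Ux; eassumption.
have -> : (fun y => complex.Im (F y + G y)) =
  (fun y => complex.Im (F y) + complex.Im (G y)).
  by apply/funext => y; rewrite Im_add.
rewrite Im_add /=; by rewrite deriveD //; apply: Ck_derivable Ux; eassumption.
Qed.

Lemma derivC_scale U F (c : R[i]) x v : smooth_on U F -> U x ->
  derivC v (fun x => c * F x) x = c * derivC v F x.
Proof.
move=> sF Ux; rewrite (derivC_mul v (smooth_on_cst U c) sF Ux).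
by rewrite derivC_cst mul0r add0r.
Qed.

Lemma iter_derivC_add U F G v n x : open U -> smooth_on U F -> smooth_on U G -> U x ->
  iter n (derivC v) (fun x => F x + G x) x =
  iter n (derivC v) F x + iter n (derivC v) G x.
Proof.
move=> oU sF sG; elim: n x => //= n IH x Ux.
rewrite (derivC_ext v oU IH Ux).
by apply: (derivC_add (U := U)) => //; exact: smooth_on_iter.
Qed.

Lemma iter_derivC_scale U F (c : R[i]) v n x : open U -> smooth_on U F -> U x ->
  iter n (derivC v) (fun x => c * F x) x = c * iter n (derivC v) F x.
Proof.
move=> oU sF; elim: n x => //= n IH x Ux.
rewrite (derivC_ext v oU IH Ux).
by apply: (derivC_scale (U := U)) => //; exact: smooth_on_iter.
Qed.

Lemma iter_derivC0 v n x : iter n (derivC v) (fun=> 0 : R[i]) x = 0.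
Proof.
elim: n x => //= n IH x; rewrite -[RHS](derivC_cst 0 x v); congr (derivC v _ x).
by apply/funext => y; rewrite IH.
Qed.

Lemma derivC_comm U F x v w : open U -> smooth_on U F -> U x ->
  derivC v (derivC w F) x = derivC w (derivC v F) x.
Proof.
move=> oU sF Ux; have [rF iF] := sF 2%N.
by rewrite /derivC /= (derive_comm w v oU rF Ux) (derive_comm w v oU iF Ux).
Qed.

Lemma iter_derivC_comm1 U F v w n x : open U -> smooth_on U F -> U x ->
  iter n (derivC v) (derivC w F) x = derivC w (iter n (derivC v) F) x.
Proof.
move=> oU sF; elim: n x => //= n IH x Ux.
rewrite (derivC_ext v oU IH Ux).
by apply: (derivC_comm v w oU) => //; exact: smooth_on_iter.
Qed.

Lemma iter_derivC_comm U F v w m n x : open U -> smooth_on U F -> U x ->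
  iter m (derivC v) (iter n (derivC w) F) x = iter n (derivC w) (iter m (derivC v) F) x.
Proof.
move=> oU sF; elim: n x => //= n IH x Ux.
rewrite (iter_derivC_comm1 v w m oU) //; last exact: smooth_on_iter.
exact: derivC_ext Ux.
Qed.

Lemma derivC_dirP U F x v w (a : R) : open U -> smooth_on U F -> U x ->
  derivC (a *: v + w) F x = a%:C * derivC v F x + derivC w F x.
Proof.
move=> oU sF Ux; have [rF iF] := sF 1%N.
rewrite /derivC (derive_dirP _ _ _ oU rF Ux) (derive_dirP _ _ _ oU iF Ux).
by apply: complex_eq; rewrite ?Re_add ?Im_add ?Re_mul ?Im_mul /=; ring.
Qed.

Lemma derivC_dir0 F x : derivC 0 F x = 0.
Proof. by rewrite /derivC !derive0. Qed.

Lemma derivC_dirZ U F x v (a : R) : open U -> smooth_on U F -> U x ->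
  derivC (a *: v) F x = a%:C * derivC v F x.
Proof.
move=> oU sF Ux; have := derivC_dirP v 0 a oU sF Ux.
by rewrite addr0 => ->; rewrite derivC_dir0 addr0.
Qed.

End Basics.

Section Affine.
Variables V W : normedModType R.

(** Both sides are limits of the same difference quotient, so the identity is unconditional. This is
    why iterated derivatives in charts can be computed by [pd_affine] without side conditions. *)
Lemma derive_affine (L : {linear W -> V}) (b : V) (f : V -> R) x v :
  'D_v (fun y => f (L y + b)) x = 'D_(L v) f (L x + b).
Proof.
rewrite /derive; congr (lim (_ @ 0^')); apply/funext => h /=.
by rewrite linearP addrA.
Qed.

Lemma derivable_affine (L : {linear W -> V}) (b : V) (f : V -> R) x v :
  derivable (fun y => f (L y + b)) x v <-> derivable f (L x + b) (L v).
Proof.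
rewrite /derivable; suff -> : (fun h : R => h^-1 *: (((fun y => f (L y + b)) \o shift x)
  (h *: v) - f (L x + b))) = (fun h => h^-1 *: ((f \o shift (L x + b)) (h *: L v) -
   f (L x + b))) by [].
by apply/funext => h /=; rewrite linearP addrA.
Qed.

Lemma derivC_affine (L : {linear W -> V}) (b : V) (F : V -> R[i]) x v :
  derivC v (fun y => F (L y + b)) x = derivC (L v) F (L x + b).
Proof. by rewrite /derivC !(derive_affine L b (fun y => _ (F y))). Qed.

Lemma Ck_affine (L : {linear W -> V}) (b : V) k U (f : V -> R) : continuous L ->
  Ck k U f -> Ck k [set y | U (L y + b)] (fun y => f (L y + b)).
Proof.
move=> cL; elim: k f => [|k IH] f Cf.
all: have cc y : U (L y + b) -> {for y, continuous (fun y => f (L y + b))}.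
1,3: move=> Uy; apply: (@continuous_comp _ _ _ (fun y => L y + b) f);
  [by apply: cvgD; [exact: cL|exact: cvg_cst]|exact: Ck_continuous Cf Uy].
  by split.
split=> // v; split.
  by move=> y Uy; apply/derivable_affine; exact: Ck_derivable Cf Uy.
have -> : 'D_v (fun y => f (L y + b)) = (fun y => 'D_(L v) f (L y + b)).
  by apply/funext => y; exact: derive_affine.
by apply: (IH ('D_(L v) f)); exact: Ck_derive.
Qed.

Lemma smooth_on_affine (L : {linear W -> V}) (b : V) U (F : V -> R[i]) : continuous L ->
  smooth_on U F -> smooth_on [set y | U (L y + b)] (fun y => F (L y + b)).
Proof.
move=> cL sF k; have [rF iF] := sF k.
by split; [exact: Ck_affine rF|exact: Ck_affine iF].
Qed.

End Affine.

Lemma smooth_on_chain (W : normedModType R) p q (phi : W -> 'M[R]_(p, q))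
    (F : 'M[R]_(p, q) -> R[i]) U U' : open U -> open U' -> smooth_on U F ->
  (forall x, U' x -> U (phi x)) ->
  (forall k i j, Ck k U' (fun x => phi x i j)) -> smooth_on U' (F \o phi).
Proof.
move=> oU oU' sF UU sphi k; have [rF iF] := sF k.
by split; [exact: (Ck_chain (phi := phi) oU oU' rF)|exact: (Ck_chain (phi := phi) oU oU' iF)].
Qed.

End ComplexCalculus.

(** * Smooth functions of one real variable, up to the flat function exp(-1/x) *)

Section SmoothFunctions.
Variable R : realType.

Lemma smooth1_expR : smooth1 setT (@expR R).
Proof. by exists (fun=> expR) => // n x _; exact: is_derive_expR. Qed.

(** Each derivative is a phase shift by [pi / 2], which gives the whole sequence in closed form. *)
Lemma smooth1_cos : smooth1 setT (@cos R).
Proof.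
exists (fun n x => cos (x + n%:R * (pi / 2))) => [|n x _].
  by apply/funext => x; rewrite mul0r addr0.
have H : is_derive x (1 : R) (fun y : R => y + n%:R * (pi / 2)) 1.
  exact: is_derive_shift.
have D := @is_derive1_comp _ (@cos R) (+%R^~ (n%:R * (pi / 2))) _ _ _ (is_derive_cos _) H.
rewrite mulr1 in D; apply: is_derive_eq D _.
by rewrite -cosDpihalf -addrA -[n.+1%:R]natr1 [(_ + 1) * _]mulrDl mul1r.
Qed.

Lemma smooth1_sin : smooth1 setT (@sin R).
Proof.
exists (fun n x => sin (x + n%:R * (pi / 2))) => [|n x _].
  by apply/funext => x; rewrite mul0r addr0.
have H : is_derive x (1 : R) (fun y : R => y + n%:R * (pi / 2)) 1.
  exact: is_derive_shift.
have D := @is_derive1_comp _ (@sin R) (+%R^~ (n%:R * (pi / 2))) _ _ _ (is_derive_sin _) H.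
rewrite mulr1 in D; apply: is_derive_eq D _.
by rewrite -sinDpihalf -addrA -[n.+1%:R]natr1 [(_ + 1) * _]mulrDl mul1r.
Qed.

Lemma is_derive_inv (x : R) : x != 0 -> is_derive x (1 : R) (fun y => y^-1) (- (x^-1 ^+ 2)).
Proof.
move=> x0; have [D E] : is_derive x (1 : R) (fun y : R => (id y)^-1) (- (id x)^-2 *: 1).
  by split; [exact: derivableV|rewrite deriveV // derive_id].
by split=> //; rewrite E [_ *: _]mulr1 exprVn.
Qed.

Lemma smooth1_inv_seq n (x : R) : x != 0 ->
  is_derive x (1 : R) (fun y => (-1) ^+ n * n`!%:R * y^-1 ^+ n.+1)
    ((-1) ^+ n.+1 * n.+1`!%:R * x^-1 ^+ n.+2).
Proof.
move=> x0; have H := is_deriveX n.+1 (is_derive_inv x0).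
have {}H := is_deriveZ ((-1) ^+ n * n`!%:R) H.
have E : (fun y : R => (-1) ^+ n * n`!%:R * y^-1 ^+ n.+1) =
  ((-1) ^+ n * n`!%:R) \*: ((fun y : R => y^-1) ^+ n.+1).
  by apply/funext => y; rewrite /= exprfctE.
rewrite E; apply: is_derive_eq H _.
rewrite /GRing.scale /= factS natrM -[_ *+ n.+1]mulr_natl !exprS.
ring.
Qed.

Lemma smooth1_inv : smooth1 [set x | x != 0] (fun x : R => x^-1).
Proof.
exists (fun n y => (-1) ^+ n * n`!%:R * y^-1 ^+ n.+1) => [|n x x0].
  by apply/funext => x; rewrite mul1r expr1 fact0 mul1r.
exact: smooth1_inv_seq.
Qed.

Lemma smooth1_ln : smooth1 [set x | 0 < x] (@ln R).
Proof.
exists (fun n => if n is n'.+1 then fun y : R => (-1) ^+ n' * n'`!%:R * y^-1 ^+ n'.+1 else @ln R).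
  by [].
move=> [|n] x x0; last by apply: smooth1_inv_seq; rewrite gt_eqF.
by apply: is_derive_eq (is_derive1_ln x0) _; rewrite fact0 !mul1r expr1.
Qed.

(** The functions p(1/x) exp(-1/x), extended by 0, form a family stable under differentiation: [p]
    becomes X^2 (p - p'). The classical flat function is the case [p = 1]. *)
Definition flat_poly (p : {poly R}) (x : R) : R :=
  if 0 < x then p.[x^-1] * expR (- x^-1) else 0.

(** The exponential at [x^-1] dominates its own Taylor term of order [i.+2], two more than the
    degree of the monomial it multiplies. The resulting quadratic bound makes the difference
    quotient at 0 tend to 0. *)
Lemma flat_poly_bound p : exists C : R, forall x : R, `|flat_poly p x| <= C * x ^+ 2.
Proof.
exists (\sum_(i < size p) `|p`_i| * i.+2`!%:R) => x; rewrite /flat_poly.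
have C0 : 0 <= \sum_(i < size p) `|p`_i| * i.+2`!%:R.
  by apply: sumr_ge0 => i _; rewrite mulr_ge0.
case: ifPn => [x0|_]; last by rewrite normr0 mulr_ge0 // sqr_ge0.
have y0 : 0 < x^-1 by rewrite invr_gt0.
rewrite normrM (gtr0_norm (expR_gt0 _)) expRN.
rewrite ler_pdivrMr ?expR_gt0 //.
have -> : (\sum_(i < size p) `|p`_i| * i.+2`!%:R) * x ^+ 2 * expR x^-1 =
  \sum_(i < size p) `|p`_i| * (i.+2`!%:R * x ^+ 2 * expR x^-1).
  by rewrite !mulr_suml; apply: eq_bigr => i _; rewrite !mulrA.
rewrite horner_coef; apply: le_trans (ler_norm_sum _ _ _) _.
apply: ler_sum => i _; rewrite normrM ler_wpM2l //.
rewrite (ger0_norm (exprn_ge0 _ (ltW y0))).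
have := expR_ge1Dxn i.+1 (ltW y0); set E := expR _ => H.
have f0 : 0 < i.+2`!%:R :> R by rewrite ltr0n fact_gt0.
have {}H : x^-1 ^+ i.+2 <= i.+2`!%:R * E.
  by rewrite mulrC -ler_pdivrMr //; apply: le_trans H; rewrite lerDr.
rewrite mulrAC -ler_pdivrMr ?exprn_gt0 // -exprVn -exprD addn2; exact: H.
Qed.

Lemma is_derive_flat_poly p x :
  is_derive x (1 : R) (flat_poly p) (flat_poly ('X^2 * (p - p^`())) x).
Proof.
have [x0|x0|->] := ltgtP x 0.
- rewrite {2}/flat_poly ltNge (ltW x0) /=.
  apply: (near_eq_is_derive (f := fun=> 0 : R)).
  near=> y; rewrite /flat_poly ltNge; suff -> : y <= 0 by [].
  by apply: ltW; near: y; exact: lt_nbhsl.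
- rewrite {2}/flat_poly x0.
  have xn : x != 0 by rewrite gt_eqF.
  have I := is_derive_inv xn.
  have H1 := is_derive1_comp (is_derive_poly p x^-1) I.
  have H2 := @is_derive1_comp _ (@expR R) (fun y => - y^-1) _ _ _
    (is_derive_expR (- x^-1)) (is_deriveN I).
  apply: near_eq_is_derive (is_derive_eq (is_deriveM H1 H2) _).
    near=> y; rewrite /flat_poly; suff -> : 0 < y by [].
    by near: y; exact: lt_nbhsr.
  rewrite /GRing.scale /= !hornerE /=; ring.
- rewrite {2}/flat_poly ltxx.
  have [C HC] := flat_poly_bound p.
  have D : (fun h : R => h^-1 *: ((flat_poly p \o shift 0) (h *: 1) - flat_poly p 0)) @ 0^' --> (0 : R).
    apply/cvgr0Pnorm_le => e e0.
    near=> h; have h0 : h != 0 by near: h; exact: nbhs_dnbhs_neq.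
    rewrite /= addr0 [h *: 1]mulr1 {2}/flat_poly ltxx subr0 normrM normfV.
    rewrite ler_pdivrMl ?normr_gt0 //; apply: le_trans (HC h) _.
    rewrite -(real_normK (num_real h)) expr2 mulrCA ler_wpM2l //.
    apply: (@le_trans _ _ ((`|C| + 1) * `|h|)).
      by rewrite ler_wpM2r // (le_trans (ler_norm C)) // lerDl.
    rewrite mulrC -ler_pdivlMr ?ltr_wpDl //; near: h.
    by apply: dnbhs0_le; rewrite divr_gt0 // ltr_wpDl.
  by split; [apply: cvgP D|apply: cvg_lim D].
Unshelve. all: by end_near. Qed.

Definition flat : R -> R := flat_poly 1.

Lemma smooth1_flat : smooth1 setT flat.
Proof.
exists (fun n => flat_poly (iter n (fun p => 'X^2 * (p - p^`())) 1)) => // n x _.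
exact: is_derive_flat_poly.
Qed.

Lemma flat_gt0 x : 0 < x -> 0 < flat x.
Proof. by move=> x0; rewrite /flat /flat_poly x0 hornerE mul1r expR_gt0. Qed.

Lemma flat_le0 x : x <= 0 -> flat x = 0.
Proof. by move=> x0; rewrite /flat /flat_poly ltNge x0. Qed.

Lemma flat_ge0 x : 0 <= flat x.
Proof. by have [/flat_le0 ->|/flat_gt0/ltW] := leP x 0. Qed.

End SmoothFunctions.

(** * Complex powers and cutoffs *)

Lemma mul_cancel_inner (A : comNzRingType) (s e x k y : A) : x * y = 1 ->
  s * (e * x) * (k * y) = s * k * e.
Proof. by move=> xy; rewrite -[RHS]mulr1 -xy; ring. Qed.

Section ComplexPowers.
Variable R : realType.
Implicit Types (c d : R) (lam mu z w : R[i]).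

Lemma cexpD z w : cexp (z + w) = cexp z * cexp w.
Proof.
case: z => a b; case: w => c d; rewrite /cexp /= expRD cosD sinD.
by apply: complex_eq; rewrite !(Re_mul, Im_mul) /=; ring.
Qed.

Lemma cexp_real (x : R) : cexp x%:C = (expR x)%:C.
Proof. by rewrite /cexp /= cos0 sin0; apply: complex_eq; rewrite /=; ring. Qed.

Lemma cexp0 : cexp 0 = 1 :> R[i].
Proof. by have := cexp_real 0; rewrite expR0. Qed.

Lemma cexp_neq0 z : cexp z != 0.
Proof.
apply/eqP => E; have := cexpD z (- z); rewrite subrr cexp0 E mul0r.
by move/eqP; rewrite oner_eq0.
Qed.

Lemma cexpN z : cexp (- z) = (cexp z)^-1.
Proof.
apply: (mulfI (cexp_neq0 z)); rewrite -cexpD subrr cexp0 divff //; exact: cexp_neq0.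
Qed.

Lemma cexp_line_inj mu : (forall t : R, cexp (mu * t%:C) = 1) -> mu = 0.
Proof.
case: mu => a b H.
have E t : expR (a * t) * cos (b * t) = 1 /\ expR (a * t) * sin (b * t) = 0.
  have := H t; rewrite /cexp.
  have -> : (a +i* b) * t%:C = (a * t) +i* (b * t).
    by apply: complex_eq; rewrite ?Re_mul ?Im_mul /=; ring.
  by move=> /= [/=]; rewrite !mul0r ?subr0 ?addr0 => -> ->.
have b0 : b = 0.
  (* At [t = pi / b] the cosine is -1, so a positive exponential would equal -1. *)
  apply/eqP/negPn/negP => b0; have [+ _] := E (pi / b).
  rewrite [b * _]mulrC divfK // cospi mulrN1 => P.
  by have := expR_gt0 (a * (pi / b)); rewrite -[expR _]opprK P oppr_gt0 ltr10.
have [] := E 1; rewrite b0 mul0r cos0 !mulr1 => /eqP + _.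
rewrite -expR0 => /eqP/expR_inj ->; by [].
Qed.

Section Derivative.
Variable V : normedModType R.
Implicit Types (U : set V) (l : V -> R).

Lemma Re_cexp_line mu (t : R) : complex.Re (cexp (mu * t%:C)) =
  expR (complex.Re mu * t) * cos (complex.Im mu * t).
Proof.
by rewrite /cexp !(Re_mul, Im_mul) /= !mulr0 mul0r subr0 add0r subr0.
Qed.

Lemma Im_cexp_line mu (t : R) : complex.Im (cexp (mu * t%:C)) =
  expR (complex.Re mu * t) * sin (complex.Im mu * t).
Proof.
by rewrite /cexp !(Re_mul, Im_mul) /= !mulr0 mul0r subr0 add0r addr0.
Qed.

Lemma derivC_cexp mu l x v (b : R) : is_derive x v l b ->
  derivC v (fun y => cexp (mu * (l y)%:C)) x = mu * b%:C * cexp (mu * (l x)%:C).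
Proof.
move=> dl.
have dE : is_derive x v (fun y => expR (complex.Re mu * l y))
    (expR (complex.Re mu * l x) * (complex.Re mu * b)).
  exact: (is_derive_comp1 (is_derive_expR _) (is_deriveZ (complex.Re mu) dl)).
have dC : is_derive x v (fun y => cos (complex.Im mu * l y))
    (- sin (complex.Im mu * l x) * (complex.Im mu * b)).
  exact: (is_derive_comp1 (is_derive_cos _) (is_deriveZ (complex.Im mu) dl)).
have dS : is_derive x v (fun y => sin (complex.Im mu * l y))
    (cos (complex.Im mu * l x) * (complex.Im mu * b)).
  exact: (is_derive_comp1 (is_derive_sin _) (is_deriveZ (complex.Im mu) dl)).
apply: complex_eq.
  rewrite [LHS]/=.
  have -> : (fun y => complex.Re (cexp (mu * (l y)%:C))) = (fun y =>
    expR (complex.Re mu * l y) * cos (complex.Im mu * l y)).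
    by apply/funext => y; exact: Re_cexp_line.
  have [_ ->] := is_deriveM dE dC.
  rewrite Re_mul Re_cexp_line Im_cexp_line !(Re_mul, Im_mul) /= /GRing.scale /=; ring.
rewrite [LHS]/=.
have -> : (fun y => complex.Im (cexp (mu * (l y)%:C))) = (fun y =>
  expR (complex.Re mu * l y) * sin (complex.Im mu * l y)).
  by apply/funext => y; exact: Im_cexp_line.
have [_ ->] := is_deriveM dE dS.
rewrite Im_mul Re_cexp_line Im_cexp_line !(Re_mul, Im_mul) /= /GRing.scale /=; ring.
Qed.

Lemma smooth_on_cexp mu l U : open U -> (forall k, Ck k U l) ->
  smooth_on U (fun y => cexp (mu * (l y)%:C)).
Proof.
move=> oU sl k.
have CE : Ck k U (fun y => expR (complex.Re mu * l y)).
  by apply: (Ck_comp1 oU (@smooth1_expR R)) => //; exact: Ck_scale.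
split.
  apply: Ck_ext (Ck_mul oU CE (Ck_comp1 oU (@smooth1_cos R) _
    (Ck_scale (complex.Im mu) oU (sl k)))) => // x _.
  by rewrite Re_cexp_line.
apply: Ck_ext (Ck_mul oU CE (Ck_comp1 oU (@smooth1_sin R) _
    (Ck_scale (complex.Im mu) oU (sl k)))) => // x _.
by rewrite Im_cexp_line.
Qed.

End Derivative.

(* The inverse of the character of P, read on the first column: if g' has first
   column c times that of g, then f g' = kap al lam c * f g.  At the junk value
   c = 0 the logarithm is 0. *)
Definition kap (al : bool) lam c : R[i] :=
  (Num.sg c ^+ al)%:C * cexp (- lam * (ln `|c|)%:C).

Lemma kapM al lam c d : c != 0 -> d != 0 ->
  kap al lam (c * d) = kap al lam c * kap al lam d.
Proof.
move=> c0 d0; rewrite /kap sgrM exprMn normrM lnM ?posrE ?normr_gt0 //.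
by rewrite rmorphM rmorphD mulrDr cexpD mulrACA.
Qed.

Lemma kap1 al lam : kap al lam 1 = 1.
Proof. by rewrite /kap sgr1 expr1n normr1 ln1 mulr0 cexp0 mulr1. Qed.

Lemma kap_neq0 al lam c : c != 0 -> kap al lam c != 0.
Proof.
move=> c0; rewrite mulf_neq0 ?cexp_neq0 //.
by rewrite rmorphXn expf_neq0 // fmorph_eq0 sgr_eq0.
Qed.

(** Since c^k = sgn(c)^k |c|^k, the factor [c ^+ k] undoes a shift of the exponent by [k] together
    with the corresponding twist of the sign. All bookkeeping of parameters under differentiation
    goes through this identity. *)
Lemma kap_addsgn al lam k c : c != 0 ->
  kap (addsgn al k) (lam + k%:R) c * (c ^+ k)%:C = kap al lam c.
Proof.
move=> c0; have n0 : 0 < `|c| by rewrite normr_gt0.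
rewrite /kap opprD mulrDl cexpD.
have -> : - k%:R * (ln `|c|)%:C = (- (k%:R * ln `|c|))%:C :> R[i].
  by rewrite rmorphN rmorphM rmorph_nat mulNr.
have sgX : Num.sg c ^+ addsgn al k * Num.sg c ^+ k = Num.sg c ^+ al.
  have s2 : Num.sg c ^+ 2 = 1 by rewrite sqr_sg c0.
  rewrite /addsgn -{2}[k]odd_double_half exprD -mul2n exprM s2 expr1n mulr1.
  by case: al; case: (odd k); rewrite ?mulr1 ?mul1r // -expr2.
rewrite cexp_real expRN mulr_natl -lnXn ?posrE // lnK ?posrE ?exprn_gt0 //.
have -> : (c ^+ k)%:C = (Num.sg c ^+ k)%:C * (`|c| ^+ k)%:C :> R[i].
  by rewrite -rmorphM -exprMn -numEsg.
rewrite -sgX rmorphM.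
have : (`|c| ^- k)%:C * (`|c| ^+ k)%:C = 1 :> R[i].
  by rewrite -rmorphM mulVf // expf_neq0 // gt_eqF.
exact: mul_cancel_inner.
Qed.

(** The sign is read off at -1, where the logarithm vanishes, and the exponent on the positive
    half-line, parametrised by [expR]. *)
Lemma kap_inj al be lam mu : (forall c, c != 0 -> kap al lam c = kap be mu c) ->
  al = be /\ lam = mu.
Proof.
move=> H; split.
  have := H (-1); rewrite oppr_eq0 oner_eq0 /kap normrN1 ln1 !mulr0 cexp0 !mulr1.
  rewrite sgrN1 => /(_ isT) [].
  case: al {H}; case: be => //= /eqP; rewrite expr1 expr0.
    by rewrite lt_eqF // (lt_trans _ ltr01) // ltrN10.
  by rewrite gt_eqF // (lt_trans _ ltr01) // ltrN10.
apply/eqP; rewrite -subr_eq0; apply/eqP/cexp_line_inj => t.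
have e0 := expR_gt0 t; have := H (expR t); rewrite gt_eqF // => /(_ isT).
rewrite /kap gtr0_sg // !expr1n !mul1r gtr0_norm // expRK => E.
by rewrite mulrBl cexpD -mulNr -E -cexpD mulNr subrr cexp0.
Qed.

Lemma kap_gt0 al lam c : 0 < c -> kap al lam c = cexp (- lam * (ln c)%:C).
Proof. by move=> c0; rewrite /kap gtr0_sg // expr1n mul1r gtr0_norm. Qed.

Lemma kap00 al c : 0 < c -> kap al 0 c = 1.
Proof. by move=> c0; rewrite kap_gt0 // oppr0 mul0r cexp0. Qed.

Section Kap.
Variable V : normedModType R.
Implicit Types (U : set V) (l : V -> R).

Lemma open_preimage_on U l (A : set R) : open U -> Ck 0 U l -> open A ->
  open (U `&` l @^-1` A).
Proof.
move=> oU [cl _] oA; rewrite openE => x [Ux Alx].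
have H : \forall y \near x, A (l y).
  by apply: cl => //; exact: open_nbhs_nbhs.
by apply: filterI => //; exact: open_nbhs_nbhs.
Qed.

(** Near each point [l] has a constant sign, and there [kap] is a constant times the exponential of
    a multiple of a smooth logarithm. *)
Lemma smooth_on_kap U l al lam : open U -> (forall k, Ck k U l) ->
  (forall x, U x -> l x != 0) -> smooth_on U (fun y => kap al lam (l y)).
Proof.
move=> oU sl l0; apply: smooth_on_loc => x Ux.
have /orP[lx|lx] : (l x < 0) || (0 < l x) by rewrite -neq_lt l0.
  have oU' := open_preimage_on oU (sl 0) (@open_lt R 0).
  exists (U `&` l @^-1` [set y | y < 0]) => //.
  have sl' k : Ck k (U `&` l @^-1` [set y | y < 0]) (fun y => ln (- 1 * l y)).
    apply: (Ck_comp1 oU' (@smooth1_ln R)).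
      by move=> y [_ /=]; rewrite mulN1r oppr_gt0.
    by apply: Ck_scale => //; apply: CkW (sl k) => y [].
  apply: smooth_on_ext (smooth_on_scale ((-1) ^+ al)%:C oU'
    (smooth_on_cexp (- lam) oU' sl')) => // y [_ /= ly].
  by rewrite /kap ltr0_sg // ltr0_norm // mulN1r.
have oU' := open_preimage_on oU (sl 0) (@open_gt R 0).
exists (U `&` l @^-1` [set y | 0 < y]) => //.
have sl' k : Ck k (U `&` l @^-1` [set y | 0 < y]) (fun y => ln (l y)).
  apply: (Ck_comp1 oU' (@smooth1_ln R)); first by move=> y [].
  by apply: CkW (sl k) => y [].
apply: smooth_on_ext (smooth_on_cexp (- lam) oU' sl') => // y [_ /= ly].
by rewrite kap_gt0.
Qed.

Lemma derivC_kap l al lam x v (b : R) : 0 < l x -> {for x, continuous l} ->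
  is_derive x v l b ->
  derivC v (fun y => kap al lam (l y)) x = - lam * (b / l x)%:C * kap al lam (l x).
Proof.
move=> lx cl dl; have D := is_derive_comp1 (is_derive1_ln lx) dl.
rewrite (kap_gt0 _ _ lx) mulrC [b / _]mulrC.
rewrite -[LHS]/(derivC v _ x) mulrC -(derivC_cexp (- lam) D).
apply: near_derivC; have : \forall y \near x, 0 < l y.
  by exact: (cvgr_gt (l x) cl 0 lx).
by apply: filterS => y ly; rewrite kap_gt0.
Qed.

End Kap.
End ComplexPowers.

Section Coordinates.
Variables (R : realType) (p q : nat).

Definition coordmx (i : 'I_p) (j : 'I_q) (A : 'M[R]_(p, q)) : R := A i j.

Fact coordmx_linear i j : linear (coordmx i j).
Proof. by move=> a A B; rewrite /coordmx !mxE. Qed.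

HB.instance Definition _ i j :=
  GRing.isLinear.Build R 'M[R]_(p, q) R _ (coordmx i j) (coordmx_linear i j).

Lemma Ck_coord k U i j : Ck k U (fun A : 'M[R]_(p, q) => A i j).
Proof. exact: (@Ck_linear _ _ k U (coordmx i j) (@coord_continuous _ _ _ i j)). Qed.

Lemma is_derive_coord i j (A v : 'M[R]_(p, q)) :
  is_derive A v (fun A : 'M[R]_(p, q) => A i j) (v i j).
Proof. exact: (derive_linear (coordmx i j) v A). Qed.

End Coordinates.

(** * A scale-invariant cutoff around the first axis *)

Section Bump.
Variables (R : realType) (n : nat).
Local Notation V := 'cV[R]_n.+1.
Implicit Types v : V.

Definition nz : set V := [set v | v != 0].

Lemma open_nz : open nz.
Proof.
have -> : nz = ~` [set 0].
  by apply/seteqP; split=> v /=; [move/eqP|move=> h; apply/eqP].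
apply/closed_openC/accessible_closed_set1/hausdorff_accessible/norm_hausdorff.
Qed.

Definition sqn v : R := \sum_i v i 0 ^+ 2.

Lemma sqn_gt0 v : v != 0 -> 0 < sqn v.
Proof.
move=> v0; rewrite lt_neqAle sumr_ge0 ?andbT; last by move=> i _; rewrite sqr_ge0.
apply: contra v0; rewrite eq_sym psumr_eq0; last by move=> i _; rewrite sqr_ge0.
move=> /allP H; apply/eqP/colP => i; rewrite mxE.
by have := H i (mem_index_enum _); rewrite /= sqrf_eq0 => /eqP.
Qed.

Lemma Ck_sqn k U : open U -> Ck k U sqn.
Proof.
by move=> oU; apply: (@Ck_sum _ _ _ _ _ _ (fun i (v : V) => v i 0 ^+ 2)) => // i;
  apply: Ck_exp => //; exact: Ck_coord.
Qed.

(** The squared cosine of the angle between [v] and the first axis: a smooth function of the line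
    through [v]. *)
Definition ratio v : R := v 0 0 ^+ 2 * (sqn v)^-1.

Lemma Ck_ratio k : Ck k nz ratio.
Proof.
apply: (Ck_mul open_nz); first by apply: Ck_exp (Ck_coord _ _ _ _); exact: open_nz.
apply: (Ck_comp1 open_nz (@smooth1_inv R)); last exact: Ck_sqn open_nz.
by move=> v v0 /=; rewrite gt_eqF // sqn_gt0.
Qed.

Lemma ratioZ c v : c != 0 -> ratio (c *: v) = ratio v.
Proof.
move=> c0; rewrite /ratio /sqn mxE exprMn.
under eq_bigr do rewrite mxE exprMn.
by rewrite -mulr_sumr invfM mulrACA divff ?mul1r // expf_neq0.
Qed.

(* A cutoff which is homogeneous of degree 0: it is 1 near the line of the first
   basis vector and 0 near the hyperplane v 0 0 = 0. *)
Definition chi v : R :=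
  flat (ratio v - 1 / 2) * (flat (ratio v - 1 / 2) + flat (3 / 4 - ratio v))^-1.

(** As 1/2 < 3/4, the two flat functions never vanish together. *)
Lemma chi_den v : 0 < flat (ratio v - 1 / 2) + flat (3 / 4 - ratio v).
Proof.
have [h|h] := ltP (1 / 2) (ratio v).
  by apply: ltr_pwDl (flat_ge0 _); apply: flat_gt0; rewrite subr_gt0.
by apply: ltr_wpDl (flat_ge0 _) _; apply: flat_gt0; lra.
Qed.

Lemma Ck_chi k : Ck k nz chi.
Proof.
have o := open_nz.
have C1 j : Ck j nz (fun v => flat (ratio v - 1 / 2)).
  apply: (Ck_comp1 o (@smooth1_flat R)) => //.
  by apply: Ck_add => //; [exact: Ck_ratio|exact: Ck_cst].
have C2 j : Ck j nz (fun v => flat (3 / 4 - ratio v)).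
  apply: (Ck_comp1 o (@smooth1_flat R)) => //.
  apply: Ck_ext (Ck_lin 1 (-1) o (Ck_cst _ _ (3 / 4 : R)) (Ck_ratio j)) => // v _.
  by rewrite mul1r mulN1r.
apply: Ck_mul => //; apply: (Ck_comp1 o (@smooth1_inv R)); last exact: Ck_add.
by move=> v _ /=; rewrite gt_eqF // chi_den.
Qed.

Lemma chiZ c v : c != 0 -> chi (c *: v) = chi v.
Proof. by move=> c0; rewrite /chi ratioZ. Qed.

Lemma chi_eq1 v : 3 / 4 <= ratio v -> chi v = 1.
Proof.
move=> h; rewrite /chi [flat (3 / 4 - _)]flat_le0 ?subr_le0 // addr0 divff //.
by rewrite gt_eqF // flat_gt0 //; lra.
Qed.

Lemma chi_eq0 v : ratio v <= 1 / 2 -> chi v = 0.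
Proof. by move=> h; rewrite /chi flat_le0 ?mul0r // subr_le0. Qed.

Lemma near_chi1 : \forall v \near (delta_mx 0 0 : V), chi v = 1.
Proof.
have e0 : nz (delta_mx 0 0).
  by apply/eqP => /matrixP/(_ 0 0)/eqP; rewrite !mxE !eqxx oner_eq0.
have r1 : ratio (delta_mx 0 0) = 1.
  rewrite /ratio /sqn (bigD1 ord0) //= big1 => [|i i0]; last first.
    by rewrite mxE (negbTE i0) expr0n.
  by rewrite addr0 mxE !eqxx expr1n invr1 mulr1.
have H : \forall v \near (delta_mx 0 0 : V), 3 / 4 < ratio v.
  by apply: (cvgr_gt _ (Ck_continuous (Ck_ratio 0) e0)); rewrite r1; lra.
by apply: filterS H => v /ltW/chi_eq1.
Qed.

Lemma near_chi0 v : v != 0 -> v 0 0 = 0 -> \forall w \near v, chi w = 0.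
Proof.
move=> v0 vz; have H : \forall w \near v, ratio w < 1 / 2.
  by apply: (cvgr_lt _ (Ck_continuous (Ck_ratio 0) v0)); rewrite /ratio vz expr0n mul0r.
by apply: filterS H => w /ltW/chi_eq0.
Qed.

End Bump.

(** * Sections as homogeneous functions *)

Section FirstColumn.
Variables (R : realType) (n : nat).
Implicit Types (g h p : SL R n.+1) (al : bool) (lam : R[i]).

Definition fcol g : 'cV[R]_n.+1 := col 0 (val g).
Definition e0 : 'cV[R]_n.+1 := delta_mx 0 0.

Lemma e0_neq0 : e0 != 0.
Proof. by apply/eqP => /matrixP/(_ 0 0)/eqP; rewrite !mxE !eqxx oner_eq0. Qed.

Lemma fcolM g h : fcol (g * h)%g = val g *m fcol h.
Proof. by rewrite /fcol colE /= -mulmxA -colE. Qed.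

Lemma SL_mulmx_neq0 g (v : 'cV[R]_n.+1) : v != 0 -> val g *m v != 0.
Proof.
apply: contra_neq => E; rewrite -[v]mul1mx -(mulVmx (SL_unit g)) -mulmxA E.
by rewrite mulmx0.
Qed.

Lemma fcolE g : fcol g = val g *m e0.
Proof. by rewrite /fcol colE. Qed.

Lemma fcol_neq0 g : fcol g != 0.
Proof. by rewrite fcolE SL_mulmx_neq0 // e0_neq0. Qed.

Lemma fcol_block (a : R) (u : 'rV[R]_n) (k : 'M[R]_n) :
  col 0 (block_mx a%:M u 0 k : 'M[R]_(1 + n)) = a *: e0.
Proof.
have -> : (0 : 'I_(1 + n)) = lshift n 0 by apply/val_inj.
rewrite (@block_mxEh _ 1 n 1 n) (@colKl _ (1 + n) 1 n).
apply/colP => i; have := @splitK 1 n i; case: (@fintype.split 1 n i) => j <- /=.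
  rewrite (ord1 j) !mxE (unsplitK (inl _)) mxE.
  have -> : (@lshift 1 n 0 == 0 :> 'I_n.+1) by apply/eqP/val_inj.
  by rewrite !eqxx mulr1.
by rewrite !mxE (unsplitK (inr _)) mxE mulr0.
Qed.

Lemma MAN_mx k t u : Mmx k *m Amx n t *m Nmx u =
  block_mx ((\det k)^-1 * expR t)%:M (((\det k)^-1 * expR t) *: u) 0
    (expR (- t / n%:R) *: k) :> 'M[R]_(1 + n).
Proof.
rewrite /Mmx /Amx /Nmx !(@mulmx_block _ 1 n 1 n 1 n).
rewrite !mul0mx !mulmx0 !addr0 !add0r !mulmx1 -scalar_mxM mul_scalar_mx.
by rewrite mul0mx addr0 add0r mul_mx_scalar.
Qed.

Lemma MAN_fcol k t u p : MAN k t u p -> fcol p = ((\det k)^-1 * expR t) *: e0.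
Proof. by move=> [_ E]; rewrite /fcol E MAN_mx; exact: fcol_block. Qed.

(** The single scalar c = det(k)^-1 e^t remembers both det k, as its sign, and t, as the logarithm
    of its modulus. Hence the inducing character depends only on the first column of the element of
    P. *)
Lemma MAN_coef (k : 'M[R]_n) (t : R) : `|\det k| = 1 ->
  [/\ (\det k)^-1 * expR t != 0, Num.sg ((\det k)^-1 * expR t) = \det k &
      ln `|(\det k)^-1 * expR t| = t].
Proof.
move=> dk; have e := expR_gt0 t.
have k0 : \det k != 0 by rewrite -normr_eq0 dk oner_eq0.
split; first by rewrite mulf_neq0 ?invr_eq0 // gt_eqF.
  rewrite sgrM sgrV (gtr0_sg e) mulr1.
  by rewrite [RHS]numEsg dk mulr1.
by rewrite normrM normfV dk invr1 mul1r gtr0_norm // expRK.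
Qed.

Lemma sigma_kap al lam (k : 'M[R]_n) (t : R) : `|\det k| = 1 ->
  (sigma al lam k t)^-1 = kap al lam ((\det k)^-1 * expR t).
Proof.
move=> dk; have [c0 sc lc] := MAN_coef t dk.
rewrite /kap sc lc mulNr cexpN /sigma invfM; congr (_ * _).
have d2 : \det k * \det k = 1 by rewrite -sc -expr2 sqr_sg c0.
rewrite -fmorphV -exprVn; congr ((_ ^+ _)%:C).
by apply: (mulrI (x := \det k)); rewrite ?unitfE ?divff // -normr_eq0 dk oner_eq0.
Qed.

(** P is the stabiliser of the line through [e0]. The parameter [t] is forced by the modulus of [c],
    and [k] is the lower right block rescaled to have determinant of modulus 1, which takes an n-th
    root. *)
Lemma parabolicP (n0 : (0 < n)%N) p c : c != 0 -> fcol p = c *: e0 ->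
  exists k t u, MAN k t u p /\ (\det k)^-1 * expR t = c.
Proof.
move=> c0 pc; pose q : 'M[R]_(1 + n) := val p.
have nn : n%:R != 0 :> R by rewrite pnatr_eq0 -lt0n.
have qE : q = block_mx c%:M (ursubmx q) 0 (drsubmx q).
  rewrite -[LHS](@submxK _ 1 n 1 n); congr block_mx.
    apply/matrixP => i j; rewrite !ord1 !mxE.
    have := congr1 (fun v : 'cV[R]_n.+1 => v 0 0) pc.
    rewrite !mxE !eqxx mulr1n mulr1 => <-.
    by congr (val p _ _); apply/val_inj.
  apply/matrixP => i j; rewrite !ord1 !mxE.
  have := congr1 (fun v : 'cV[R]_n.+1 => v (rshift 1 i) 0) pc.
  rewrite !mxE /= mulr0 => <-.
  by congr (val p _ _); apply/val_inj.
have dq : c * \det (drsubmx q) = 1.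
  by rewrite -(SL_det p) -/q qE (@det_ublock _ 1 n) block_mxKdr det_scalar1.
pose t := ln `|c|; pose k := expR (t / n%:R) *: drsubmx q.
have cn : 0 < `|c| by rewrite normr_gt0.
have dk : \det k = `|c| / c.
  rewrite /k detZ -expRM_natl [n%:R * _]mulrC divfK // lnK ?posrE //.
  by rewrite -[\det _](mulKf c0) dq mulr1.
have ck : (\det k)^-1 * expR t = c.
  by rewrite dk lnK ?posrE // invf_div divfK // gt_eqF.
exists k, t, (c^-1 *: ursubmx q); split=> //; split.
  by rewrite dk normrM normr_id normfV divff // gt_eqF.
rewrite MAN_mx ck scalerA divff // scale1r /k scalerA -expRD.
by rewrite mulNr addNr expR0 scale1r -qE.
Qed.

(** The element [g^-1 * g'] maps [e0] to [c *: e0], so it lies in P. *)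
Lemma Ind_fcol al lam (n0 : (0 < n)%N) (f : Ind n al lam) g g' c : c != 0 ->
  fcol g' = c *: fcol g -> f g' = kap al lam c * f g.
Proof.
move=> c0 E; have [_ ef] : smoothSL f /\ equivariant al lam f.
  by have := valP f; rewrite inE.
have [|k [t [u [pM <-]]]] := @parabolicP n0 (g^-1 * g')%g c c0.
  by rewrite fcolM E -scalemxAr -fcolM mulVg; congr (_ *: _); rewrite fcolE /= mul1mx.
have [dk _] := pM; rewrite -sigma_kap // -(ef _ _ _ _ _ pM).
by rewrite mulgA mulgV mul1g.
Qed.

Definition homog al lam (Phi : 'cV[R]_n.+1 -> R[i]) :=
  smooth_on (@nz R n) Phi /\
  forall c v, c != 0 -> v != 0 -> Phi (c *: v) = kap al lam c * Phi v.

Lemma homog_Ind_pred al lam Phi : homog al lam Phi ->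
  (fun g => Phi (fcol g)) \in @Ind_pred R n al lam.
Proof.
move=> [sPhi hPhi]; rewrite inE; split.
  move=> g; pose L : {linear 'M[R]_n.+1 -> 'cV[R]_n.+1} := mulmxr e0.
  have cL : continuous L.
    move=> A; apply: mx_continuous => i j.
    have -> : (fun A => L A i j) = (fun A => A i 0).
      by apply/funext => B; rewrite /L /= -colE mxE.
    exact: coord_continuous.
  exists [set A | nz (L A + 0)], (fun A => Phi (L A + 0)); split.
  - have -> : [set A | nz (L A + 0)] = L @^-1` (@nz R n).
      by apply/seteqP; split=> A /=; rewrite addr0.
    by move/continuousP: cL; apply; exact: open_nz.
  - by rewrite /nz /= addr0 -colE; exact: fcol_neq0.
  - exact: smooth_on_affine.
  - by move=> h _; rewrite addr0 /L /= -colE.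
move=> g k t u p pM; have [dk _] := pM; have [c0 _ _] := MAN_coef t dk.
rewrite fcolM (MAN_fcol pM) -scalemxAr -fcolE hPhi ?fcol_neq0 //.
by rewrite sigma_kap.
Qed.

Definition Ind_of al lam Phi (h : homog al lam Phi) : Ind n al lam :=
  Sub (fun g => Phi (fcol g)) (homog_Ind_pred h).

Lemma Ind_ext al lam (f1 f2 : Ind n al lam) : (forall g, f1 g = f2 g) -> f1 = f2.
Proof. by move=> E; apply/val_inj/funext. Qed.

Lemma Ind_smooth al lam (f : Ind n al lam) : smoothSL f.
Proof. by have := valP f; rewrite inE => -[]. Qed.

End FirstColumn.

(** * From sections back to homogeneous functions *)

Section Homogeneous.
Variables (R : realType) (m : nat).
Local Notation V := 'cV[R]_m.+2.

(** A lower triangular completion of [w] to a matrix of determinant 1, valid where [w 0 0] is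
    nonzero. It depends smoothly on [w] there and is the identity at [e0], so it is a local section
    of [fcol]. *)
Definition col_completion (w : V) : 'M[R]_m.+2 :=
  \matrix_(i, j) if j == 0 then w i 0 else
    if i == j then (if j == lift ord0 ord0 then (w 0 0)^-1 else 1) else 0.

Lemma det_col_completion (w : V) : w 0 0 != 0 -> \det (col_completion w) = 1.
Proof.
move=> w0; rewrite det_trig; last first.
  apply/is_trig_mxP => i j ij; rewrite mxE.
  have j0 : j != 0 by apply: contraTneq ij => ->.
  by rewrite (negbTE j0); case: eqP => // E; rewrite E ltnn in ij.
rewrite big_ord_recl big_ord_recl big1 => [|i _]; last by rewrite mxE eqxx.
by rewrite !mxE !eqxx mulr1 divff.
Qed.

Lemma col_completion_e0 : col_completion (e0 R m.+1) = 1%:M.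
Proof.
apply/matrixP => i j; rewrite !mxE !eqxx invr1 if_same andbT.
by case: eqP => [->|_]; case: eqP.
Qed.

Lemma col_col_completion w : col 0 (col_completion w) = w.
Proof. by apply/colP => i; rewrite !mxE eqxx. Qed.

Lemma exists_fcol (v : V) : v != 0 -> exists g : SL R m.+2, fcol g = v.
Proof.
move=> vn0; have [v0|v0] := eqVneq (v 0 0) 0; last first.
  have D : \det (col_completion v) == 1 by rewrite det_col_completion.
  by exists (Sub (col_completion v) D); rewrite /fcol /= col_col_completion.
have [i vi] : exists i, v i 0 != 0.
  apply/existsP; apply: contraNT vn0 => /existsPn H.
  by apply/eqP/colP => i; rewrite mxE; apply/eqP/negPn/H.
have i0 : i != 0 by apply: contraNneq vi => ->; rewrite v0.
(* When the first coordinate is 0, the transvection [T 1] adds a nonzero coordinate to it; [T (-1)]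
   undoes this after the completion. *)
pose T (a : R) : 'M[R]_m.+2 := 1%:M + a *: delta_mx 0 i.
have dT a : \det (T a) = 1.
  rewrite -det_tr det_trig.
    apply: big1 => j _; rewrite !mxE eqxx.
    by case: eqP => [->|_]; rewrite ?(eq_sym 0) ?(negbTE i0) ?mulr0 ?addr0.
  apply/is_trig_mxP => j k jk; rewrite !mxE.
  have -> : (k == j) = false by apply/negP => /eqP E; rewrite E ltnn in jk.
  have -> : (k == 0) = false by apply/negP => /eqP E; rewrite E in jk.
  by rewrite mulr0 addr0.
pose w := T 1 *m v.
have w0 : w 0 0 != 0.
  rewrite /w mulmxDl mul1mx -scalemxAl mxE v0 add0r scale1r.
  rewrite mxE (bigD1 i) //= big1 => [|k ki]; last by rewrite mxE (negbTE ki) andbF mul0r.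
  by rewrite mxE !eqxx mul1r addr0.
have D : \det (T (-1) *m col_completion w) == 1.
  by rewrite det_mulmx dT det_col_completion // mulr1.
exists (Sub (T (-1) *m col_completion w) D);
  rewrite /fcol colE /= -mulmxA -colE col_col_completion /w mulmxA.
rewrite mulmxDl !mulmxDr !mul1mx mulmx1 -scalemxAl -scalemxAr mul_delta_mx_0 //.
by rewrite !scaler0 addr0 scaleN1r scale1r addrK mul1mx.
Qed.

Lemma Ck_mulmx p q r k U (A : 'M[R]_(p, q)) i j :
  open U -> Ck k U (fun X : 'M[R]_(q, r) => (A *m X) i j).
Proof.
move=> oU; apply: Ck_ext (Ck_sum (index_enum 'I_q) oU
  (F := fun l (X : 'M[R]_(q, r)) => A i l * X l j) _) => //.
  by move=> X _; rewrite mxE.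
by move=> l; apply: Ck_scale => //; exact: Ck_coord.
Qed.

(** [f] depends only on the first column, so any choice of preimages under [fcol] defines [Phi]. Its
    smoothness is local, and is seen by replacing the arbitrary choice with a smooth local
    section. *)
Lemma Ind_homog al (lam : R[i]) (f : Ind m.+1 al lam) :
  exists2 Phi, homog al lam Phi & forall g, f g = Phi (fcol g).
Proof.
have H (v : V) : exists g : SL R m.+2, v != 0 -> fcol g = v.
  have [->|/exists_fcol[g gv]] := eqVneq v 0; last by exists g.
  by exists 1%g.
have [s sP] := choice H.
have fE g g' : fcol g = fcol g' -> f g = f g'.
  move=> E; have := @Ind_fcol _ _ al lam (ltn0Sn m) f g' g 1.
  by rewrite oner_neq0 scale1r kap1 mul1r; apply.
exists (fun v => f (s v)); last by move=> g; apply: fE; rewrite sP // fcol_neq0.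
split; last first.
  move=> c v c0 v0; apply: Ind_fcol => //.
  by rewrite !sP // scaler_eq0 negb_or c0.
apply: smooth_on_loc => v0 v0n; have [g gE] := exists_fcol v0n.
have [U [F [oU Ug sF FE]]] := Ind_smooth f g.
pose l (v : V) : R := (val g^-1%g *m v) 0 0.
pose O := setT `&` l @^-1` [set x | x != 0].
have Cl k W : open W -> Ck k W l by move=> oW; exact: Ck_mulmx.
have oO : open O.
  apply: open_preimage_on; [exact: openT|exact: (Cl _ _ openT)|].
  have -> : [set x : R | x != 0] = ~` [set 0].
    by apply/seteqP; split=> x /=; [move/eqP|move=> h; apply/eqP].
  apply/closed_openC/accessible_closed_set1/hausdorff_accessible/norm_hausdorff.
(* The completion is translated by [g], so that this local section passes through [g] at [v0] and
   stays near [g], where the smooth extension [F] of [f] is available. *)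
pose phi v := val g *m col_completion (val g^-1%g *m v).
have Cphi k i j : Ck k O (fun v => phi v i j).
  apply: Ck_ext (Ck_sum (index_enum 'I_m.+2) oO
    (F := fun r v => val g i r * col_completion (val g^-1%g *m v) r j) _) => //.
    by move=> v _; rewrite mxE.
  move=> r; apply: Ck_scale => //.
  have E (G : V -> R) : (forall v, col_completion (val g^-1%g *m v) r j = G v) ->
      Ck k O G -> Ck k O (fun v => col_completion (val g^-1%g *m v) r j).
    by move=> GE; apply: Ck_ext => // v _; rewrite GE.
  have [j0|j0] := eqVneq j 0.
    apply: (E (fun v => (val g^-1%g *m v) r 0)); last exact: Ck_mulmx.
    by move=> v; rewrite mxE j0.
  have [rj|rj] := eqVneq r j; last first.
    apply: (E (fun=> 0)); last exact: Ck_cst.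
    by move=> v; rewrite mxE (negbTE j0) (negbTE rj).
  have [j1|j1] := eqVneq j (lift ord0 ord0); last first.
    apply: (E (fun=> 1)); last exact: Ck_cst.
    by move=> v; rewrite mxE (negbTE j0) rj eqxx (negbTE j1).
  apply: (E (fun v => (l v)^-1)).
    by move=> v; rewrite mxE (negbTE j0) rj eqxx j1.
  apply: (Ck_comp1 oO (@smooth1_inv R)); last exact: Cl.
  by move=> v [].
have le0 : val g^-1%g *m v0 = e0 R m.+1.
  by rewrite -gE fcolE mulmxA /= mulVmx ?mul1mx // SL_unit.
have Ov0 : O v0 by split; rewrite //= /l le0 mxE eqxx oner_eq0.
have phi0 : phi v0 = val g by rewrite /phi le0 col_completion_e0 mulmx1.
have nb : nbhs v0 (O `&` phi @^-1` U).
  apply: filterI; first exact: open_nbhs_nbhs.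
  have : {for v0, continuous phi}.
    by apply: mx_continuous => i j; exact: Ck_continuous (Cphi 0 i j) Ov0.
  by apply; apply: open_nbhs_nbhs; rewrite phi0.
exists (interior (O `&` phi @^-1` U)) => //.
have oI : open (interior (O `&` phi @^-1` U)) by exact: open_interior.
have sub := @interior_subset _ (O `&` phi @^-1` U).
apply: smooth_on_ext (smooth_on_chain (phi := phi) oU oI sF _ _) => //.
- move=> v /sub [[_ lv] Uv] /=.
  have D : \det (col_completion (val g^-1%g *m v)) == 1.
    by rewrite det_col_completion.
  have -> : phi v = val (g * Sub (col_completion (val g^-1%g *m v)) D)%g by [].
  rewrite FE //; apply: fE.
  rewrite fcolM /fcol /= col_col_completion mulmxA mulmxV ?SL_unit // mul1mx.
  rewrite -[RHS]/(fcol _) sP //.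
  apply: contraNneq lv => ->.
  by rewrite /l mulmx0 mxE.
- by move=> v /sub [].
- by move=> k i j; apply: CkW (Cphi k i j) => v /sub [].
Qed.

End Homogeneous.

Lemma cvg_initial (S : choiceType) (T : topologicalType) (f : S -> T) (F : set_system S) (s : S) :
  Filter F -> f @ F --> f s -> F --> (s : initial_topology f).
Proof.
move=> FF cf A [_ [[B Bop <-] Bfs sBfA]]; apply: filterS sBfA _.
by apply: (cf B); apply: open_nbhs_nbhs.
Qed.

(** * The topology on sections *)

Section InducedTopology.
Variables (R : realType) (n : nat) (al : bool) (lam : R[i]).
Local Notation I := (Ind n al lam).

Definition jet_near (K : set 'cV[R]_n) (s : seq 'I_n) g (e : R) (f f' : I) :=
  forall x, K x ->
   `|complex.Re (pd s (chart g f) x) - complex.Re (pd s (chart g f') x)| < e /\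
   `|complex.Im (pd s (chart g f) x) - complex.Im (pd s (chart g f') x)| < e.

(** The topology has three layers: initial along [jets], a product over charts and multi-indices,
    and compact convergence in each factor. [cvg_Ind] and [near_Ind] are the two ways through
    them. *)
Lemma cvg_Ind (F : set_system I) (f : I) : Filter F ->
  (forall K s g e, compact K -> 0 < e -> \forall f' \near F, jet_near K s g e f f') ->
  F --> f.
Proof.
move=> FF H; apply: cvg_initial; apply/cvg_sup => -[g s].
apply: cvg_initial; apply/fam_cvgP => K cK /= P /uniform_nbhs [E [entE EP]].
move: entE; rewrite -entourage_ballE => -[e /= e0 eE].
apply: filterS (H K s g e cK e0) => f' ff'; apply: EP => x Kx; apply: eE.
by have [] := ff' x Kx.
Qed.

Lemma near_Ind (f : I) K s g e : compact K -> 0 < e ->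
  \forall f' \near f, jet_near K s g e f f'.
Proof.
move=> cK e0.
have H1 := @initial_continuous I _ (@jets R n al lam) f.
have H2 := @proj_continuous _ (fun _ : SL R n.+1 * seq 'I_n =>
  {family compact, 'cV[R]_n -> R * R}) (g, s) (jets f).
have H3 := cvg_comp _ _ H1 H2.
have : \forall h \near (proj (g, s) (jets f) : {family compact, 'cV[R]_n -> R * R}),
   forall x, K x -> ball (proj (g, s) (jets f) x : R * R) e (h x).
  apply: (fam_nbhs (E := [set xy | ball xy.1 e xy.2])) => //.
  exact: entourage_ball (PosNum e0).
move=> /H3 H4; have FF : Filter (nbhs f) := nbhs_filter f.
apply: (@filterS _ (nbhs f) FF (fun f' : I => forall x, K x ->
  ball (jets f (g, s) x : R * R) e (jets f' (g, s) x)) _ _ H4) => f' ff' x Kx.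
by have [] := ff' x Kx.
Qed.

End InducedTopology.

(** * Homogeneity under differentiation and Bol's lemma *)

Section HomogeneousCalculus.
Variables (R : realType) (n : nat).
Local Notation V := 'cV[R]_n.+1.
Implicit Types (al : bool) (lam : R[i]) (Phi : V -> R[i]).
Let onz : open (@nz R n) := @open_nz R n.

Lemma addsgnD al j k : addsgn (addsgn al j) k = addsgn al (j + k).
Proof. by rewrite /addsgn oddD addbA. Qed.

Lemma nzZ c (v : V) : c != 0 -> v != 0 -> c *: v != 0.
Proof. by move=> c0 v0; rewrite scaler_eq0 negb_or c0. Qed.

(** Differentiating Phi(c v) = kap(c) Phi(v) in [v] produces a factor [c] on the left, which lowers
    the degree by one and flips the sign character. *)
Lemma homog_derivC al lam Phi w : homog al lam Phi ->
  homog (addsgn al 1) (lam + 1) (derivC w Phi).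
Proof.
move=> [sP hP]; split; first exact: smooth_on_derivC.
move=> c v c0 v0; have cC : c%:C != 0 :> R[i] by rewrite fmorph_eq0.
apply: (mulfI cC).
rewrite -(derivC_dirZ _ _ onz sP (nzZ c0 v0)).
have := derivC_affine (GRing.scale c : {linear V -> V}) 0 Phi v w.
rewrite addr0 /= => <-.
rewrite (near_derivC (G := fun y => kap al lam c * Phi y)); last first.
  apply: filterS (open_nbhs_nbhs (conj onz v0)) => y y0.
  by rewrite addr0 hP.
rewrite (derivC_scale _ _ sP v0) mulrA; congr (_ * _).
by have := kap_addsgn al lam 1 c0; rewrite expr1 mulrC => ->.
Qed.

Lemma homog_iter al lam Phi w k : homog al lam Phi ->
  homog (addsgn al k) (lam + k%:R) (iter k (derivC w) Phi).
Proof.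
move=> hP; elim: k => [|k IH]; first by rewrite addr0 /addsgn addbF.
have := homog_derivC w IH.
by rewrite addsgnD addn1 -addrA natr1.
Qed.

(** Euler's relation in degree 0: only the factors 1 + h near 1 enter, and they are positive, so the
    sign character is not seen. *)
Lemma euler0 al Phi v : homog al 0 Phi -> v != 0 -> derivC v Phi v = 0.
Proof.
move=> [_ hP] v0; have E (h : R) : `|h| < 1 -> Phi (h *: v + v) = Phi v.
  move=> h1; have h0 : 0 < h + 1 by move: h1; rewrite ltr_norml => /andP[]; lra.
  by rewrite -[X in _ + X]scale1r -scalerDl hP ?gt_eqF // kap00 // mul1r.
have D (F : V -> R) : (forall h : R, `|h| < 1 -> F (h *: v + v) = F v) -> 'D_v F v = 0.
  move=> EF; apply: cvg_lim => //=.
  apply: (@cvg_trans _ ((fun=> 0 : R) @ 0^')); last exact: cvg_cst.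
  apply: near_eq_cvg; near=> h; rewrite /= EF ?subrr ?scaler0 //.
  by near: h; apply: dnbhs0_lt.
by rewrite /derivC !D // => h /E ->.
Unshelve. all: by end_near. Qed.

(* Bol's lemma: on homogeneous functions of degree l - 1 the l-th derivative
   along w at v only depends on w modulo v, because the derivatives of order
   l - 1 are homogeneous of degree 0, hence killed by the derivative along v. *)
Lemma bol al Phi l u v w : homog al (1 - l%:R) Phi -> v != 0 ->
  iter l (derivC (u *: v + w)) Phi v = iter l (derivC w) Phi v.
Proof.
elim: l al Phi => [al Phi _ _|l IH al Phi hP v0]; first exact: erefl.
have hP' := homog_derivC (u *: v + w) hP.
rewrite iterSr (IH (addsgn al 1) _ _ v0); last first.
  by move: hP'; rewrite -natr1 opprD addrA subrK.
have [sP _] := hP; rewrite (iter_derivC_comm1 _ _ _ onz sP v0).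
rewrite (derivC_dirP _ _ _ onz (smooth_on_iter w l sP) v0).
have := homog_iter w l hP.
have -> : 1 - l.+1%:R + l%:R = 0 :> R[i] by rewrite -natr1; ring.
move=> h0.
by rewrite (euler0 h0 v0) mulr0 add0r.
Qed.

Lemma iter_derivC_dirZ Phi a v w k : smooth_on (@nz R n) Phi -> v != 0 ->
  iter k (derivC (a *: w)) Phi v = (a ^+ k)%:C * iter k (derivC w) Phi v.
Proof.
move=> sP; elim: k v => [|k IH] v v0; first by rewrite mul1r.
rewrite /= (derivC_ext (a *: w) onz IH v0).
have sI := smooth_on_iter w k sP.
rewrite (derivC_scale _ _ sI v0) (derivC_dirZ _ _ onz sI v0).
by rewrite mulrA -rmorphM -exprSr.
Qed.

End HomogeneousCalculus.

(** * Charts in homogeneous coordinates *)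

Section Charts.
Variables (R : realType) (n : nat).
Implicit Types (g : SL R n.+1) (al : bool) (lam : R[i]).

Lemma pd_affine p (s : seq 'I_n) (L : {linear 'cV[R]_n -> 'cV[R]_p}) b
    (F : 'cV[R]_p -> R[i]) :
  pd s (fun x => F (L x + b)) =
  (fun x => foldr (fun j => derivC (L (delta_mx j 0))) F s (L x + b)).
Proof.
elim: s => //= j s ->; apply/funext => x; exact: derivC_affine.
Qed.

Lemma pd_cat (s1 s2 : seq 'I_n) F : pd (s1 ++ s2) F = pd s1 (pd s2 F) :> (_ -> R[i]).
Proof. by rewrite /pd foldr_cat. Qed.

Lemma pd_smooth U (s : seq 'I_n) (F : 'cV[R]_n -> R[i]) :
  smooth_on U F -> smooth_on U (pd s F).
Proof. by move=> sF; elim: s => //= j s IH; exact: smooth_on_derivC. Qed.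

Lemma pd_lin (s : seq 'I_n) (c : R[i]) F G : smooth_on setT F -> smooth_on setT G ->
  pd s (fun x => c * F x + G x) = (fun x => c * pd s F x + pd s G x).
Proof.
move=> sF sG; elim: s => //= j s ->; apply/funext => x.
have oT : open [set: 'cV[R]_n] := openT.
have sF' := pd_smooth s sF; have sG' := pd_smooth s sG.
rewrite (derivC_add _ (smooth_on_scale c oT sF') sG' I).
by rewrite (derivC_scale c _ sF' I).
Qed.

Definition embJ : 'M[R]_(1 + n, n) := col_mx 0 1%:M.

Lemma fcol_Nbar x : fcol (Nbar x) = (embJ : 'M[R]_(n.+1, n)) *m x + e0 R n.
Proof.
rewrite /fcol /= /Nbar_mx; have -> : (0 : 'I_(1 + n)) = lshift n 0 by apply/val_inj.
rewrite (@block_mxEh _ 1 n 1 n) (@colKl _ (1 + n) 1 n) (@mul_col_mx _ 1 n n 1).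
rewrite mul0mx mul1mx; apply/colP => i; have := @splitK 1 n i.
case: (@fintype.split 1 n i) => j <- /=.
  rewrite (ord1 j) !mxE (unsplitK (inl _)) !mxE.
  have -> : (@lshift 1 n 0 == 0 :> 'I_n.+1) by apply/eqP/val_inj.
  by rewrite eqxx add0r.
by rewrite !mxE (unsplitK (inr _)) addr0.
Qed.

(** Charts of G/P lift to affine maps into the space of nonzero vectors. Partial derivatives in a
    chart therefore become iterated derivatives of [Phi] along fixed vectors. *)
Lemma chartE al lam (f : Ind n al lam) Phi g : (forall g, f g = Phi (fcol g)) ->
  chart g f = (fun x => Phi (val g *m embJ *m x + fcol g)).
Proof.
move=> fE; apply/funext => x.
by rewrite /chart fE fcolM fcol_Nbar mulmxDr mulmxA -fcolE.
Qed.

Lemma chart_neq0 g (x : 'cV[R]_n) :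
  (val g *m embJ *m x + fcol g : 'cV[R]_n.+1) != 0.
Proof.
have <- : fcol (g * Nbar x)%g = val g *m embJ *m x + fcol g.
  by rewrite fcolM fcol_Nbar mulmxDr mulmxA -fcolE.
exact: fcol_neq0.
Qed.

Lemma pd_chart al lam (f : Ind n al lam) Phi g s : (forall g, f g = Phi (fcol g)) ->
  pd s (chart g f) = (fun x => foldr (fun j => derivC (val g *m embJ *m delta_mx j 0))
    Phi s (val g *m embJ *m x + fcol g)).
Proof.
by move=> fE; rewrite (chartE g fE) (pd_affine s (mulmx (val g *m embJ))).
Qed.

Lemma chart_lin al lam (c : R[i]) (f1 f2 : Ind n al lam) g :
  chart g (c *: f1 + f2) = (fun x => c * chart g f1 x + chart g f2 x).
Proof. by []. Qed.

(** N_- is a vector group, so moving the base point inside it translates the chart. *)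
Lemma chart_shift al lam (f : Ind n al lam) g y :
  chart (g * Nbar y)%g f = (fun x => chart g f (x + y)).
Proof.
apply/funext => x; rewrite /chart -mulgA; congr (f (_ * _)%g).
apply/val_inj => /=; rewrite /Nbar_mx (@mulmx_block _ 1 n 1 n 1 n).
by rewrite !mul0mx !mulmx0 !mulmx1 !mul1mx !addr0 add0r addrC.
Qed.

End Charts.

Lemma chart_smooth (R : realType) m al (lam : R[i]) (f : Ind m.+1 al lam) g :
  smooth_on setT (chart g f).
Proof.
have [Phi [sP _] fE] := Ind_homog f; rewrite (chartE g fE).
have cL := @mulmx_continuous R m.+2 m.+1 1 (val g *m @embJ R m.+1).
apply: smooth_onW (smooth_on_affine (fcol g) cL sP) => x _.
exact: chart_neq0.
Qed.

(** * The differential operators *)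

Section Restriction.
Variable R : realType.
Implicit Types (h : SL R 2).

Definition embG : 'M[R]_(2 + 1, 2) := col_mx 1%:M 0.
Local Notation J := (embG : 'M[R]_(3, 2)).
Definition e2 : 'cV[R]_3 := @delta_mx R (2 + 1) 1 (rshift 2 0) 0.

Lemma iotaGM h h' : iotaG (h * h')%g = (iotaG h * iotaG h')%g.
Proof.
apply/val_inj => /=; rewrite (@mulmx_block _ 2 1 2 1 2 1).
by rewrite !mul0mx !mulmx0 mulmx1 !addr0 add0r.
Qed.

Lemma iotaG1 : iotaG (1%g : SL R 2) = 1%g.
Proof. apply/val_inj/esym; exact: (@scalar_mx_block _ 2 1 1). Qed.

Lemma col_iotaG h j : col (lshift 1 j) (val (iotaG h) : 'M[R]_(2 + 1)) = J *m col j (val h).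
Proof.
rewrite /= (@block_mxEh _ 2 1 2 1) (@colKl _ (2 + 1) 2 1).
by rewrite (@mul_col_mx _ 2 1 2 1) mul1mx mul0mx (@col_col_mx _ 2 1 2) col0.
Qed.

Lemma fcol_iotaG h : fcol (iotaG h) = J *m fcol h.
Proof.
by rewrite /fcol -col_iotaG; congr col; apply/val_inj.
Qed.

Lemma embJ_delta n (i : 'I_n) :
  (@embJ R n : 'M[R]_(1 + n, n)) *m delta_mx i 0 = delta_mx (rshift 1 i) 0 :> 'cV[R]_(1 + n).
Proof.
rewrite -colE; apply/colP => k; rewrite !mxE; have := @splitK 1 n k.
case: (@fintype.split 1 n k) => j <- /=; rewrite !mxE.
  by rewrite (ord1 j); case: eqP => // /(congr1 val).
by rewrite andbT (inj_eq (@rshift_inj 1 n)).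
Qed.

(** In the chart at [iotaG h] the first coordinate direction is the second column of [h] and moves
    with [h], while the second direction is the constant [e2]. Only derivatives in the first one can
    obstruct equivariance. *)
Lemma iotaG_dir0 h : val (iotaG h) *m @embJ R 2 *m delta_mx 0 0 = J *m col 1 (val h).
Proof.
rewrite -mulmxA embJ_delta -colE -col_iotaG; congr col.
exact/val_inj.
Qed.

Lemma iotaG_dir1 h : val (iotaG h) *m @embJ R 2 *m delta_mx 1 0 = e2.
Proof.
rewrite -mulmxA embJ_delta -colE.
have -> : rshift 1 (1 : 'I_2) = @rshift 2 1 0 by apply/val_inj.
rewrite /= (@block_mxEh _ 2 1 2 1) (@colKr _ (2 + 1) 2 1).
apply/colP => k; rewrite !mxE; have := @splitK 2 1 k.
case: (@fintype.split 2 1 k) => j <- /=; rewrite ?(unsplitK (inl _)) ?(unsplitK (inr _)) !mxE.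
  by rewrite andbT; case: eqP => // /(congr1 val) /= E; have := ltn_ord j; rewrite E.
by rewrite !ord1 !eqxx.
Qed.

Definition emb1 : 'M[R]_(2, 1) := delta_mx 0 0.

Lemma embG_delta (i : 'I_2) : J *m delta_mx i 0 = delta_mx (lshift 1 i) 0 :> 'cV[R]_(2 + 1).
Proof.
rewrite -colE; apply/colP => k; rewrite !mxE; have := @splitK 2 1 k.
case: (@fintype.split 2 1 k) => j <- /=; rewrite !mxE ?andbT.
  by rewrite (inj_eq (@lshift_inj 2 1)).
case: eqP => // /(congr1 val) /= E.
by have := ltn_ord i; rewrite -E.
Qed.

Lemma embG_e0 : J *m e0 R 1 = e0 R 2.
Proof. by rewrite /e0 embG_delta; congr delta_mx; apply/val_inj. Qed.

(** The splittings 1 + 2 and 2 + 1 of the index set do not match blockwise. Writing [Nbar] and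
    [iotaG] as the identity plus a product of rectangular matrices makes them comparable in
    [iotaG_Nbar]. *)
Lemma Nbar_mxE n (x : 'cV[R]_n) :
  Nbar_mx x = 1%:M + (embJ R n : 'M[R]_(n.+1, n)) *m x *m (e0 R n)^T.
Proof.
have -> : (e0 R n)^T = row_mx 1%:M 0 :> 'M[R]_(1, 1 + n).
  apply/matrixP => i j; rewrite !mxE (ord1 i) !eqxx /=; have := @splitK 1 n j.
  case: (@fintype.split 1 n j) => k <- /=; rewrite ?(unsplitK (inl _)) ?(unsplitK (inr _)) !mxE //.
  by rewrite !ord1 andbT; congr (nat_of_bool _)%:R; apply/eqP/val_inj.
rewrite (@mul_col_mx _ 1 n n 1) mul0mx mul1mx (@mul_col_row _ 1 n 1 1 n).
rewrite !mul0mx !mulmx1 !mulmx0 [X in X + _](@scalar_mx_block _ 1 n 1).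
by rewrite (@add_block_mx _ 1 n 1 n) !addr0 add0r.
Qed.

Lemma iotaG_mxE h : val (iotaG h) = 1%:M + J *m (val h - 1%:M) *m J^T.
Proof.
rewrite /= -[X in X + _]/(1%:M : 'M[R]_(2 + 1)) (@scalar_mx_block _ 2 1 1).
rewrite (@mul_col_mx _ 2 1 2 2) mul1mx mul0mx (@tr_col_mx _ 2 1 2) trmx1 trmx0.
rewrite (@mul_col_row _ 2 1 2 2 1) !mul0mx !mulmx0 mulmx1.
by rewrite (@add_block_mx _ 2 1 2 1) !addr0 addrC subrK.
Qed.

Lemma embG_embJ : J *m embJ R 1 = embJ R 2 *m emb1.
Proof.
rewrite /emb1 embJ_delta; have -> : embJ R 1 = delta_mx (rshift 1 0) 0 :> 'cV[R]_2.
  by rewrite -embJ_delta -colE; apply/colP => i; rewrite [RHS]mxE.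
by rewrite embG_delta; congr delta_mx; apply/val_inj.
Qed.

Lemma iotaG_Nbar (x : 'cV[R]_1) : iotaG (Nbar x) = Nbar (emb1 *m x).
Proof.
apply/val_inj; rewrite iotaG_mxE [RHS]Nbar_mxE [val (Nbar x)]Nbar_mxE.
congr (_ + _); rewrite addrC addKr -embG_e0 trmx_mul !mulmxA.
by rewrite embG_embJ.
Qed.

(** The description of P as a stabiliser spares the computation of the factors of [iotaG p]. *)
Lemma iotaG_parabolic (p : SL R 2) : parabolic p -> parabolic (iotaG p).
Proof.
move=> [k [t [u pM]]]; have [dk _] := pM; have [c0 _ _] := MAN_coef t dk.
have [|k' [t' [u' [pM' _]]]] := @parabolicP R 2 isT (iotaG p) _ c0; last by exists k', t', u'.
by rewrite fcol_iotaG (MAN_fcol pM) -scalemxAr embG_e0.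
Qed.

End Restriction.

Section Operators.
Variables (R : realType) (al be : bool) (lam nu : R[i]).
Local Notation J := (@embG R : 'M[R]_(3, 2)).
Let onz : open (@nz R 2) := @open_nz R 2.
Implicit Types (f : Ind 2 al lam) (h : SL R 2).

Definition opw m l : seq 'I_2 := nseq m 1 ++ nseq l 0.

(** Taking the derivative at the centre of the chart at [iotaG h] builds in covariance under left
    translation by G'; what remains to be shown is equivariance under P' on the right. *)
Definition op m l f h : R[i] := pd (opw m l) (chart (iotaG h) f) 0.

Lemma foldr_nseq (T U : Type) (F : T -> U -> U) m a x :
  foldr F x (nseq m a) = iter m (F a) x.
Proof. by elim: m => //= m ->. Qed.

Lemma pd_opw m l F : pd (opw m l) F =
  iter m (derivC (delta_mx 1 0)) (iter l (derivC (delta_mx 0 0)) F) :> (_ -> R[i]).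
Proof. by rewrite pd_cat /pd !foldr_nseq. Qed.

Lemma opE f Phi m l h : homog al lam Phi -> (forall g, f g = Phi (fcol g)) ->
  op m l f h = iter l (derivC (J *m col 1 (val h)))
    (iter m (derivC (e2 R)) Phi) (J *m fcol h).
Proof.
move=> [sP _] fE; rewrite /op (pd_chart _ _ fE) mulmx0 add0r foldr_cat !foldr_nseq.
rewrite iotaG_dir0 iotaG_dir1 -fcol_iotaG.
by apply: (iter_derivC_comm _ _ _ _ onz sP); exact: fcol_neq0.
Qed.

Lemma Ck_moving k W i j : open W -> Ck k W (fun A : 'M[R]_2 => (J *m col 0 A) i j).
Proof.
move=> oW; apply: Ck_ext (Ck_sum (index_enum 'I_2) oW
  (F := fun r (A : 'M[R]_2) => J i r * A r 0) _) => //.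
  by move=> A _; rewrite mxE; apply: eq_bigr => r _; congr (_ * _); rewrite mxE.
by move=> r; apply: Ck_scale => //; exact: Ck_coord.
Qed.

Lemma open_moving : open [set A : 'M[R]_2 | J *m col 0 A != 0].
Proof.
have cphi : continuous (fun A : 'M[R]_2 => J *m col 0 A).
  move=> A; apply: mx_continuous => i j.
  by have [c _] := Ck_moving 0 i j (@openT 'M[R]_2); exact: c.
rewrite openE => A UA; have := cphi A (@nz R 2); apply.
by apply: open_nbhs_nbhs; split; [exact: onz|exact: UA].
Qed.

(** The direction varies with [A], but at a fixed [A] it is a combination of two constant vectors
    with coefficients [A 0 1] and [A 1 1]. Expanding one derivative at a time moves these
    coefficients outside. *)
Lemma smooth_moving_derivC (Psi : 'cV[R]_3 -> R[i]) l : smooth_on (@nz R 2) Psi ->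
  smooth_on [set A : 'M[R]_2 | J *m col 0 A != 0]
    (fun A => iter l (derivC (J *m col 1 A)) Psi (J *m col 0 A)).
Proof.
set U := [set A | _]; pose phi (A : 'M[R]_2) := J *m col 0 A.
have oU : open U := open_moving.
elim: l Psi => [|l IH] Psi sP.
  apply: (smooth_on_chain (phi := phi) onz oU sP) => // k i j.
  exact: Ck_moving.
have dirE (A : 'M[R]_2) : J *m col 1 A = A 0 1 *: (J *m delta_mx 0 0) +
    A 1 1 *: (J *m delta_mx 1 0).
  rewrite 2!scalemxAr -mulmxDr; congr (_ *m _); apply/colP => i; rewrite !mxE.
  case: i => -[|[|//]] Hi; rewrite /= ?mulr1 ?mulr0 ?addr0 ?add0r;
    by congr (A _ _); apply/val_inj.
have s1 i := IH _ (smooth_on_derivC (J *m delta_mx i 0) sP).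
apply: smooth_on_ext (smooth_on_add oU
  (smooth_on_mul oU (smooth_on_real (fun k => @Ck_coord R 2 2 k U 0 1)) (s1 0))
  (smooth_on_mul oU (smooth_on_real (fun k => @Ck_coord R 2 2 k U 1 1)) (s1 1))) => // A UA.
rewrite iterSr [in RHS](iter_derivC_ext (G := fun v =>
   (A 0 1)%:C * derivC (J *m delta_mx 0 0) Psi v +
   (A 1 1)%:C * derivC (J *m delta_mx 1 0) Psi v) _ _ onz _ UA); last first.
  move=> v v0; rewrite dirE (derivC_dirP _ _ _ onz sP v0).
  by rewrite (derivC_dirZ _ _ onz sP v0).
have sd i := smooth_on_derivC (J *m delta_mx i 0) sP.
rewrite (iter_derivC_add _ _ onz (smooth_on_scale _ onz (sd 0))
  (smooth_on_scale _ onz (sd 1)) UA).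
by rewrite !(iter_derivC_scale _ _ _ onz (sd _) UA).
Qed.

Lemma op_smooth f m l : smoothSL (op m l f).
Proof.
have [Phi hP fE] := Ind_homog f.
have sP := smooth_on_iter (e2 R) m hP.1.
move=> h; set U := [set A : 'M[R]_2 | J *m col 0 A != 0].
have sF := smooth_moving_derivC l sP.
exists U, (fun A => iter l (derivC (J *m col 1 A))
  (iter m (derivC (e2 R)) Phi) (J *m col 0 A)); split=> //.
- exact: open_moving.
- by have := fcol_neq0 (iotaG h); rewrite fcol_iotaG.
- by move=> h' _; rewrite (opE m l h' hP fE).
Qed.

(** A derivative along e_1 counts twice: it lowers the degree by one, and the torus of G' scales e_1
    inversely to e_0. For l > 0 the last clause says lam + m = 1 - l, the degree required by
    [bol]. *)
Definition admissible m l := [/\ be = addsgn al (m + 2 * l),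
  nu = lam + (m + 2 * l)%:R & l = 0 \/ lam = 1 - (m + l)%:R].

Lemma MAN1_col1 k t u (p : SL R 2) (c := (\det k)^-1 * expR t) : MAN k t u p ->
  col 1 (val p) = c^-1 *: delta_mx 1 0 + (val p 0 1) *: e0 R 1.
Proof.
move=> pM; have [dk _] := pM; have [c0 _ _] := MAN_coef t dk.
have p1 := MAN_fcol pM; rewrite -/c in p1 c0.
have p10 : val p 1 0 = 0.
  by have := congr1 (fun v : 'cV[R]_2 => v 1 0) p1; rewrite !mxE mulr0.
have p00 : val p 0 0 = c.
  by have := congr1 (fun v : 'cV[R]_2 => v 0 0) p1; rewrite !mxE mulr1.
have p11 : val p 1 1 = c^-1.
  apply: (mulfI c0); rewrite divff //; have := SL_det p; rewrite -det_tr det_trig.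
    rewrite !big_ord_recl big_ord0 mulr1 !mxE p00 => E; apply: etrans E.
    by congr (_ * val p _ _); apply/val_inj.
  apply/is_trig_mxP => i j ij; rewrite mxE.
  suff [-> ->] : i = 0 /\ j = 1 by [].
  by case: i ij => -[|[|//]] ?; case: j => -[|[|//]] ? // _; split; apply/val_inj.
apply/colP => i; rewrite !mxE; case: i => -[|[|//]] Hi; rewrite /= ?mulr1 ?mulr0 ?addr0 ?add0r.
  by congr (val p _ _); apply/val_inj.
by rewrite -p11; congr (val p _ _); apply/val_inj.
Qed.

Lemma op_equivariant f m l : admissible m l -> equivariant be nu (op m l f).
Proof.
move=> [-> -> lP] h k t u p pM; have [dk _] := pM.
have [c0 _ _] := MAN_coef t dk; rewrite sigma_kap //; set c := _^-1 * _ in c0 *.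
have [Phi hP fE] := Ind_homog f; rewrite !(opE m l _ hP fE).
set Psi := iter m _ Phi; have hPsi := homog_iter (e2 R) m hP; rewrite -/Psi in hPsi.
set v := J *m fcol h; have v0 : v != 0 by rewrite /v -fcol_iotaG fcol_neq0.
set w := J *m col 1 (val h).
have vE : J *m fcol (h * p)%g = c *: v.
  by rewrite fcolM (MAN_fcol pM) -/c -!scalemxAr -fcolE.
have wE : J *m col 1 (val (h * p)%g) = (val p 0 1 / c) *: (c *: v) + c^-1 *: w.
  rewrite /= colE -mulmxA -colE (MAN1_col1 pM) -/c mulmxDr -!scalemxAr -fcolE -colE.
  by rewrite mulmxDr -!scalemxAr scalerA divfK // addrC.
have cv0 : c *: v != 0 by apply: nzZ.
(* The unipotent part of [p] only adds a multiple of the base vector to the direction, which [bol]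
   removes. *)
rewrite vE wE; have -> : iter l (derivC ((val p 0 1 / c) *: (c *: v) + c^-1 *: w)) Psi (c *: v)
    = iter l (derivC (c^-1 *: w)) Psi (c *: v).
  case: lP => [-> //|lamE]; move: hPsi.
  have -> : lam + m%:R = 1 - l%:R by rewrite lamE natrD; ring.
  by move=> hPsi; exact: bol hPsi cv0.
rewrite (iter_derivC_dirZ _ _ _ hPsi.1 cv0).
have [_ ->] := homog_iter w l hPsi => //.
(* Raising the exponent by [l] once more produces [c ^+ l], which cancels the factor from the
   direction [c^-1 *: w]. *)
rewrite addsgnD -addrA -natrD -(kap_addsgn _ _ l c0) addsgnD -addrA -natrD.
rewrite -addnA addnn -mul2n mulrA; congr (_ * _).
rewrite mulrCA -rmorphM -exprMn mulVf // expr1n mulr1 //.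
Qed.

Section Combination.
Variables (a b : R[i]) (m l m' l' : nat).
Hypotheses (adm : admissible m l) (adm' : admissible m' l').

Fact comb_subproof f : (fun h => a * op m l f h + b * op m' l' f h) \in @Ind_pred R 1 be nu.
Proof.
rewrite inE; split.
  apply: smoothSL_lin; first exact: op_smooth.
  have E : op m' l' f = op m' l' f by [].
  have H := smoothSL_lin b (@op_smooth f m' l') (@smoothSL0 R 2).
  by move: H; under eq_fun do rewrite addr0.
move=> h k t u p pM; rewrite (op_equivariant _ adm _ pM) (op_equivariant _ adm' _ pM).
by rewrite mulrDr !(mulrCA _ (_^-1)).
Qed.

(** Combinations of two operators serve both nonzero cases of the theorem; the one-dimensional case
    is [b = 0]. *)
Definition comb f : Ind 1 be nu :=
  Sub (fun h => a * op m l f h + b * op m' l' f h) (comb_subproof f).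

Lemma op_linear n k (c : R[i]) f1 f2 h :
  op n k (c *: f1 + f2) h = c * op n k f1 h + op n k f2 h.
Proof.
rewrite /op chart_lin pd_lin //; exact: chart_smooth.
Qed.

Fact comb_linear : linear comb.
Proof.
move=> c f1 f2; apply: Ind_ext => h.
suff : a * op m l (c *: f1 + f2) h + b * op m' l' (c *: f1 + f2) h =
  c * (a * op m l f1 h + b * op m' l' f1 h) + (a * op m l f2 h + b * op m' l' f2 h).
  exact.
by rewrite !op_linear; ring.
Qed.

HB.instance Definition _ := GRing.isLinear.Build _ _ _ _ comb comb_linear.

End Combination.
End Operators.

(** * The operators are continuous, intertwining and local *)

Section Existence.
Variables (R : realType) (al be : bool) (lam nu : R[i]).
Implicit Types (f : Ind 2 al lam) (h : SL R 2).

Lemma iotaGV h : (iotaG h)^-1%g = iotaG (h^-1)%g.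
Proof.
apply: (mulgI (iotaG h)); rewrite mulgV -iotaGM mulgV.
by rewrite iotaG1.
Qed.

Lemma chart_act n (f : Ind n al lam) g g' : chart g (act g' f) = chart (g'^-1 * g)%g f.
Proof. by apply/funext => x; rewrite /chart -[LHS]/(f (g'^-1 * (g * Nbar x))%g) mulgA. Qed.

Lemma op_act f m l h h' : op m l (act (iotaG h') f) h = op m l f (h'^-1 * h)%g.
Proof. by rewrite /op chart_act iotaGV -iotaGM. Qed.

Lemma pd_shift n (s : seq 'I_n) (F : 'cV[R]_n -> R[i]) y :
  pd s (fun x => F (x + y)) = (fun x => pd s F (x + y)).
Proof. exact: (pd_affine s (idfun : {linear 'cV[R]_n -> 'cV[R]_n}) y F). Qed.

(** The chart of G'/P' at [h] is the line x_2 = 0 in the chart of G/P at [iotaG h]. *)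
Lemma op_chart f m l h : (fun x => op m l f (h * Nbar x)%g) =
  (fun x => pd (opw m l) (chart (iotaG h) f) (emb1 R *m x)).
Proof.
by apply/funext => x; rewrite /op iotaGM iotaG_Nbar chart_shift pd_shift add0r.
Qed.

Lemma pd_emb1 (s : seq 'I_1) (F : 'cV[R]_2 -> R[i]) :
  pd s (fun x => F (emb1 R *m x)) =
  (fun x => pd (nseq (size s) 0) F (emb1 R *m x)).
Proof.
have E : (fun x : 'cV[R]_1 => F (emb1 R *m x)) = (fun x => F (mulmx (emb1 R) x + 0)).
  by apply/funext => x; rewrite addr0.
rewrite E (pd_affine s (mulmx (emb1 R))); apply/funext => x; rewrite addr0.
have D (j : 'I_1) : emb1 R *m delta_mx j 0 = delta_mx 0 0.
  by rewrite /emb1 mul_delta_mx_cond (ord1 j) eqxx.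
have -> // : foldr (fun j => derivC (emb1 R *m delta_mx j 0)) F s =
  pd (nseq (size s) 0) F.
by elim: s => [|j s IH] //; rewrite /pd /= IH D.
Qed.

Lemma op_restr f m l x1 : op m l f (Nbar (x1 *: delta_mx 0 0)) = DD al lam m l f x1.
Proof.
have := congr1 (fun F => F (x1 *: delta_mx 0 0)) (op_chart f m l 1%g).
rewrite mul1g iotaG1 => ->; rewrite /DD pd_opw.
by rewrite -scalemxAr -colE; congr (iter _ _ _ (_ *: _)); apply/colP => i; rewrite mxE.
Qed.

Lemma near_pd n (s : seq 'I_n) (F G : 'cV[R]_n -> R[i]) (x : 'cV[R]_n) :
  (\forall y \near x, F y = G y) -> \forall y \near x, pd s F y = pd s G y.
Proof.
move=> FG; elim: s => //= j s IH.
by apply: filterS (near_join IH) => y; exact: near_derivC.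
Qed.

Lemma iotaG_continuous : continuous (@iotaG R).
Proof.
move=> h; have FF : Filter (nbhs h) := nbhs_filter h; apply: cvg_initial.
pose B (A : 'M[R]_2) : 'M[R]_3 := block_mx A 0 0 1%:M : 'M[R]_(2 + 1).
have cB : continuous B.
  move=> A; apply: mx_continuous => i j.
  have E : (exists i' j', (fun A => B A i j) = (fun A : 'M[R]_2 => A i' j')) \/
      (exists c : R, (fun A => B A i j) = (fun=> c)).
    have := @splitK 2 1 i; case: (@fintype.split 2 1 i) => i' <- /=;
    have := @splitK 2 1 j; case: (@fintype.split 2 1 j) => j' <- /=.
    - by left; exists i', j'; apply/funext => A'; rewrite /B (@block_mxEul _ 2 1 2 1).
    - by right; exists 0; apply/funext => A'; rewrite /B (@block_mxEur _ 2 1 2 1) mxE.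
    - by right; exists 0; apply/funext => A'; rewrite /B (@block_mxEdl _ 2 1 2 1) mxE.
    - by right; exists ((1%:M : 'M[R]_1) i' j'); apply/funext => A'; rewrite /B (@block_mxEdr _ 2 1 2 1).
  case: E => [[i' [j' ->]]|[c ->]].
    exact: (@coord_continuous R 2 2 i' j' A).
  exact: (@cst_continuous _ _ c A).
have cv := @initial_continuous _ _ (val : SL R 2 -> 'M[R]_2) h.
exact: (cvg_comp _ _ cv (cB (val h))).
Qed.

Lemma Nbar_continuous n (g : SL R n.+1) : continuous (fun x : 'cV[R]_n => (g * Nbar x)%g).
Proof.
move=> x; have FF : Filter (nbhs x) := nbhs_filter x; apply: cvg_initial.
have cN : continuous (@Nbar_mx R n).
  move=> y; apply: mx_continuous => i j.
  have E : (exists i', (fun y => Nbar_mx y i j) = (fun y : 'cV[R]_n => y i' 0)) \/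
      (exists c : R, (fun y => Nbar_mx y i j) = (fun=> c)).
    rewrite /Nbar_mx.
    have := @splitK 1 n i; case: (@fintype.split 1 n i) => i' <- /=;
    have := @splitK 1 n j; case: (@fintype.split 1 n j) => j' <- /=.
    - by right; exists ((1%:M : 'M[R]_1) i' j'); apply/funext => A'; rewrite (@block_mxEul _ 1 n 1 n).
    - by right; exists 0; apply/funext => A'; rewrite (@block_mxEur _ 1 n 1 n) mxE.
    - by left; exists i'; apply/funext => A'; rewrite (@block_mxEdl _ 1 n 1 n) (ord1 j').
    - by right; exists ((1%:M : 'M[R]_n) i' j'); apply/funext => A'; rewrite (@block_mxEdr _ 1 n 1 n).
  case: E => [[i' ->]|[c ->]].
    exact: (@coord_continuous R n 1 i' 0 y).
  exact: (@cst_continuous _ _ c y).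
exact: (cvg_comp _ _ (cN x) (@mulmx_continuous R n.+1 n.+1 n.+1 (val g) (Nbar_mx x))).
Qed.

Lemma op_supp0 f m l h (Z : set (SL R 3)) : closed Z -> [set g | f g != 0] `<=` Z ->
  ~ Z (iotaG h) -> op m l f h = 0.
Proof.
move=> cZ fZ nZ; have oZ : open (~` Z) by exact: closed_openC.
have H : \forall x \near (0 : 'cV[R]_2), chart (iotaG h) f x = 0.
  have N0 : (iotaG h * Nbar 0)%g = iotaG h.
    rewrite -[RHS]mulg1; congr (_ * _)%g; apply/val_inj.
    by rewrite /= Nbar_mxE mulmx0 mul0mx addr0.
  have := @Nbar_continuous 2 (iotaG h) 0 (~` Z); rewrite /= N0 => C.
  have {}C : \forall x \near (0 : 'cV[R]_2), ~ Z (iotaG h * Nbar x)%g.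
    exact: C (open_nbhs_nbhs (conj oZ nZ)).
  apply: filterS C => x /= nx; apply/eqP/negPn/negP => fx; apply: nx.
  exact: fZ.
have := near_pd (opw m l) H; move=> /nbhs_singleton; rewrite /op => ->.
suff -> : pd (opw m l) (fun=> 0) = (fun=> 0 : R[i]) by [].
elim: (opw m l) => //= j s ->; apply/funext => x; exact: derivC_cst.
Qed.

Section Combination.
Variables (a b : R[i]) (m l m' l' : nat).
Hypotheses (adm : admissible al be lam nu m l) (adm' : admissible al be lam nu m' l').
Local Notation T := (comb a b adm adm').

(** A jet of [T f] in a chart of G'/P' is a combination of two jets of [f] in one chart of G/P, of
    order higher by m + l and m' + l'. This is the whole content of [comb_continuous]. *)
Lemma pd_comb f h s : pd s (chart h (T f)) = (fun x =>
  a * pd (nseq (size s) 0 ++ opw m l) (chart (iotaG h) f) (emb1 R *m x) +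
  b * pd (nseq (size s) 0 ++ opw m' l') (chart (iotaG h) f) (emb1 R *m x)).
Proof.
have sm k j : smooth_on setT (fun x : 'cV[R]_1 =>
    pd (opw k j) (chart (iotaG h) f) (emb1 R *m x)).
  have sF := pd_smooth (opw k j) (chart_smooth f (iotaG h)).
  have := smooth_on_affine 0 (@mulmx_continuous R 2 1 1 (emb1 R)) sF.
  rewrite (_ : [set y | _] = setT); last by apply/seteqP; split.
  apply: smooth_on_ext; first exact: openT.
  by move=> x _; rewrite addr0.
have -> : chart h (T f) = (fun x =>
   a * pd (opw m l) (chart (iotaG h) f) (emb1 R *m x) +
   (b * pd (opw m' l') (chart (iotaG h) f) (emb1 R *m x) + 0)).
  apply/funext => x; rewrite addr0.
  have E k j := congr1 (fun F => F x) (op_chart f k j h).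
  by rewrite -(E m l) -(E m' l').
rewrite pd_lin //; last first.
  apply: smooth_on_lin; [exact: openT|exact: sm|exact: smooth_on0].
rewrite pd_lin //; last exact: smooth_on0.
rewrite !pd_emb1 !pd_cat; apply/funext => x.
suff -> : pd s (fun=> 0) = (fun=> 0 : R[i]) by rewrite addr0.
by elim: s => //= j s ->; apply/funext => y; exact: derivC_cst.
Qed.

Lemma comb_continuous : continuous T.
Proof.
move=> f; have FF : Filter (nbhs f) := nbhs_filter f; apply: cvg_Ind => K s h e cK e0.
(* [M] exceeds the sum of the four coefficients by 1, which makes it positive and the final
   estimate, [(M - 1) * (e / M) < e], strict. *)
pose M := `|complex.Re a| + `|complex.Im a| + `|complex.Re b| + `|complex.Im b| + 1.
have M0 : 0 < M by rewrite ltr_wpDl ?ltr01 ?addr_ge0.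
have eM : 0 < e / M by rewrite divr_gt0.
have cK' : compact ((fun x : 'cV[R]_1 => emb1 R *m x) @` K).
  apply: continuous_compact => //; apply: continuous_subspaceT.
  exact: mulmx_continuous.
have N k j := @near_Ind R 2 al lam f _ (nseq (size s) 0 ++ opw k j) (iotaG h) _ cK' eM.
apply: filterS2 (N m l) (N m' l') => f' H1 H2 x Kx.
have {H1} := H1 _ (ex_intro2 _ _ x Kx erefl).
have {H2} := H2 _ (ex_intro2 _ _ x Kx erefl).
rewrite !pd_comb.
move: (pd _ (chart _ f) _) (pd _ (chart _ f') _) (pd _ (chart _ f) _) (pd _ (chart _ f') _).
move=> z1 z1' z2 z2' [r2 i2] [r1 i1].
have bnd (p q r t x1 x2 x3 x4 : R) : `|x1| < e / M -> `|x2| < e / M -> `|x3| < e / M ->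
    `|x4| < e / M -> `|p| + `|q| + `|r| + `|t| + 1 = M ->
    `|p * x1 + q * x2 + (r * x3 + t * x4)| < e.
  move=> h1 h2 h3 h4 hM.
  apply: le_lt_trans (_ : (M - 1) * (e / M) < _); last first.
    by rewrite mulrBl mul1r mulrC divfK ?gt_eqF // ltrBlDr ltrDl.
  have -> : M - 1 = `|p| + `|q| + (`|r| + `|t|) by rewrite -hM; ring.
  rewrite !mulrDl; apply: le_trans (ler_normD _ _) _; apply: lerD;
  apply: le_trans (ler_normD _ _) _; apply: lerD; rewrite normrM ler_wpM2l // ltW //.
split.
  have -> : complex.Re (a * z1 + b * z2) - complex.Re (a * z1' + b * z2') =
     complex.Re a * (complex.Re z1 - complex.Re z1') +
     (- complex.Im a) * (complex.Im z1 - complex.Im z1') +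
     (complex.Re b * (complex.Re z2 - complex.Re z2') +
     (- complex.Im b) * (complex.Im z2 - complex.Im z2')).
    by rewrite !(Re_add, Re_mul); ring.
  by apply: bnd => //; rewrite !normrN.
have -> : complex.Im (a * z1 + b * z2) - complex.Im (a * z1' + b * z2') =
   complex.Re a * (complex.Im z1 - complex.Im z1') +
   complex.Im a * (complex.Re z1 - complex.Re z1') +
   (complex.Re b * (complex.Im z2 - complex.Im z2') +
   complex.Im b * (complex.Re z2 - complex.Re z2')).
  by rewrite !(Im_add, Im_mul); ring.
exact: bnd.
Qed.

Lemma comb_act f h : T (act (iotaG h) f) = act h (T f).
Proof.
apply: Ind_ext => k.
by rewrite -[LHS]/(a * op m l _ k + b * op m' l' _ k) !op_act.
Qed.

Lemma comb_supp f : @iotaG R @` Supp (T f) `<=` Supp f.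
Proof.
move=> _ [h Sh <-] Z [cZ pZ fZ].
(* A closed invariant set that competes for the support of [f] pulls back along [iotaG] to one that
   competes for the support of [T f]. *)
apply: (Sh [set h' | Z (iotaG h')]); split.
- by apply: preimage_closed => // x _; exact: iotaG_continuous.
- by move=> g p /= Zg pp; rewrite iotaGM; apply: pZ => //; exact: iotaG_parabolic.
- move=> k /= Tk; apply: contrapT => nZ; move/negP: Tk; apply; apply/eqP.
  rewrite -[LHS]/(a * op m l f k + b * op m' l' f k).
  by rewrite !(op_supp0 _ _ cZ fZ nZ) !mulr0 addr0.
Qed.

Lemma comb_Diff : Diff al be lam nu T.
Proof. by split; [exact: comb_continuous|move=> h f; exact: comb_act|exact: comb_supp]. Qed.

Lemma restrJ_comb : restrJ T = a *: DD al lam m l + b *: DD al lam m' l'.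
Proof.
apply/funext => f; apply/funext => x1.
rewrite -[RHS]/(a * DD al lam m l f x1 + b * DD al lam m' l' f x1) -!op_restr.
by rewrite /restrJ /chart mul1g.
Qed.

End Combination.
End Existence.

(** * Families vanishing to finite order *)

Section UniformFamilies.
Variables (R : realType) (V : normedModType R).
Implicit Types (U : set V) (h : R -> V -> R).

(* The family h eps is O(eps^N) for 0 < eps <= 1, locally uniformly on U,
   together with its derivatives of order at most k. *)
Fixpoint unifO k N U h : Prop :=
  (forall x, U x -> exists C : R, \forall y \near x,
     forall eps : R, 0 < eps -> eps <= 1 -> `|h eps y| <= C * eps ^+ N) /\
  if k is k'.+1 then forall v, unifO k' N U (fun eps => 'D_v (h eps)) else True.

Definition family_smooth U h :=
  forall (eps : R) k, 0 < eps -> eps <= 1 -> Ck k U (h eps).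

Lemma family_smooth_derive U h v : family_smooth U h ->
  family_smooth U (fun eps => 'D_v (h eps)).
Proof. by move=> sh eps k e0 e1; exact: Ck_derive (sh eps k.+1 e0 e1). Qed.

Lemma unifOS k N U h : unifO k.+1 N U h -> unifO k N U h.
Proof.
elim: k h => [|k IH] h [b0 bS]; split=> // v; exact: IH (bS v).
Qed.

Lemma unifO_ext k N U h h' : open U ->
  (forall (eps : R) x, 0 < eps -> eps <= 1 -> U x -> h eps x = h' eps x) ->
  unifO k N U h -> unifO k N U h'.
Proof.
move=> oU; elim: k h h' => [|k IH] h h' hh [b0 bS]; split=> //.
1,2: move=> x Ux; have [C H] := b0 x Ux; exists C;
  apply: filterS2 H (open_nbhs_nbhs (conj oU Ux)) => y H Uy eps e0 e1;
  by rewrite -hh // H.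
move=> v; apply: IH (bS v) => eps x e0 e1 Ux; apply: near_eq_derive.
by apply: filterS (open_nbhs_nbhs (conj oU Ux)) => y Uy; exact: hh.
Qed.

Lemma unifO_loc k N U h :
  (forall x, U x -> exists2 U', U' x & unifO k N U' h) -> unifO k N U h.
Proof.
elim: k h => [|k IH] h H; split=> //.
1,2: by move=> x Ux; have [U' U'x [b0 _]] := H x Ux; exact: b0.
move=> v; apply: IH => x Ux; have [U' U'x [_ bS]] := H x Ux; exists U' => //; exact: bS.
Qed.

Lemma unifO0 k N U : unifO k N U (fun _ _ => 0).
Proof.
elim: k => [|k IH]; split=> //.
1,2: by move=> x _; exists 0; near=> y => eps _ _; rewrite normr0 mul0r.
move=> v; have -> : (fun _ : R => 'D_v (fun _ : V => 0 : R)) = (fun _ _ => 0).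
  by apply/funext => eps; apply/funext => x; rewrite derive_cst.
exact: IH.
Unshelve. all: by end_near. Qed.

Lemma unifO_add k N U h h' : open U -> family_smooth U h -> family_smooth U h' ->
  unifO k N U h -> unifO k N U h' -> unifO k N U (fun eps x => h eps x + h' eps x).
Proof.
move=> oU; elim: k h h' => [|k IH] h h' sh sh' [b0 bS] [b0' bS']; split=> //.
1,2: move=> x Ux; have [C H] := b0 x Ux; have [C' H'] := b0' x Ux; exists (C + C');
  apply: filterS2 H H' => y H H' eps e0 e1;
  by rewrite mulrDl (le_trans (ler_normD _ _)) // lerD ?H ?H'.
move=> v; apply: unifO_ext (IH _ _ (family_smooth_derive v sh)
  (family_smooth_derive v sh') (bS v) (bS' v)) => // eps x e0 e1 Ux.
rewrite deriveD //.
  exact: Ck_derivable (sh eps 1%N e0 e1) Ux.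
exact: Ck_derivable (sh' eps 1%N e0 e1) Ux.
Qed.

Lemma unifO_mul k N U (F : V -> R) h : open U -> (forall k, Ck k U F) ->
  family_smooth U h -> unifO k N U h -> unifO k N U (fun eps x => F x * h eps x).
Proof.
move=> oU; elim: k F h => [|k IH] F h sF sh [b0 bS]; split=> //.
1,2: move=> x Ux; have [C H] := b0 x Ux; exists ((`|F x| + 1) * C).
1,2: have cF := cvg_norm (Ck_continuous (sF 0%N) Ux).
1,2: have nF := cvgr_lt (`|F x|) (cF _) (`|F x| + 1) (ltr_pwDr ltr01 (lexx _)).
1,2: apply: filterS2 H (nF _ _) => y {}H {}nF eps e0 e1.
1,2: by rewrite normrM -mulrA ler_pM // ?H // ltW.
move=> v; have sh' : family_smooth U (fun eps => 'D_v (h eps)).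
  exact: family_smooth_derive.
apply: unifO_ext (unifO_add oU _ _ (IH _ _ sF sh' (bS v))
   (IH _ _ (fun k => Ck_derive v (sF k.+1)) sh _)) => //.
- move=> eps x e0 e1 Ux.
  have := is_deriveM (derivableP (Ck_derivable (v := v) (sF 1%N) Ux))
     (derivableP (Ck_derivable (v := v) (sh eps 1%N e0 e1) Ux)).
  by move=> [_ ->]; congr (_ + _); rewrite mulrC.
- by move=> eps j e0 e1; apply: Ck_mul => //; exact: sh'.
- by move=> eps j e0 e1; apply: Ck_mul; [|exact: Ck_derive (sF j.+1)|exact: sh].
- by apply: unifOS; split.
Qed.

Lemma unifO_eps k N U h : open U -> family_smooth U h -> unifO k N U h ->
  unifO k N.+1 U (fun eps x => eps * h eps x).
Proof.
move=> oU; elim: k h => [|k IH] h sh [b0 bS]; split=> //.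
1,2: move=> x Ux; have [C H] := b0 x Ux; exists C.
1,2: apply: filterS H => y H eps e0 e1.
1,2: by rewrite normrM gtr0_norm // exprS mulrCA ler_wpM2l ?H // ltW.
move=> v; apply: unifO_ext (IH _ (family_smooth_derive v sh) (bS v)) => // eps x e0 e1 Ux.
have [_ E] := is_deriveZ eps (derivableP (Ck_derivable (v := v) (sh eps 1%N e0 e1) Ux)).
by rewrite -[LHS]E.
Qed.

Lemma unifO_le k N U h : unifO k N.+1 U h -> unifO k N U h.
Proof.
elim: k h => [|k IH] h [b0 bS]; split=> //.
1,2: move=> x Ux; have [C H] := b0 x Ux; exists `|C|.
1,2: apply: filterS H => y H eps e0 e1; apply: le_trans (H eps e0 e1) _.
1,2: apply: (@le_trans _ _ (`|C| * eps ^+ N.+1)).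
1,3: by rewrite ler_wpM2r ?exprn_ge0 ?ler_norm // ltW.
1,2: by rewrite exprS ler_wpM2l // ler_piMl // exprn_ge0 // ltW.
by move=> v; exact: IH (bS v).
Qed.

(** The form in which a loss of one order of vanishing is repaid by a factor [eps]. For [N = 0],
    where [N.-1] is again 0, the gain is discarded. *)
Lemma unifO_eps_pred k N U h : open U -> family_smooth U h -> unifO k N.-1 U h ->
  unifO k N U (fun eps x => eps * h eps x).
Proof.
move=> oU sh; case: N => [|N] B; last exact: unifO_eps.
by apply: unifO_le; exact: unifO_eps.
Qed.

Lemma unifO_foldr k N U h s : unifO (size s + k) N U h ->
  unifO k N U (fun eps => foldr (fun v F => 'D_v F) (h eps) s).
Proof.
elim: s k => [|v s IH] k; first exact: id.
by rewrite [size _]/= addSnnS => /IH [_ ]; apply.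
Qed.

End UniformFamilies.

(** * The dilations with weights 2 and 1 *)

Section Scaling.
Variable R : realType.
Local Notation V := 'cV[R]_3.
Implicit Types (v : V) (G : V -> R).

Definition i1 : 'I_3 := @lshift 2 1 1.
Definition i2 : 'I_3 := @rshift 2 1 0.
Definition b0 : V := delta_mx 0 0.
Definition b1 : V := delta_mx i1 0.
Definition b2 : V := delta_mx i2 0.

Lemma col3_eq (v w : V) : v 0 0 = w 0 0 -> v i1 0 = w i1 0 -> v i2 0 = w i2 0 -> v = w.
Proof.
move=> h0 h1 h2; apply/colP => -[[|[|[|//]]] Hi].
- by have -> : Ordinal Hi = 0 by apply/val_inj.
- by have -> : Ordinal Hi = i1 by apply/val_inj.
- by have -> : Ordinal Hi = i2 by apply/val_inj.
Qed.

Lemma col3E v : v = v 0 0 *: b0 + (v i1 0 *: b1 + v i2 0 *: b2).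
Proof. by apply: col3_eq; rewrite !mxE /= ?mulr1 ?mulr0 ?addr0 ?add0r. Qed.

(* [scal eps] is [eps] times the element diag(eps^-1, eps, 1) of G', so that it
   fixes the first basis vector. *)
Definition weights (eps : R) : 'rV[R]_3 :=
  \row_r (if r == 0 then 1 else if r == i1 then eps ^+ 2 else eps).
Definition scal eps : 'M[R]_3 := diag_mx (weights eps).

Lemma scal0 eps v : (scal eps *m v) 0 0 = v 0 0.
Proof. by rewrite mul_diag_mx !mxE mul1r. Qed.
Lemma scal1 eps v : (scal eps *m v) i1 0 = eps ^+ 2 * v i1 0.
Proof. by rewrite mul_diag_mx !mxE. Qed.
Lemma scal2 eps v : (scal eps *m v) i2 0 = eps * v i2 0.
Proof. by rewrite mul_diag_mx !mxE. Qed.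

Definition U0 : set V := [set v | v 0 0 != 0].

Lemma open_U0 : open U0.
Proof.
have oN : open [set x : R | x != 0].
  have -> : [set x : R | x != 0] = ~` [set 0].
    by apply/seteqP; split=> x /=; [move/eqP|move=> h; apply/eqP].
  apply/closed_openC/accessible_closed_set1/hausdorff_accessible/norm_hausdorff.
have := open_preimage_on (@openT V) (@Ck_coord R 3 1 0 setT 0 0) oN.
by rewrite setTI.
Qed.

Lemma U0_scal eps v : U0 v -> U0 (scal eps *m v).
Proof. by rewrite /U0 /= scal0. Qed.

(** The factors [eps] are kept nested and outermost, one for each application of [unifO_eps]. *)
Lemma derive_scal eps G v w : (forall k, Ck k U0 G) -> U0 w ->
  'D_v (fun y => G (scal eps *m y)) w = v 0 0 * 'D_b0 G (scal eps *m w) +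
   (eps * (eps * (v i1 0 * 'D_b1 G (scal eps *m w))) +
    eps * (v i2 0 * 'D_b2 G (scal eps *m w))).
Proof.
move=> sG Uw.
have E : (fun y => G (scal eps *m y)) = (fun y => G (mulmx (scal eps) y + 0)).
  by apply/funext => y; rewrite addr0.
rewrite E derive_affine addr0 /= (col3E (mulmx _ v)) scal0 scal1 scal2.
have Uw' := U0_scal eps Uw.
rewrite (derive_dirP _ _ _ open_U0 (sG 1%N) Uw') (derive_dirP _ _ _ open_U0 (sG 1%N) Uw').
have := derive_dirP b2 0 (eps * v i2 0) open_U0 (sG 1%N) Uw'.
rewrite addr0 derive0 addr0 => ->.
by move: ('D_b0 G _) ('D_b1 G _) ('D_b2 G _) => p q r; ring.
Qed.

Lemma family_smooth_scal G : (forall k, Ck k U0 G) ->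
  family_smooth U0 (fun eps y => G (scal eps *m y)).
Proof.
move=> sG eps k _ _.
have := Ck_affine 0 (@mulmx_continuous R 3 3 1 (scal eps)) (sG k).
rewrite (_ : [set y | _] = U0); last first.
  by apply/seteqP; split=> y; rewrite /U0 /= addr0 scal0.
by apply: Ck_ext; [exact: open_U0|move=> y _; rewrite addr0].
Qed.

(** Only transverse derivatives are recorded; derivatives along the axis follow by
    [flat_along_axis], so the condition survives all three terms of [derive_scal]. *)
Fixpoint flat_along N G : Prop :=
  if N is N'.+1 then
    [/\ forall v, U0 v -> v i1 0 = 0 -> v i2 0 = 0 -> G v = 0,
      flat_along N' ('D_b1 G) & flat_along N' ('D_b2 G)]
  else True.

Lemma flat_along_ext N G G' : (forall v, U0 v -> G v = G' v) ->
  flat_along N G -> flat_along N G'.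
Proof.
elim: N G G' => //= N IH G G' GG [z d1 d2].
have DE b v : U0 v -> 'D_b G v = 'D_b G' v.
  move=> Uv; apply: near_eq_derive.
  by apply: filterS (open_nbhs_nbhs (conj open_U0 Uv)) => y; exact: GG.
by split; [move=> v Uv h1 h2; rewrite -GG // z|apply: IH d1; exact: DE|apply: IH d2; exact: DE].
Qed.

(** Moving along [b0] stays on the axis, where the function is 0, and ['D_b0] commutes with the
    transverse derivatives. *)
Lemma flat_along_axis N G : (forall k, Ck k U0 G) -> flat_along N G ->
  flat_along N ('D_b0 G).
Proof.
elim: N G => // N IH G sG [z d1 d2]; split.
- move=> v Uv v1 v2; apply: cvg_lim => //=.
  apply: (@cvg_trans _ ((fun=> 0 : R) @ 0^')); last exact: cvg_cst.
  apply: near_eq_cvg; near=> h.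
  rewrite (z v) // z ?subr0 ?scaler0 // ?mxE ?v1 ?v2 /= ?mulr0 ?addr0 //.
  rewrite /U0 /= !mxE /= mulr1; apply/eqP => /eqP; rewrite addr_eq0 => /eqP E.
  have : `|h| < `|v 0 0| by near: h; apply: dnbhs0_lt; rewrite normr_gt0.
  by rewrite E normrN ltxx.
- have := IH _ (fun k => Ck_derive b1 (sG k.+1)) d1.
  by apply: flat_along_ext => v Uv; exact: derive_comm open_U0 (sG 2%N) Uv.
- have := IH _ (fun k => Ck_derive b2 (sG k.+1)) d2.
  by apply: flat_along_ext => v Uv; exact: derive_comm open_U0 (sG 2%N) Uv.
Unshelve. all: by end_near. Qed.

(** Half of the modulus of [x] keeps the first coordinate away from 0. The box is symmetric in the
    transverse coordinates, hence mapped into itself by [scal eps] for eps in [0, 1]. *)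
Definition slab (x c : R) : set V :=
  [set v | [/\ `|v 0 0 - x| <= `|x| / 2, `|v i1 0| <= c & `|v i2 0| <= c]].

Lemma compact_slab x c : compact (slab x c).
Proof.
pose A (r : 'I_3) : set R := if r == 0 then [set` `[x - `|x| / 2, x + `|x| / 2]]
  else [set` `[- c, c]].
have cA r : compact (A r) by rewrite /A; case: ifP => _; exact: segment_compact.
have -> : slab x c = (fun v : 'rV[R]_3 => v^T) @` [set v : 'rV[R]_3 | forall r, A r (v ord0 r)].
  apply/seteqP; split=> [v [h0 h1 h2]|_ [w Aw <-]].
    exists v^T; last by rewrite trmxK.
    move=> r; rewrite mxE /A.
    case: eqP => [->|r0]; rewrite /= in_itv /=; first by rewrite -ler_distl.
    rewrite -ler_norml; case: r r0 => -[|[|[|//]]] Hr // r0.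
    - by exfalso; apply: r0; apply/val_inj.
    - by have -> : Ordinal Hr = i1 by apply/val_inj.
    - by have -> : Ordinal Hr = i2 by apply/val_inj.
  split; rewrite mxE; [have := Aw 0|have := Aw i1|have := Aw i2];
    rewrite /A /= in_itv /= -?ler_distl -?ler_norml //.
apply: continuous_compact; last exact: rV_compact.
apply: continuous_subspaceT => v; apply: mx_continuous => i j.
have -> : (fun y : 'rV[R]_3 => y^T i j) = (fun y => y j i).
  by apply/funext => y; rewrite mxE.
exact: (@coord_continuous R 1 3 j i v).
Qed.

Lemma slab_U0 x c v : x != 0 -> slab x c v -> U0 v.
Proof.
move=> x0 [h _ _]; rewrite /U0 /=; apply: contraTneq h => ->.
rewrite sub0r normrN -ltNge ltr_pdivrMr // ltr_pMr ?normr_gt0 //.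
by rewrite ltr1n.
Qed.

(** Taylor's estimate by induction on [N]: along the transverse segment from the axis to
    [scal eps *m v] the mean value theorem extracts one factor [eps] and leaves a transverse
    derivative flat to order [N]. The base case is a maximum on a compact set. *)
Lemma slab_bound x c G N : x != 0 -> 0 <= c -> (forall k, Ck k U0 G) -> flat_along N G ->
  exists C : R, forall v (eps : R), slab x c v -> 0 <= eps -> eps <= 1 ->
    `|G (scal eps *m v)| <= C * eps ^+ N.
Proof.
move=> x0 c0; elim: N G => [|N IH] G sG.
  move=> _; have [||v vB vmax] := @compact_EVT_max V R (fun v => `|G v|) (slab x c) _ (@compact_slab x c).
  - exists (x *: b0); split; rewrite !mxE /= ?mulr1 ?subrr ?mulr0 normr0 //.
  - apply: continuous_in_subspaceT => v /[!inE] /(slab_U0 x0) Uv.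
    have cG : {for v, continuous G} := Ck_continuous (sG 0%N) Uv.
    apply: (@continuous_comp _ _ _ G (fun z : R => `|z|)) => //.
    exact: (@norm_continuous R R (G v)).
  exists `|G v| => w eps Bw e0 e1; rewrite expr0 mulr1; apply: vmax; rewrite inE.
  case: Bw => h0 h1 h2; split; rewrite ?scal0 ?scal1 ?scal2 // normrM ger0_norm ?exprn_ge0 //.
    by apply: le_trans h1; rewrite ler_piMl // exprn_ile1.
  by apply: le_trans h2; rewrite ler_piMl.
move=> [z d1 d2].
have [C1 H1] := IH _ (fun k => Ck_derive b1 (sG k.+1)) d1.
have [C2 H2] := IH _ (fun k => Ck_derive b2 (sG k.+1)) d2.
exists (c * (C1 + C2)) => v eps Bv e0 e1.
pose b : V := v 0 0 *: b0.
pose d : V := (eps ^+ 2 * v i1 0) *: b1 + (eps * v i2 0) *: b2.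
(* A point of the segment is itself a dilate of a point of the slab, namely of [v] with its
   transverse coordinates multiplied by [t], so the induction hypothesis applies to it. *)
have dbE (t : R) : `|t| <= 1 -> exists2 v', slab x c v' & t *: d + b = scal eps *m v'.
  move=> t1; exists (v 0 0 *: b0 + ((t * v i1 0) *: b1 + (t * v i2 0) *: b2)).
    case: Bv => h0 h1 h2; split; rewrite !mxE /= !(mulr0, mulr1, addr0, add0r) //.
      by rewrite normrM (le_trans _ h1) // ler_piMl.
    by rewrite normrM (le_trans _ h2) // ler_piMl.
  apply: col3_eq; rewrite ?scal0 ?scal1 ?scal2 !mxE /= !(mulr0, mulr1, addr0, add0r) //; ring.
have Udb t : `|t| <= 1 -> U0 (t *: d + b).
  by move=> /dbE[v' Bv' ->]; apply: U0_scal; exact: slab_U0 Bv'.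
have [t tle|t] := @line_MVT _ _ G b d 1.
  by apply: Ck_derivable (sG 1%N) _; apply: Udb; rewrite normr1 in tle.
rewrite normr1 => t1; have [v' Bv' E] := dbE t t1.
have -> : 1 *: d + b = scal eps *m v.
  apply: col3_eq; rewrite ?scal0 ?scal1 ?scal2 !mxE /= !(mulr0, mulr1, mul1r, addr0, add0r) //.
have Gb0 : G b = 0.
  apply: z; rewrite /b ?mxE /= ?mulr0 // /U0 /= !mxE /= mulr1.
  exact: slab_U0 Bv.
rewrite Gb0 subr0 mul1r => ->; rewrite (derive_dirP _ _ _ open_U0 (sG 1%N) (Udb _ t1)).
have := derive_dirP b2 0 (eps * v i2 0) open_U0 (sG 1%N) (Udb _ t1).
rewrite addr0 derive0 addr0 E => ->.
have [_ v1 v2] := Bv.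
have {}H1 := H1 v' eps Bv' e0 e1; have {}H2 := H2 v' eps Bv' e0 e1.
have p0 : 0 <= eps ^+ N by rewrite exprn_ge0.
have C10 : 0 <= C1 * eps ^+ N by apply: le_trans H1.
have C20 : 0 <= C2 * eps ^+ N by apply: le_trans H2.
apply: le_trans (ler_normD _ _) _; rewrite !normrM exprS mulrDr mulrDl.
rewrite (ger0_norm e0); apply: lerD.
  have -> : c * C1 * (eps * eps ^+ N) = eps * c * (C1 * eps ^+ N) by ring.
  have ee : 0 <= eps * eps by rewrite mulr_ge0.
  apply: ler_pM => //; first by rewrite mulr_ge0.
  by apply: ler_pM => //; rewrite ler_piMl.
have -> : c * C2 * (eps * eps ^+ N) = eps * c * (C2 * eps ^+ N) by ring.
by apply: ler_pM => //; [rewrite mulr_ge0|apply: ler_pM].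
Qed.

(** Differentiating along the axis preserves the order of flatness. A transverse derivative loses
    one order but carries [eps] or its square, so the exponent [N] survives every derivative. *)
Lemma unifO_scal k N G : (forall j, Ck j U0 G) -> flat_along N G ->
  unifO k N U0 (fun eps v => G (scal eps *m v)).
Proof.
have base N' G' : (forall j, Ck j U0 G') -> flat_along N' G' -> forall x, U0 x ->
    exists C : R, \forall y \near x, forall eps : R, 0 < eps -> eps <= 1 ->
      `|G' (scal eps *m y)| <= C * eps ^+ N'.
  move=> sG fG x Ux; pose c := `|x i1 0| + `|x i2 0| + 1.
  have c0 : 0 <= c by rewrite !addr_ge0.
  have [C H] := slab_bound Ux c0 sG fG; exists C.
  have nz0 : \forall y \near x, `|(y : V) 0 0 - x 0 0| < `|x 0 0| / 2.
    have x2 : 0 < `|x 0 0| / 2 by rewrite divr_gt0 // normr_gt0.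
    have := @cvgr_dist_lt _ _ _ (nbhs x) _ (fun y : V => y 0 0) (x 0 0)
      (@coord_continuous R 3 1 0 0 x) _ x2.
    by move=> h; apply: filterS (h _) => y; rewrite distrC.
  have nc r : `|x r 0| < c -> \forall y \near x, `|(y : V) r 0| < c.
    move=> xc; have cv := cvg_norm (@coord_continuous R 3 1 r 0 x).
    exact: (cvgr_lt _ (cv _) _ xc).
  have n1 := nc i1 _; have n2 := nc i2 _.
  apply: filterS3 nz0 (n1 _) (n2 _) => [y h0 h1 h2 eps e0 e1||].
  - by apply: H; rewrite ?(ltW e0) //; split; apply: ltW.
  - by rewrite /c -addrA ltrDl ltr_wpDl.
  - by rewrite /c addrAC ltrDr ltr_wpDl.
elim: k N G => [|k IH] N G sG fG; first by split=> //; exact: base.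
split; first exact: base.
move=> v; have sD b j := Ck_derive b (sG j.+1).
have fs b := family_smooth_scal (sD b).
have fsc b a : family_smooth U0 (fun eps y => a * 'D_b G (scal eps *m y)).
  by move=> eps j e0 e1; apply: Ck_scale; [exact: open_U0|exact: fs].
have Bc b a N' : unifO k N' U0 (fun eps y => 'D_b G (scal eps *m y)) ->
    unifO k N' U0 (fun eps y => a * 'D_b G (scal eps *m y)).
  move=> B; apply: (unifO_mul (F := fun=> a)) B;
      [exact: open_U0|move=> j; exact: Ck_cst|exact: fs].
have smul h : family_smooth U0 h -> family_smooth U0 (fun eps (y : V) => eps * h eps y).
  by move=> sh eps j e0 e1; apply: Ck_scale; [exact: open_U0|exact: sh].
have oU := open_U0.
have fD0 := flat_along_axis sG fG.
have [fD1 fD2] : flat_along N.-1 ('D_b1 G) /\ flat_along N.-1 ('D_b2 G).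
  by case: (N) fG => [|N'] // [].
have B0 := Bc b0 (v 0 0) N (IH _ _ (sD b0) fD0).
have B1 := unifO_eps_pred oU (fsc b1 (v i1 0)) (Bc b1 (v i1 0) _ (IH _ _ (sD b1) fD1)).
have B2 := unifO_eps_pred oU (fsc b2 (v i2 0)) (Bc b2 (v i2 0) _ (IH _ _ (sD b2) fD2)).
have {}B1 : unifO k N U0 (fun eps y => eps * (eps * (v i1 0 * 'D_b1 G (scal eps *m y)))).
  by apply: unifO_le; apply: unifO_eps => //; exact: smul (fsc b1 (v i1 0)).
have B12 := unifO_add oU (smul _ (smul _ (fsc b1 (v i1 0)))) (smul _ (fsc b2 (v i2 0))) B1 B2.
have s12 : family_smooth U0 (fun eps y => eps * (eps * (v i1 0 * 'D_b1 G (scal eps *m y))) +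
    eps * (v i2 0 * 'D_b2 G (scal eps *m y))).
  move=> eps j e0 e1; apply: Ck_add => //.
    exact: (smul _ (smul _ (fsc b1 (v i1 0))) eps j e0 e1).
  exact: (smul _ (fsc b2 (v i2 0)) eps j e0 e1).
apply: unifO_ext (unifO_add oU (fsc b0 (v 0 0)) s12 B0 B12) => // eps y e0 e1 Uy.
by rewrite (derive_scal eps v sG Uy).
Qed.

End Scaling.

(** * Covariant local functionals *)

Section Localization.
Variable R : realType.
Local Notation V := 'cV[R]_3.
Implicit Types (v : V) (Phi Psi : V -> R[i]) (al : bool) (lam : R[i]).
Let onz : open (@nz R 2) := @open_nz R 2.

Lemma U0_nz v : U0 v -> v != 0.
Proof. by apply: contraNneq => ->; rewrite mxE. Qed.

Lemma smooth_on_U0 Phi : smooth_on (@nz R 2) Phi -> smooth_on (@U0 R) Phi.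
Proof. by apply: smooth_onW => v; exact: U0_nz. Qed.

Lemma zero_near_hyperplane v : v != 0 -> ~ U0 v ->
  exists2 W : set V, open W /\ W v & forall w, W w -> chi w = 0.
Proof.
move=> v0 /negP/negPn/eqP vz; exists (interior [set w : V | chi w = 0]).
  split; first exact: open_interior.
  exact: near_chi0 v0 vz.
by move=> w /interior_subset.
Qed.

(** Near the hyperplane [v 0 0 = 0] the cutoff is identically 0, so the product extends smoothly
    whatever [Psi] does there. *)
Lemma homog_chi al lam Psi : smooth_on (@U0 R) Psi ->
  (forall c v, c != 0 -> U0 v -> Psi (c *: v) = kap al lam c * Psi v) ->
  homog al lam (fun v => (chi v)%:C * Psi v).
Proof.
move=> sP hP; split.
  apply: smooth_on_loc => v v0; have [Uv|nUv] := pselect (U0 v).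
    exists (@U0 R) => //; apply: smooth_on_mul => //; first exact: open_U0.
    apply: smooth_on_real => k; apply: CkW (@Ck_chi R 2 k) => w; exact: U0_nz.
  have [W [oW Wv] W0] := zero_near_hyperplane v0 nUv; exists W => //.
  apply: smooth_on_ext (smooth_on_cst W 0) => // w /W0 ->; by rewrite mul0r.
move=> c v c0 v0; rewrite chiZ // mulrCA; have [Uv|nUv] := pselect (U0 v).
  by rewrite hP.
have [W [oW Wv] W0] := zero_near_hyperplane v0 nUv.
by rewrite (W0 _ Wv) !mul0r.
Qed.

Lemma homog_comp_SL al lam Phi (g : SL R 3) : homog al lam Phi ->
  homog al lam (fun v => Phi (val g *m v)).
Proof.
move=> [sP hP]; split; last first.
  by move=> c v c0 v0; rewrite -scalemxAr hP // SL_mulmx_neq0.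
have := smooth_on_affine 0 (@mulmx_continuous R 3 3 1 (val g)) sP.
move=> H; have {}H : smooth_on (@nz R 2) (fun y => Phi (mulmx (val g) y + 0)).
  by apply: smooth_onW H => v v0; rewrite /nz /= addr0 SL_mulmx_neq0.
by apply: smooth_on_ext H => // v _; rewrite addr0.
Qed.

Lemma smooth_on_scal eps Phi : smooth_on (@nz R 2) Phi ->
  smooth_on (@U0 R) (fun v => Phi (scal eps *m v)).
Proof.
move=> sP; have := smooth_on_affine 0 (@mulmx_continuous R 3 3 1 (scal eps)) (smooth_on_U0 sP).
move=> H; have {}H : smooth_on (@U0 R) (fun y => Phi (mulmx (scal eps) y + 0)).
  by apply: smooth_onW H => v v0; rewrite /= addr0; exact: U0_scal.
by apply: smooth_on_ext H => [|v _]; [exact: open_U0|rewrite addr0].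
Qed.

Lemma homog_scal al lam Phi eps : homog al lam Phi ->
  homog al lam (fun v => (chi v)%:C * Phi (scal eps *m v)).
Proof.
move=> [sP hP]; apply: homog_chi; first exact: smooth_on_scal.
by move=> c v c0 Uv; rewrite -scalemxAr hP // U0_nz //; exact: U0_scal.
Qed.

Lemma unifO_chi k N (G : V -> R) : (forall j, Ck j (@nz R 2) G) -> flat_along N G ->
  unifO k N (@nz R 2) (fun eps v => chi v * G (scal eps *m v)).
Proof.
move=> sG fG; have sG0 j : Ck j (@U0 R) G.
  by apply: CkW (sG j) => w; exact: U0_nz.
apply: unifO_loc => v v0; have [Uv|nUv] := pselect (U0 v).
  exists (@U0 R) => //; apply: (unifO_mul (F := @chi R 2)) (unifO_scal k sG0 fG).
  - exact: open_U0.
  - by move=> j; apply: CkW (@Ck_chi R 2 j) => w; exact: U0_nz.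
  - exact: family_smooth_scal.
have [W [oW Wv] W0] := zero_near_hyperplane v0 nUv; exists W => //.
apply: unifO_ext (unifO0 k N W) => // eps w _ _ Ww; by rewrite (W0 _ Ww) mul0r.
Qed.

Definition derivs (s : seq V) : (V -> R[i]) -> V -> R[i] := foldr (fun w => derivC w) ^~ s.

Lemma Re_derivs s Psi v : complex.Re (derivs s Psi v) =
  foldr (fun w F => 'D_w F) (fun v => complex.Re (Psi v)) s v.
Proof.
elim: s v => //= w s IH v; congr ('D_w _ v).
by apply/funext => u; exact: IH.
Qed.

Lemma Im_derivs s Psi v : complex.Im (derivs s Psi v) =
  foldr (fun w F => 'D_w F) (fun v => complex.Im (Psi v)) s v.
Proof.
elim: s v => //= w s IH v; congr ('D_w _ v).
by apply/funext => u; exact: IH.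
Qed.

Lemma smooth_derivs U s Psi : smooth_on U Psi -> smooth_on U (derivs s Psi).
Proof. by move=> sP; elim: s => //= w s IH; exact: smooth_on_derivC. Qed.

Lemma derivs_scale s (c : R[i]) Psi v : smooth_on (@nz R 2) Psi -> v != 0 ->
  derivs s (fun v => c * Psi v) v = c * derivs s Psi v.
Proof.
move=> sP; elim: s v => //= w s IH v v0.
rewrite (derivC_ext w onz IH v0).
exact: derivC_scale (smooth_derivs s sP) v0.
Qed.

Fixpoint flat_axis N Phi : Prop :=
  if N is N'.+1 then
    [/\ forall v, U0 v -> v i1 0 = 0 -> v i2 0 = 0 -> Phi v = 0,
      flat_axis N' (derivC (b1 R) Phi) & flat_axis N' (derivC (b2 R) Phi)]
  else True.

Lemma flat_axis_ReIm N Phi : flat_axis N Phi ->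
  flat_along N (fun v => complex.Re (Phi v)) /\ flat_along N (fun v => complex.Im (Phi v)).
Proof.
elim: N Phi => [|N IH] Phi; first by [].
move=> [z /IH[r1 i1'] /IH[r2 i2']]; split; split => //.
  by move=> v Uv v1 v2; rewrite z.
by move=> v Uv v1 v2; rewrite z.
Qed.

(** Homogeneity carries a vanishing value at [b0] to the whole axis. Derivatives of [Phi] are
    homogeneous for other parameters, so [al] and [lam] vary in the induction. *)
Lemma flat_axis_jets al lam Phi N : homog al lam Phi ->
  (forall i j, (i + j < N)%N ->
    iter i (derivC (b1 R)) (iter j (derivC (b2 R)) Phi) (b0 R) = 0) ->
  flat_axis N Phi.
Proof.
elim: N al lam Phi => // N IH al lam Phi hP H; have sP := hP.1; split.
- move=> v Uv v1 v2; rewrite [v]col3E v1 v2 !scale0r !addr0.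
  have H0 : Phi (b0 R) = 0 := H 0%N 0%N isT.
  by rewrite (hP.2 _ _ Uv (@e0_neq0 R 2)) H0 mulr0.
- apply: (IH _ _ _ (homog_derivC (b1 R) hP)) => i j ij.
  rewrite -(H i.+1 j) ?addSn // iterSr.
  apply: (iter_derivC_ext _ _ onz); last exact: (@e0_neq0 R 2).
  by move=> v v0; exact: iter_derivC_comm1 onz sP v0.
- apply: (IH _ _ _ (homog_derivC (b2 R) hP)) => i j ij.
  by rewrite -(H i j.+1) ?addnS // iterSr.
Qed.

End Localization.

Section Functionals.
Variables (R : realType) (al be : bool) (lam nu : R[i]).
Local Notation V := 'cV[R]_3.
Local Notation I3 := (Ind 2 al lam).
Implicit Types (Phi : V -> R[i]) (f : I3).

Definition represents Phi f := forall g, f g = Phi (fcol g).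

(* The properties of the functional f |-> (D f)(1) attached to a differential
   intertwining operator D. *)
Definition covariant_local (L : I3 -> R[i]) : Prop :=
  [/\ forall c f1 f2, L (c *: f1 + f2) = c * L f1 + L f2,
      forall f Phi, represents Phi f -> (\forall v \near (b0 R), Phi v = 0) -> L f = 0,
      forall (F : set_system R) (h : R -> I3), Filter F -> h @ F --> (0 : I3) ->
        forall e : R, 0 < e -> \forall x \near F,
          `|complex.Re (L (h x))| < e /\ `|complex.Im (L (h x))| < e &
      forall (p : SL R 2) c f f', c != 0 -> fcol p = c *: e0 R 1 ->
        (forall g, f' g = f (iotaG p * g)%g) -> L f' = kap be nu c * L f].

Variable L : I3 -> R[i].
Hypothesis LP : covariant_local L.

Lemma functional0 : L 0 = 0.
Proof.
have [lin _ _ _] := LP; have := lin (-1) 0 0.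
by rewrite scaler0 addr0 mulN1r addNr.
Qed.

Lemma functionalZ c f : L (c *: f) = c * L f.
Proof. by have [lin _ _ _] := LP; have := lin c f 0; rewrite !addr0 functional0 addr0. Qed.

Lemma functionalD f1 f2 : L (f1 + f2) = L f1 + L f2.
Proof. by have [lin _ _ _] := LP; have := lin 1 f1 f2; rewrite scale1r mul1r. Qed.

Lemma functional_local f1 f2 Phi1 Phi2 : represents Phi1 f1 -> represents Phi2 f2 ->
  (\forall v \near (b0 R), Phi1 v = Phi2 v) -> L f1 = L f2.
Proof.
have [lin loc _ _] := LP => r1 r2 E.
have : L ((-1) *: f2 + f1) = 0.
  apply: (loc _ (fun v => -1 * Phi2 v + Phi1 v)).
    by move=> g; rewrite -r1 -r2.
  by apply: filterS E => v ->; rewrite mulN1r addNr.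
by rewrite lin mulN1r => /eqP; rewrite addrC subr_eq0 => /eqP.
Qed.

Lemma iotaG_mulmx (p : SL R 2) (v : V) : fcol p = val p 0 0 *: e0 R 1 ->
  val (iotaG p) *m v = (val p 0 0 * v 0 0 + val p 0 1 * v i1 0) *: b0 R +
    ((val p 1 1 * v i1 0) *: b1 R + v i2 0 *: b2 R).
Proof.
move=> pc; have C0 : val (iotaG p) *m b0 R = val p 0 0 *: b0 R.
  by rewrite /b0 -fcolE fcol_iotaG pc -scalemxAr embG_e0.
have C1 : val (iotaG p) *m b1 R = val p 0 1 *: b0 R + val p 1 1 *: b1 R.
  rewrite /b1 -colE col_iotaG.
  have -> : col 1 (val p) = val p 0 1 *: delta_mx 0 0 + val p 1 1 *: delta_mx 1 0.
    apply/colP => -[[|[|//]] Hi]; rewrite !mxE /= ?mulr1 ?mulr0 ?addr0 ?add0r;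
      by congr (val p _ _); apply/val_inj.
  have E0 : delta_mx (@lshift 2 1 0) 0 = b0 R.
    by rewrite /b0; congr delta_mx; apply/val_inj.
  by rewrite mulmxDr -!scalemxAr !embG_delta E0.
have C2 : val (iotaG p) *m b2 R = b2 R.
  have E2 : b2 R = delta_mx (@rshift 1 2 1) 0.
    by rewrite /b2; congr delta_mx; apply/val_inj.
  by rewrite -[RHS](iotaG_dir1 p) -mulmxA embJ_delta E2.
rewrite {1}[v]col3E !mulmxDr -!scalemxAr C0 C1 C2 scalerDr !scalerA.
by rewrite addrA addrA -scalerDl -addrA ![_ * v _ _]mulrC.
Qed.

Lemma exists_triangular (c u : R) : c != 0 -> exists2 p : SL R 2, fcol p = c *: e0 R 1 &
  [/\ val p 0 0 = c, val p 0 1 = u & val p 1 1 = c^-1].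
Proof.
move=> c0; pose A : 'M[R]_2 := \matrix_(i, j)
  if i == 0 then (if j == 0 then c else u) else (if j == 0 then 0 else c^-1).
have dA : \det A == 1.
  rewrite -det_tr det_trig; last first.
    apply/is_trig_mxP => i j ij; rewrite !mxE.
    by case: i ij => -[|[|//]] ?; case: j => -[|[|//]] ?.
  by rewrite !big_ord_recl big_ord0 !mxE /= mulr1 divff.
exists (Sub A dA); last by split; rewrite /= mxE.
by apply/colP => -[[|[|//]] Hi]; rewrite !mxE /= ?mulr1 ?mulr0.
Qed.

(** Covariance under P' combined with locality: the relation between the two homogeneous functions
    is required only near [b0]. *)
Lemma functional_triangular (c u : R) f f' Phi Phi' : c != 0 -> represents Phi f ->
  represents Phi' f' ->
  (\forall v \near (b0 R), Phi' v = Phi ((c * v 0 0 + u * v i1 0) *: b0 R +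
    ((c^-1 * v i1 0) *: b1 R + v i2 0 *: b2 R))) ->
  L f' = kap be nu c * L f.
Proof.
move=> c0 rf rf' E; have [p pc [p00 p01 p11]] := exists_triangular u c0.
have [_ _ _ equi] := LP.
rewrite -(equi p c f (act (iotaG p)^-1%g f) c0 pc); last first.
  by move=> g; rewrite -[LHS]/(f ((iotaG p)^-1^-1 * g)%g) invgK.
apply: functional_local rf' _ _.
  move=> g; rewrite -[LHS]/(f ((iotaG p)^-1^-1 * g)%g) invgK rf fcolM.
  exact: (erefl ((fun v => Phi (val (iotaG p) *m v)) (fcol g))).
apply: filterS E => v ->; rewrite iotaG_mulmx ?p00 ?p01 ?p11 //.
Qed.

(** The element of A' is the case [c = eps^-1], [u = 0] of [functional_triangular]. Homogeneity
    converts it into [scal eps] at the cost of [kap al lam eps^-1], and the cutoff is 1 near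
    [b0]. *)
Lemma functional_scal eps f f' Phi (hP : homog al lam Phi) : eps != 0 ->
  represents Phi f -> represents (fun v => (chi v)%:C * Phi (scal eps *m v)) f' ->
  kap al lam eps^-1 * L f' = kap be nu eps^-1 * L f.
Proof.
move=> e0 rf rf'; rewrite -functionalZ; have e0' : eps^-1 != 0 by rewrite invr_eq0.
apply: (functional_triangular (u := 0) (Phi := Phi)
  (Phi' := fun v => kap al lam eps^-1 * ((chi v)%:C * Phi (scal eps *m v)))) => //.
  by move=> g; rewrite -rf'.
have nU : \forall v \near (b0 R), U0 v.
  apply: open_nbhs_nbhs; split; first exact: open_U0.
  by rewrite /U0 /= mxE oner_eq0.
apply: filterS2 nU (@near_chi1 R 2) => v Uv ->; rewrite mul1r mul0r addr0 invrK.
rewrite -hP.2 ?U0_nz //; last exact: U0_scal.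
have sE r : (eps^-1 *: (scal eps *m v)) r 0 = eps^-1 * (scal eps *m v) r 0.
  by rewrite mxE.
congr Phi; apply: col3_eq; rewrite sE ?scal0 ?scal1 ?scal2 !mxE /= !(mulr1, mulr0, addr0, add0r) //.
- by rewrite expr2 mulrA mulKf.
- by rewrite mulKf.
Qed.

End Functionals.

(** * Finite order: the functional kills sufficiently flat sections *)

Section FlatKernel.
Variables (R : realType) (al be : bool) (lam nu : R[i]).
Local Notation V := 'cV[R]_3.
Local Notation I3 := (Ind 2 al lam).
Variable L : I3 -> R[i].
Hypothesis LP : covariant_local be nu L.

Lemma cexp_ln_bound (mu : R[i]) (eps : R) :
  `|complex.Re (cexp (mu * (ln eps)%:C))| <= expR (complex.Re mu * ln eps) /\
  `|complex.Im (cexp (mu * (ln eps)%:C))| <= expR (complex.Re mu * ln eps).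
Proof.
rewrite Re_cexp_line Im_cexp_line !normrM !(gtr0_norm (expR_gt0 _)).
by split; rewrite ler_piMr ?expR_ge0 // ?cos_max ?sin_max.
Qed.

(** The margin of 1 in the hypothesis leaves a full factor [eps] after the growth of the scalar is
    absorbed. *)
Lemma power_bound (a eps : R) N : 0 < eps -> eps <= 1 -> a + 1 <= N%:R ->
  eps ^+ N * expR (- a * ln eps) <= eps.
Proof.
move=> e0 e1 aN; rewrite -{1 3}[eps]lnK ?posrE // -expRM_natl -expRD ler_expR.
have l0 : ln eps <= 0 by rewrite ln_le0.
have -> : N%:R * ln eps + - a * ln eps = (N%:R - a) * ln eps by ring.
rewrite -[leRHS]mul1r ler_wnM2r //; lra.
Qed.

Lemma flat_kernel (Phi : V -> R[i]) (f : I3) N : homog al lam Phi -> represents Phi f ->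
  flat_axis N Phi -> complex.Re (nu - lam) + 1 <= N%:R -> L f = 0.
Proof.
move=> hP rf fP aN; pose a := complex.Re (nu - lam); have sP := hP.1.
(* The ratio of the two characters at [eps^-1]: with this scalar, [L (h eps)] does not depend on
   [eps]. *)
pose ka (eps : R) : R[i] := cexp (- (nu - lam) * (ln eps)%:C).
pose Psi (eps : R) (v : V) := (chi v)%:C * Phi (scal eps *m v).
pose h eps : I3 := ka eps *: Ind_of (homog_scal eps hP).
have Lh eps : 0 < eps -> L (h eps) = L f.
  move=> e0; rewrite (functionalZ LP).
  have rf' : represents (Psi eps) (Ind_of (homog_scal eps hP)) by [].
  have en : eps != 0 by rewrite gt_eqF.
  have := functional_scal LP hP en rf rf'.
  have ei : 0 < eps^-1 by rewrite invr_gt0.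
  rewrite !kap_gt0 // lnV ?posrE // => E.
  apply: (mulfI (cexp_neq0 (- nu * (- ln eps)%:C))); rewrite -E mulrA -cexpD.
  congr (cexp _ * _); rewrite rmorphN; ring.
have h0 : h @ 0^'+ --> (0 : I3).
  apply: cvg_Ind => K s g e cK e0.
  pose dirs : seq V := [seq val g *m @embJ R 2 *m delta_mx j 0 | j <- s].
  pose vx (x : 'cV[R]_2) : V := val g *m @embJ R 2 *m x + fcol g.
  have vx0 x : vx x != 0 by exact: chart_neq0.
  have jetE eps x : pd s (chart g (h eps)) x = ka eps * derivs dirs (Psi eps) (vx x).
    rewrite (@pd_chart _ _ _ _ (h eps) (fun v => ka eps * Psi eps v) g s) //=.
    have -> F : foldr (fun j => derivC (val g *m @embJ R 2 *m delta_mx j 0)) F s =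
        derivs dirs F by rewrite /derivs /dirs foldr_map.
    exact: (derivs_scale dirs (ka eps) (homog_scal eps hP).1 (vx0 x)).
  have jet0 x : pd s (chart g (0 : I3)) x = 0.
    have -> : chart g (0 : I3) = (fun=> 0) by [].
    elim: (s) x => //= j s' IH x; rewrite -[RHS](derivC_cst 0 x (delta_mx j 0)).
    by congr derivC; apply/funext => y; exact: IH.
  have [fR fI] := flat_axis_ReIm fP.
  have bound (G : V -> R) : (forall j, Ck j (@nz R 2) G) -> flat_along N G ->
      forall x : 'cV[R]_2, exists C : R, \forall x' \near x, forall eps : R, 0 < eps -> eps <= 1 ->
      `|foldr (fun w F => 'D_w F) (fun v => chi v * G (scal eps *m v)) dirs (vx x')|
        <= C * eps ^+ N.
    move=> sG fG x.
    have [H _] := unifO_foldr (unifO_chi (size dirs + 0) sG fG).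
    have [C HC] := H _ (vx0 x); exists C.
    have cv : {for x, continuous vx}.
      apply: (@continuousD R 'cV[R]_3 'cV[R]_2 (fun y => val g *m @embJ R 2 *m y)
        (fun=> fcol g) x).
        exact: (@mulmx_continuous R 3 2 1 (val g *m @embJ R 2) x).
      exact: cst_continuous.
    exact: cv HC.
  have sR j : Ck j (@nz R 2) (fun v => complex.Re (Phi v)) by have [] := sP j.
  have sI j : Ck j (@nz R 2) (fun v => complex.Im (Phi v)) by have [] := sP j.
  have RePsi eps x : complex.Re (derivs dirs (Psi eps) x) =
      foldr (fun w F => 'D_w F) (fun v => chi v * complex.Re (Phi (scal eps *m v))) dirs x.
    rewrite Re_derivs; congr (foldr _ _ _ _); apply/funext => v.
    by rewrite Re_mul /= mul0r subr0.
  have ImPsi eps x : complex.Im (derivs dirs (Psi eps) x) =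
      foldr (fun w F => 'D_w F) (fun v => chi v * complex.Im (Phi (scal eps *m v))) dirs x.
    rewrite Im_derivs; congr (foldr _ _ _ _); apply/funext => v.
    by rewrite Im_mul /= mul0r addr0.
  have near_pos : \forall eps \near (0 : R)^'+, 0 < eps by exact: nbhs_right_gt.
  have near_le1 : \forall eps \near (0 : R)^'+, eps <= 1.
    by apply: nbhs_right_le; exact: ltr01.
  have H : \forall eps \near 0^'+, K `<=` (fun x =>
      `|complex.Re (pd s (chart g (h eps)) x)| < e /\
      `|complex.Im (pd s (chart g (h eps)) x)| < e).
    (* The bounds hold near each [x] with constants depending on [x]; compactness of [K] gives one
       range of [eps] for all of [K]. *)
    apply: (compact_near_coveringP K).1 => // x Kx.
    have [C1 H1] := bound _ sR fR x; have [C2 H2] := bound _ sI fI x.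
    pose C := `|C1| + `|C2| + 1; have C0 : 0 < C by rewrite ltr_wpDl ?addr_ge0.
    have near_e : \forall eps \near (0 : R)^'+, eps < e / C.
      by apply: nbhs_right_lt; rewrite divr_gt0.
    exists ([set x' | (forall eps : R, 0 < eps -> eps <= 1 ->
        `|foldr (fun w F => 'D_w F) (fun v => chi v * complex.Re (Phi (scal eps *m v))) dirs (vx x')|
        <= C1 * eps ^+ N) /\ (forall eps : R, 0 < eps -> eps <= 1 ->
        `|foldr (fun w F => 'D_w F) (fun v => chi v * complex.Im (Phi (scal eps *m v))) dirs (vx x')|
        <= C2 * eps ^+ N)], [set eps | [/\ 0 < eps, eps <= 1 & eps < e / C]]) => /=.
      split; first by apply: filterS2 H1 H2.
      by apply: filterS3 near_pos near_le1 near_e.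
    move=> [x' eps] /= [[h1 h2] [p0 p1 pe]].
    have {}h1 := h1 eps p0 p1; have {}h2 := h2 eps p0 p1.
    rewrite jetE Re_mul Im_mul RePsi ImPsi.
    have [k1 k2] := cexp_ln_bound (- (nu - lam)) eps; rewrite -/(ka eps) in k1 k2.
    have Ea : complex.Re (- (nu - lam)) = - a by rewrite /a; case: (nu - lam).
    rewrite Ea in k1 k2.
    have pb := power_bound p0 p1 aN; rewrite -/a in pb.
    set W1 := foldr _ _ _ _ in h1 *; set W2 := foldr _ _ _ _ in h2 *.
    set E := expR _ in k1 k2 pb.
    have ep : 0 <= eps ^+ N by rewrite exprn_ge0 // ltW.
    have small (z1 z2 w1 w2 : R) : `|z1| <= E -> `|z2| <= E -> `|w1| <= C1 * eps ^+ N ->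
        `|w2| <= C2 * eps ^+ N -> `|z1| * `|w1| + `|z2| * `|w2| < e.
      move=> hz1 hz2 hw1 hw2.
      apply: (@le_lt_trans _ _ (E * (`|C1| * eps ^+ N) + E * (`|C2| * eps ^+ N))).
        apply: lerD; apply: ler_pM => //.
          by apply: le_trans hw1 _; rewrite ler_wpM2r // ler_norm.
        by apply: le_trans hw2 _; rewrite ler_wpM2r // ler_norm.
      have -> : E * (`|C1| * eps ^+ N) + E * (`|C2| * eps ^+ N) =
        (`|C1| + `|C2|) * (eps ^+ N * E) by ring.
      apply: (@le_lt_trans _ _ (C * eps)).
        have E0 : 0 <= eps ^+ N * E by rewrite mulr_ge0 // expR_ge0.
        have CC : `|C1| + `|C2| <= C by rewrite /C lerDl.
        exact: ler_pM (addr_ge0 (normr_ge0 _) (normr_ge0 _)) E0 CC pb.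
      by rewrite mulrC -ltr_pdivlMr.
    split.
      apply: (le_lt_trans (ler_normB _ _)); rewrite !normrM.
      exact: small k1 k2 h1 h2.
    rewrite Im_mul RePsi ImPsi -/W1 -/W2.
    apply: (le_lt_trans (ler_normD (complex.Re (ka eps) * W2) (complex.Im (ka eps) * W1))).
    rewrite !normrM addrC.
    exact: small k2 k1 h1 h2.
  apply: filterS H => eps H x Kx; have [r i] := H x Kx.
  by rewrite jet0 /= !sub0r !normrN.
have [_ _ cont _] := LP.
have FF : Filter (0 : R)^'+ by apply: filter_filter.
(* [L f] is the constant value of [L (h eps)], and [h eps] tends to 0, so it is smaller than any
   [e]. *)
have key e : 0 < e -> `|complex.Re (L f)| < e /\ `|complex.Im (L f)| < e.
  move=> e0; have near_pos : \forall eps \near (0 : R)^'+, 0 < eps by exact: nbhs_right_gt.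
  have H := cont 0^'+ h FF h0 e e0.
  have [eps [He /Lh <-]] := @filter_ex _ _ (at_right_proper_filter 0) _ (filterI H near_pos).
  exact: He.
apply: complex_eq => /=; apply/eqP/negPn/negP => n0.
  have [|+ _] := key `|complex.Re (L f)|; first by rewrite normr_gt0.
  by rewrite ltxx.
have [|_] := key `|complex.Im (L f)|; first by rewrite normr_gt0.
by rewrite ltxx.
Qed.

End FlatKernel.

(** * Jets of monomials *)

Section Monomials.
Variable R : realType.
Local Notation V := 'cV[R]_3.
Implicit Types (v w : V) (F G Phi : V -> R[i]) (al : bool) (lam mu : R[i]).
Let onz : open (@nz R 2) := @open_nz R 2.

Lemma near_iter_derivC (x : V) w k F G : (\forall v \near x, F v = G v) ->
  \forall v \near x, iter k (derivC w) F v = iter k (derivC w) G v.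
Proof.
move=> FG; elim: k => //= k IH.
by apply: filterS (near_join IH) => y; exact: near_derivC.
Qed.

Lemma iter_derivC_eq_near (x : V) w k F G : (\forall v \near x, F v = G v) ->
  iter k (derivC w) F x = iter k (derivC w) G x.
Proof. by move=> /near_iter_derivC FG; exact: nbhs_singleton (FG w k). Qed.

(** Leibniz's rule stops after two terms because a coordinate is linear. At [k = 0] the junk index
    [k.-1] is harmless, its factor being 0. *)
Lemma iter_derivC_coord U r (b : V) (a : R) k G (x : V) : open U -> smooth_on U G -> U x ->
  b r 0 = a ->
  iter k (derivC b) (fun v => (v r 0)%:C * G v) x =
  (x r 0)%:C * iter k (derivC b) G x + k%:R * a%:C * iter k.-1 (derivC b) G x.
Proof.
move=> oU sG + br; elim: k x => [|k IH] x Ux; first by rewrite !mul0r addr0.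
rewrite [LHS]/= (derivC_ext b oU IH Ux).
have sc : smooth_on U (fun v => (v r 0)%:C) by apply: smooth_on_real => j; exact: Ck_coord.
have s1 := smooth_on_iter b k sG; have s2 := smooth_on_iter b k.-1 sG.
rewrite (derivC_add b (smooth_on_mul oU sc s1) (smooth_on_scale _ oU s2) Ux).
rewrite (derivC_mul b sc s1 Ux) (derivC_scale _ _ s2 Ux) derivC_real.
have [_ ->] := is_derive_coord r 0 x b; rewrite br [k.+1.-1]/=.
have E : k%:R * derivC b (iter k.-1 (derivC b) G) x = k%:R * iter k (derivC b) G x.
  by case: k {IH s1 s2} => [|k]; rewrite ?mul0r.
rewrite -mulrA [a%:C * _]mulrC mulrA mulrAC -/(a%:C) -[_%:R * _ * _ in LHS]mulrA.
rewrite mulrCA E -natr1 /=; ring.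
Qed.

Definition jet p q F : R[i] := iter p (derivC (b1 R)) (iter q (derivC (b2 R)) F) (b0 R).

Lemma near_jet p q F G : (\forall v \near b0 R, F v = G v) -> jet p q F = jet p q G.
Proof.
move=> FG; apply: iter_derivC_eq_near.
exact: near_iter_derivC.
Qed.

Lemma b0_nz : @nz R 2 (b0 R). Proof. exact: (@e0_neq0 R 2). Qed.

Lemma jet_scale_add p q (c : R[i]) F G : smooth_on (@nz R 2) F -> smooth_on (@nz R 2) G ->
  jet p q (fun v => c * F v + G v) = c * jet p q F + jet p q G.
Proof.
move=> sF sG; rewrite /jet.
have E x : @nz R 2 x -> iter q (derivC (b2 R)) (fun v => c * F v + G v) x =
    c * iter q (derivC (b2 R)) F x + iter q (derivC (b2 R)) G x.
  move=> x0; rewrite (iter_derivC_add (b2 R) q onz (smooth_on_scale c onz sF) sG x0).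
  by rewrite (iter_derivC_scale c (b2 R) q onz sF x0).
rewrite (iter_derivC_ext (b1 R) p onz E b0_nz).
have s1 := smooth_on_iter (b2 R) q sF; have s2 := smooth_on_iter (b2 R) q sG.
rewrite (iter_derivC_add (b1 R) p onz (smooth_on_scale c onz s1) s2 b0_nz).
by rewrite (iter_derivC_scale c (b1 R) p onz s1 b0_nz).
Qed.

Definition mulc r F : V -> R[i] := fun v => (v r 0)%:C * F v.

Lemma smooth_mulc U r F : open U -> smooth_on U F -> smooth_on U (mulc r F).
Proof.
by move=> oU; apply: smooth_on_mul => //; apply: smooth_on_real => j; exact: Ck_coord.
Qed.

Lemma jet_mulc1 U p q F : open U -> U (b0 R) -> smooth_on U F ->
  jet p q (mulc i1 F) = p%:R * jet p.-1 q F.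
Proof.
move=> oU Ub sF; rewrite /jet.
have b2i1 : b2 R i1 0 = 0 by rewrite mxE.
have E x : U x -> iter q (derivC (b2 R)) (mulc i1 F) x =
    (x i1 0)%:C * iter q (derivC (b2 R)) F x.
  by move=> x0; rewrite (iter_derivC_coord q oU sF x0 b2i1) mulr0 mul0r addr0.
rewrite (iter_derivC_ext (b1 R) p oU E Ub).
have b1i1 : b1 R i1 0 = 1 by rewrite mxE.
rewrite (iter_derivC_coord p oU (smooth_on_iter (b2 R) q sF) Ub b1i1).
by rewrite mulr1 mxE mul0r add0r.
Qed.

Lemma jet_mulc2 U p q F : open U -> U (b0 R) -> smooth_on U F ->
  jet p q (mulc i2 F) = q%:R * jet p q.-1 F.
Proof.
move=> oU Ub sF; rewrite /jet.
have b2i2 : b2 R i2 0 = 1 by rewrite mxE.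
have b1i2 : b1 R i2 0 = 0 by rewrite mxE.
have E x : U x -> iter q (derivC (b2 R)) (mulc i2 F) x =
    (x i2 0)%:C * iter q (derivC (b2 R)) F x + q%:R * iter q.-1 (derivC (b2 R)) F x.
  by move=> x0; rewrite (iter_derivC_coord q oU sF x0 b2i2) mulr1.
rewrite (iter_derivC_ext (b1 R) p oU E Ub).
have s1 := smooth_on_iter (b2 R) q sF; have s2 := smooth_on_iter (b2 R) q.-1 sF.
rewrite (iter_derivC_add (b1 R) p oU (smooth_mulc i2 oU s1) (smooth_on_scale q%:R oU s2) Ub).
rewrite (iter_derivC_scale _ (b1 R) p oU s2 Ub) (iter_derivC_coord p oU s1 Ub b1i2).
by rewrite mulr0 !mul0r addr0 mxE mul0r add0r.
Qed.

Definition mono i j F : V -> R[i] := iter i (mulc i1) (iter j (mulc i2) F).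

Lemma smooth_mono U i j F : open U -> smooth_on U F -> smooth_on U (mono i j F).
Proof.
move=> oU sF; rewrite /mono; elim: i => /= [|i IH]; last exact: smooth_mulc.
by elim: j => //= j IH; exact: smooth_mulc.
Qed.

Lemma monoE i j F v : mono i j F v = (v i1 0 ^+ i * v i2 0 ^+ j)%:C * F v.
Proof.
rewrite /mono; elim: i => [|i IH] /=.
  rewrite mul1r; elim: j => [|j IH] /=; first by rewrite mul1r.
  by rewrite /mulc IH exprS rmorphM mulrA.
by rewrite /mulc IH mulrA -rmorphM mulrA exprS.
Qed.

(** The falling factorials vanish as soon as [p < i] or [q < j], exactly where the truncated
    subtractions would be wrong. *)
Lemma jet_mono U p q i j F : open U -> U (b0 R) -> smooth_on U F ->
  jet p q (mono i j F) = (p ^_ i * q ^_ j)%:R * jet (p - i) (q - j) F.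
Proof.
move=> oU Ub sF; elim: i p => [|i IH] p.
  rewrite ffactn0 mul1n subn0; elim: j q => [|j IH] q; first by rewrite mul1r subn0.
  rewrite (jet_mulc2 p q oU Ub (smooth_mono 0 j oU sF)) IH mulrA -natrM ffactnS.
  by congr (_ * jet _ _ _); case: q => // q; rewrite ffact0n muln0.
rewrite (jet_mulc1 p q oU Ub (smooth_mono i j oU sF)) IH mulrA -natrM ffactnS mulnA.
by congr (_ * jet _ _ _); case: p => //= p.
Qed.

(** The first coordinate after the shear e_1 |-> e_1 + u e_0; [u = 0] serves for [jet_kmono] and
    [u = 1] for [coef_shear]. *)
Definition axis (u : R) v : R := v 0 0 + u * v i1 0.

Lemma is_derive_axis u v w : is_derive v w (axis u) (axis u w).
Proof.
have := is_deriveD (is_derive_coord 0 0 v w) (is_deriveZ u (is_derive_coord i1 0 v w)).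
exact.
Qed.

Lemma axis_continuous u : continuous (axis u).
Proof.
move=> v; have C0 := @coord_continuous R 3 1 0 0 v.
have C1 := @coord_continuous R 3 1 i1 0 v.
exact: (cvgD C0 (cvgM (@cvg_cst _ u _ (nbhs v) _) C1)).
Qed.

Lemma axis_b0 u : axis u (b0 R) = 1.
Proof. by rewrite /axis !mxE /= mulr0 addr0. Qed.

Lemma near_axis u : \forall v \near b0 R, 0 < axis u v.
Proof.
have := @axis_continuous u (b0 R); rewrite /continuous_at axis_b0 => /cvgr_gt; apply.
exact: ltr01.
Qed.

Lemma derivC_axis al mu u v w : 0 < axis u v ->
  derivC w (fun v => kap al mu (axis u v)) v =
  - mu * (axis u w / axis u v)%:C * kap al mu (axis u v).
Proof.
move=> l0; apply: derivC_kap => //; [exact: axis_continuous|exact: is_derive_axis].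
Qed.

Lemma jet_axis0 al mu u : jet 0 0 (fun v => kap al mu (axis u v)) = 1.
Proof. by rewrite /jet /= axis_b0 kap1. Qed.

Lemma jet_axis1 al mu u : jet 1 0 (fun v => kap al mu (axis u v)) = - mu * u%:C.
Proof.
rewrite /jet /= derivC_axis axis_b0 ?ltr01 // kap1 mulr1 divr1; congr (_ * _%:C).
by rewrite /axis !mxE /= add0r mulr1.
Qed.

Lemma jet_axis2 al mu u p q : (0 < q)%N -> jet p q (fun v => kap al mu (axis u v)) = 0.
Proof.
case: q => // q _; rewrite /jet iterSr -(iter_derivC0 (b1 R) p (b0 R)).
apply: iter_derivC_eq_near.
have H : \forall v \near b0 R,
    derivC (b2 R) (fun v => kap al mu (axis u v)) v = (fun=> 0 : R[i]) v.
  apply: filterS (near_axis u) => v /derivC_axis ->.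
  by rewrite /axis !mxE /= mulr0 addr0 mul0r mulr0 mul0r.
by apply: filterS (near_iter_derivC (b2 R) q H) => v ->; exact: iter_derivC0.
Qed.

Lemma jet_axis10 al mu p : (0 < p)%N -> jet p 0 (fun v => kap al mu (axis 0 v)) = 0.
Proof.
case: p => // p _; rewrite /jet iterSr -(iter_derivC0 (b1 R) p (b0 R)).
apply: iter_derivC_eq_near; apply: filterS (near_axis 0) => v /derivC_axis ->.
by rewrite /axis !mxE /= mul0r addr0 mul0r mulr0 mul0r.
Qed.

(* The monomial v_1^i v_2^j, made homogeneous by the factor in v_0. *)
Definition kmono al lam i j v : R[i] :=
  (chi v)%:C * mono i j (fun v => kap (addsgn al (i + j)) (lam + (i + j)%:R) (v 0 0)) v.

Lemma kmono_homog al lam i j : homog al lam (kmono al lam i j).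
Proof.
apply: homog_chi.
  apply: smooth_mono; first exact: open_U0.
  by apply: smooth_on_kap => [|k|v Uv]; [exact: open_U0|exact: Ck_coord|].
move=> c v c0 Uv; rewrite !monoE !mxE kapM //.
rewrite -[kap al lam c](kap_addsgn al lam (i + j) c0) !exprMn exprD !rmorphM /=.
ring.
Qed.

Lemma near_chi_mulmx (A : 'M[R]_3) : A *m b0 R = b0 R ->
  \forall v \near b0 R, chi (A *m v) = 1.
Proof.
move=> Ab; have := @mulmx_continuous R 3 3 1 A (b0 R); rewrite /continuous_at Ab => cA.
exact: (cA _ (@near_chi1 R 2)).
Qed.

(** The cutoff is 1 near [b0] and the shear fixes [v_1] and [v_2], so it alters only the factor in
    the first coordinate. *)
Lemma jet_kmono_shear al lam i j (A : 'M[R]_3) u p q :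
  (forall v, A *m v = axis u v *: b0 R + (v i1 0 *: b1 R + v i2 0 *: b2 R)) ->
  jet p q (fun v => kmono al lam i j (A *m v)) = (p ^_ i * q ^_ j)%:R *
  jet (p - i) (q - j) (fun v => kap (addsgn al (i + j)) (lam + (i + j)%:R) (axis u v)).
Proof.
move=> AE; set g := fun v => kap _ _ (axis u v).
have Ab : A *m b0 R = b0 R.
  by rewrite AE axis_b0 !mxE /= !scale0r !addr0 scale1r.
have co v : [/\ (A *m v) 0 0 = axis u v, (A *m v) i1 0 = v i1 0 & (A *m v) i2 0 = v i2 0].
  by rewrite AE !mxE /= !(mulr0, mulr1, addr0, add0r).
rewrite (@near_jet p q _ (mono i j g)); last first.
  apply: filterS (near_chi_mulmx Ab) => v c1.
  by rewrite /kmono c1 mul1r !monoE; have [-> -> ->] := co v.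
pose U : set V := [set v | axis u v != 0].
have oU : open U.
  have -> : U = (fun v => A *m v) @^-1` (@U0 R).
    by apply/seteqP; split=> v; rewrite /U /U0 /=; have [-> _ _] := co v.
  apply: open_comp; last exact: open_U0.
  by move=> v _; exact: mulmx_continuous.
apply: (jet_mono (U := U)) => //; first by rewrite /U /= axis_b0 oner_eq0.
apply: smooth_on_kap => // k; apply: Ck_add => //; first exact: Ck_coord.
by apply: Ck_scale => //; exact: Ck_coord.
Qed.

(** The factor in [v 0 0] is constant along [b1] and [b2], so these sections are dual to the jets at
    [b0], without correction terms in any order. *)
Lemma jet_kmono al lam i j p q : jet p q (kmono al lam i j) =
  if (p == i) && (q == j) then (i`! * j`!)%:R else 0.
Proof.
have := @jet_kmono_shear al lam i j 1%:M 0 p q.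
have -> : (fun v => kmono al lam i j (1%:M *m v)) = kmono al lam i j.
  by apply/funext => v; rewrite mul1mx.
move=> ->; last by move=> v; rewrite mul1mx /axis mul0r addr0 -col3E.
have [pi|pi|->] := ltngtP p i; first by rewrite ffact_small // mul0n mul0r.
- have [qj|qj|->] := ltngtP q j; first by rewrite (ffact_small qj) muln0 mul0r.
    by rewrite jet_axis2 ?subn_gt0 // mulr0.
  by rewrite subnn jet_axis10 ?subn_gt0 // mulr0.
- have [qj|qj|->] := ltngtP q j; first by rewrite (ffact_small qj) muln0 mul0r.
    by rewrite jet_axis2 ?subn_gt0 // mulr0.
  by rewrite !subnn jet_axis0 mulr1 !ffactnn.
Qed.

End Monomials.

(** * Expansion of the functional in jets, and constraints on its coefficients *)

Section Expansion.
Variables (R : realType) (al be : bool) (lam nu : R[i]).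
Local Notation V := 'cV[R]_3.
Local Notation I3 := (Ind 2 al lam).
Variable L : I3 -> R[i].
Hypothesis LP : covariant_local be nu L.
Implicit Types (f : I3) (Phi : V -> R[i]).

Lemma homog_lin (c : R[i]) Phi1 Phi2 : homog al lam Phi1 -> homog al lam Phi2 ->
  homog al lam (fun v => c * Phi1 v + Phi2 v).
Proof.
move=> [s1 h1] [s2 h2]; split; first by apply: smooth_on_lin => //; exact: open_nz.
by move=> d v d0 v0; rewrite h1 // h2 // mulrDr mulrCA.
Qed.

Definition fmono i j : I3 := Ind_of (kmono_homog al lam i j).

Definition coef i j : R[i] := L (fmono i j) / (i`! * j`!)%:R.

Lemma fact2_neq0 i j : (i`! * j`!)%:R != 0 :> R[i].
Proof. by rewrite pnatr_eq0 -lt0n muln_gt0 !fact_gt0. Qed.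

(** By the duality [jet_kmono], subtracting a multiple of one monomial clears one jet and leaves all
    the others unchanged. *)
Lemma subtract_jets (s : seq (nat * nat)) f Phi : uniq s -> homog al lam Phi ->
  represents Phi f -> exists f' Phi', [/\ homog al lam Phi', represents Phi' f',
    forall p q, jet p q Phi' = if (p, q) \in s then 0 else jet p q Phi &
    L f = L f' + \sum_(ij <- s) coef ij.1 ij.2 * jet ij.1 ij.2 Phi].
Proof.
move=> + hP rf; elim: s => [_|[i j] s IH /= /andP[ijs us]].
  by exists f, Phi; split=> //; rewrite big_nil addr0.
have [f' [Phi' [hP' rf' jP' LE]]] := IH us.
pose a : R[i] := - jet i j Phi / (i`! * j`!)%:R.
exists (a *: fmono i j + f'), (fun v => a * kmono al lam i j v + Phi' v); split.
- by apply: homog_lin => //; exact: kmono_homog.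
- by move=> g; rewrite -rf'.
- move=> p q; have [sB _] := kmono_homog al lam i j.
  rewrite (jet_scale_add p q a sB hP'.1) jet_kmono jP' in_cons.
  rewrite -pair_eqE /=; case: ifP => [/andP[/eqP -> /eqP ->]|_].
    by rewrite (negPf ijs) /a divfK ?fact2_neq0 // addNr.
  by rewrite mulr0 add0r.
- rewrite big_cons /= LE (functionalD LP) (functionalZ LP) /a /coef addrA; congr (_ + _).
  by move: (L _) (L _) (jet i j Phi) ((_ * _)%:R^-1) => x y z t; ring.
Qed.

Definition square N : seq (nat * nat) := [seq (i, j) | i <- iota 0 N, j <- iota 0 N].

Lemma square_uniq N : uniq (square N).
Proof. by apply: allpairs_uniq => [||[? ?] [? ?]]; rewrite ?iota_uniq. Qed.

Lemma mem_square N i j : ((i, j) \in square N) = (i < N)%N && (j < N)%N.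
Proof.
apply/allpairsP/andP => [[[p q] [/=]]|[iN jN]].
  by rewrite !mem_iota !add0n => pN qN [-> ->].
by exists (i, j); rewrite !mem_iota.
Qed.

(** The square contains the triangle i + j < N, so the remainder is flat enough for [flat_kernel].
    Any [N] beyond the threshold is allowed, so the square can be enlarged to contain a prescribed
    index. *)
Lemma functional_jets N f Phi : homog al lam Phi -> represents Phi f ->
  complex.Re (nu - lam) + 1 <= N%:R ->
  L f = \sum_(ij <- square N) coef ij.1 ij.2 * jet ij.1 ij.2 Phi.
Proof.
move=> hP rf NP.
have [f' [Phi' [hP' rf' jP' ->]]] := subtract_jets (square_uniq N) hP rf.
rewrite (flat_kernel LP hP' rf' _ NP) ?add0r //.
apply: (flat_axis_jets hP') => i j ijN; rewrite -/(jet i j Phi') jP' mem_square.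
by rewrite !(leq_ltn_trans _ ijN) ?leq_addl ?leq_addr.
Qed.

(** Near [b0], [scal eps] multiplies the test monomial by [eps ^+ (2 * i + j)]. Comparing with
    [functional_scal] equates two characters, and [kap_inj] separates sign and exponent. *)
Lemma coef_weight i j : coef i j != 0 ->
  be = addsgn al (2 * i + j) /\ nu = lam + (2 * i + j)%:R.
Proof.
rewrite /coef mulf_eq0 negb_or => /andP[Lf0 _].
have hB := kmono_homog al lam i j.
have key eps : eps != 0 -> kap al lam eps^-1 * (eps ^+ (2 * i + j))%:C = kap be nu eps^-1.
  move=> e0; apply: (mulIf Lf0); rewrite -(functional_scal LP hB e0
    (f' := Ind_of (homog_scal eps hB)) (f := fmono i j)) // -mulrA; congr (_ * _).
  rewrite -(functionalZ LP).
  apply: (functional_local LP (Phi1 := fun v => (eps ^+ (2 * i + j))%:C * kmono al lam i j v)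
    (Phi2 := fun v => (chi v)%:C * kmono al lam i j (scal eps *m v))) => //.
  have sb : scal eps *m b0 R = b0 R.
    by apply: col3_eq; rewrite ?scal0 ?scal1 ?scal2 !mxE /= ?mulr0.
  apply: filterS2 (@near_chi1 R 2) (near_chi_mulmx sb) => v c1 c2.
  rewrite /kmono c1 c2 !mul1r !monoE scal0 scal1 scal2 !exprMn mulrA -rmorphM.
  by rewrite mul2n -addnn !exprD; congr (_%:C * _); ring.
suff [-> ->] : addsgn al (2 * i + j) = be /\ lam + (2 * i + j)%:R = nu by [].
apply: kap_inj => c c0; have ci : c^-1 != 0 by rewrite invr_eq0.
have := key _ ci; rewrite invrK => <-.
rewrite -(kap_addsgn al lam (2 * i + j) c0) -mulrA -rmorphM -exprMn mulfV //.
by rewrite expr1n mulr1.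
Qed.

Lemma coef_eq0_functional i j : coef i j = 0 -> L (fmono i j) = 0.
Proof.
move/eqP; rewrite mulf_eq0 invr_eq0 (negPf (fact2_neq0 i j)) orbF.
by move/eqP.
Qed.

Lemma coef_shear i j : coef i.+1 j != 0 -> lam = 1 - (i.+1 + j)%:R.
Proof.
move=> cn0; have [_ nuE] := coef_weight cn0.
(* The weight at [(i, j)] is smaller by 2 than at [(i.+1, j)], so both coefficients cannot be
   nonzero. *)
have ci0 : coef i j = 0.
  apply/eqP/negPn/negP => /coef_weight[_]; rewrite nuE => /addrI/eqP.
  rewrite eqr_nat; lia.
have [p pc [p00 p01 p11]] := @exists_triangular R 1 1 (oner_neq0 _).
have AE v : val (iotaG p) *m v = axis 1 v *: b0 R + (v i1 0 *: b1 R + v i2 0 *: b2 R).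
  by rewrite iotaG_mulmx ?p00 ?p01 ?p11 // invr1 !mul1r /axis mul1r.
have hB := kmono_homog al lam i j; have hB' := homog_comp_SL (iotaG p) hB.
have rf' : represents (fun v => kmono al lam i j (val (iotaG p) *m v)) (Ind_of hB') by [].
have Lf' : L (Ind_of hB') = 0.
  rewrite (functional_triangular LP (u := 1) (f := fmono i j) (Phi := kmono al lam i j)
    (oner_neq0 _) _ rf') ?(coef_eq0_functional ci0) ?mulr0 //.
  by near=> v; rewrite AE invr1 !mul1r /axis mul1r.
pose N := (Num.trunc `|complex.Re (nu - lam) + 1|).+1.
(* The extra summand makes the square contain [(i.+1, j)]. *)
have aN : complex.Re (nu - lam) + 1 <= (N + (i.+1 + j).+1)%:R.
  rewrite natrD; apply: (@le_trans _ _ N%:R); last by rewrite lerDl ler0n.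
  apply: le_trans (ler_norm _) _; apply: ltW; exact: truncnS_gt.
have := functional_jets hB' rf' aN; rewrite Lf' => /esym.
rewrite (bigD1_seq (i.+1, j)) ?square_uniq //=; last first.
  by rewrite mem_square; apply/andP; split; lia.
(* Among indices of the same weight, [q' < j] kills the falling factorial, [q' > j] leaves a
   derivative along [b2] of a function of [v_0] and [v_1], and [q' = j] forces [p' = i.+1]. *)
rewrite big1_seq ?addr0 => [|[p' q'] /= /andP[pq _]]; last first.
  have [->|c0] := eqVneq (coef p' q') 0; first by rewrite mul0r.
  have [_] := coef_weight c0; rewrite nuE => /addrI/eqP; rewrite eqr_nat => /eqP E.
  rewrite (jet_kmono_shear al lam i j p' q' AE).
  have [qj|qj|qj] := ltngtP q' j; first by rewrite (ffact_small qj) muln0 mul0r mulr0.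
    by rewrite jet_axis2 ?subn_gt0 // !mulr0.
  by move/eqP: pq; case; rewrite qj; congr (_, _); lia.
(* The surviving jet is a positive integer times -(lam + i + j), the derivative of the power of v_0
   + v_1. *)
rewrite (jet_kmono_shear al lam i j _ _ AE) subSnn subnn jet_axis1 mulr1.
rewrite -[RHS](mulr0 (coef i.+1 j)) => /(mulfI cn0)/eqP.
rewrite mulf_eq0 => /orP[|].
  by rewrite pnatr_eq0 -[_ == 0%N]negbK -lt0n muln_gt0 !ffact_gt0 leqnSn leqnn.
rewrite oppr_eq0 => /eqP E; rewrite -[RHS]addr0 -E addSn -addn1 natrD; ring.
Unshelve. all: by end_near. Qed.

End Expansion.

(** * Classification *)

Section Classification.
Variables (R : realType) (al be : bool) (lam nu : R[i]).
Local Notation V := 'cV[R]_3.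
Local Notation I3 := (Ind 2 al lam).

Lemma Nbar0 n : Nbar (0 : 'cV[R]_n) = 1%g.
Proof. by apply/val_inj; rewrite /= Nbar_mxE mulmx0 mul0mx addr0. Qed.

Lemma fcol1 n : fcol (1%g : SL R n.+1) = e0 R n.
Proof. by rewrite fcolE mul1mx. Qed.

Lemma fcol_continuous n : continuous (@fcol R n).
Proof.
move=> g; have cv := @initial_continuous _ _ (val : SL R n.+1 -> 'M[R]_n.+1) g.
have cc : {for val g, continuous (fun A : 'M[R]_n.+1 => col 0 A)}.
  apply: mx_continuous => i j.
  have -> : (fun A : 'M[R]_n.+1 => col 0 A i j) = (fun A => A i 0).
    by apply/funext => A; rewrite mxE.
  exact: coord_continuous.
exact: (cvg_comp _ _ cv cc).
Qed.

Lemma near_zero_scale (f : I3) Phi (c : R) (v : V) : represents Phi f -> c != 0 -> v != 0 ->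
  (\forall w \near c *: v, Phi w = 0) -> \forall w \near v, Phi w = 0.
Proof.
move=> rf c0 v0 H; have cZ : (fun w : V => c *: w) @ v --> c *: v.
  exact: (cvgZr (@cvg_id _ (nbhs v))).
have nv : \forall w \near v, (w : V) != 0.
  by apply: open_nbhs_nbhs; split => //; exact: open_nz.
have H' : \forall w \near v, Phi (c *: w) = 0 := cZ _ H.
apply: filterS2 nv H' => w w0.
have [g gw] := exists_fcol w0; have [g' gw'] := exists_fcol (nzZ c0 w0).
have fE : f g' = kap al lam c * f g by apply: Ind_fcol => //; rewrite gw.
rewrite -gw' -rf fE rf gw => /eqP.
by rewrite mulf_eq0 (negPf (kap_neq0 al lam c0)) => /eqP.
Qed.

(** The set [Z] of all [g] near whose first column [Phi] is not identically 0 is closed, and right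
    P-invariant by homogeneity; it excludes the identity. *)
Lemma near_zero_Supp (f : I3) Phi : represents Phi f ->
  (\forall v \near b0 R, Phi v = 0) -> ~ Supp f 1%g.
Proof.
move=> rf Phi0; pose W : set V := [set v | \forall w \near v, Phi w = 0].
move=> S1; pose Z := [set g : SL R 3 | ~ W (fcol g)].
suff ZP : [/\ closed Z, forall g p, Z g -> parabolic p -> Z (g * p)%g &
    [set g | f g != 0] `<=` Z].
  by have := S1 Z ZP; rewrite /Z /= fcol1; apply.
split.
- have -> : Z = ~` (@fcol R 2 @^-1` (interior [set w | Phi w = 0])).
    by [].
  apply: open_closedC; apply: open_comp; last exact: open_interior.
  by move=> g _; exact: fcol_continuous.
- move=> g p /= Zg [k [t [u pM]]] gp; apply: Zg; have [dk _] := pM.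
  have [c0 _ _] := MAN_coef t dk.
  apply: (near_zero_scale rf c0 (fcol_neq0 g)).
  by rewrite fcolM (MAN_fcol pM) -scalemxAr -fcolE in gp.
- by move=> g /= /negP fg /nbhs_singleton; rewrite -rf => /eqP.
Qed.

Lemma op_jet (f : I3) Phi i j : homog al lam Phi -> represents Phi f ->
  op j i f 1%g = jet i j Phi.
Proof.
move=> hP rf; rewrite (opE _ _ _ hP rf) fcol1 embG_e0 /jet.
have -> : (embG R : 'M[R]_(3, 2)) *m col 1 (val (1%g : SL R 2)) = b1 R.
  by rewrite colE /= mul1mx embG_delta.
by have -> : e2 R = b2 R by [].
Qed.

Lemma DD_jet (f : I3) Phi i j : homog al lam Phi -> represents Phi f ->
  DD al lam j i f 0 = jet i j Phi.
Proof.
by move=> hP rf; rewrite -op_restr scale0r Nbar0; exact: op_jet.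
Qed.

Lemma DD_fmono i j p q : DD al lam q p (fmono al lam i j) 0 =
  if (p == i) && (q == j) then (i`! * j`!)%:R else 0.
Proof. by rewrite (DD_jet p q (kmono_homog al lam i j)) ?jet_kmono. Qed.

Variable D : {linear I3 -> Ind 1 be nu}.
Hypothesis DP : Diff al be lam nu D.
Let L (f : I3) := Ind_fun (D f) 1%g.

Lemma Diff_covariant_local : covariant_local be nu L.
Proof.
have [cD actD suppD] := DP; split.
- by move=> c f1 f2; rewrite /L linearP.
(* If [D f] did not vanish at 1, then 1 would lie in its support, hence [iotaG 1 = 1] in that of
   [f]. *)
- move=> f Phi rf Phi0; apply/eqP/negPn/negP => n0.
  apply: (near_zero_Supp rf Phi0); rewrite -(iotaG1 R); apply: suppD; exists 1%g => //.
  by move=> Z [_ _]; apply.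
- move=> F h FF h0 e e0.
  have cv : (D \o h) @ F --> (0 : Ind 1 be nu).
    rewrite -(linear0 D); apply: (cvg_comp _ _ h0); exact: cD.
  have cp : compact [set (0 : 'cV[R]_1)] by exact: compact_set1.
  have H : \forall x \near F, jet_near [set 0] [::] 1%g e 0 (D (h x)).
    exact: cv _ (near_Ind 0 [::] 1%g cp e0).
  apply: filterS H => x /(_ 0 (erefl _)); rewrite /= /chart Nbar0 mulg1.
  by rewrite /= !sub0r !normrN.
- move=> p c f f' c0 pc f'E.
  have -> : f' = act (iotaG p^-1)%g f.
    by apply: Ind_ext => g; rewrite f'E -iotaGV /= /Ind_fun /= /ltrans invgK.
  rewrite /L actD; rewrite /Ind_fun /= /ltrans invgK mulg1.
  by apply: Ind_fcol => //; rewrite fcol1.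
Qed.

(** Covariance under G' recovers the operator from its value at the identity. *)
Lemma DiffE f h : Ind_fun (D f) h = L (act (iotaG h^-1)%g f).
Proof.
have [_ actD _] := DP.
by rewrite /L actD /= [RHS]/Ind_fun /= /ltrans invgK mulg1.
Qed.

Definition Diff_coef i j := coef L i j.

Lemma Diff_expansion N : complex.Re (nu - lam) + 1 <= N%:R ->
  restrJ D = fun f x1 =>
    \sum_(ij <- square N) Diff_coef ij.1 ij.2 * DD al lam ij.2 ij.1 f x1.
Proof.
move=> aN; apply/funext => f; apply/funext => x1.
rewrite /restrJ /chart mul1g DiffE; set h := Nbar _.
have [Phi hP rf] := Ind_homog (act (iotaG h^-1)%g f).
rewrite (functional_jets Diff_covariant_local hP rf aN).
apply: eq_bigr => -[i j] _ /=; rewrite -(op_jet i j hP rf) op_act invgK mulg1.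
by rewrite op_restr.
Qed.

Lemma Diff_coef_weight i j : Diff_coef i j != 0 ->
  be = addsgn al (2 * i + j) /\ nu = lam + (2 * i + j)%:R.
Proof. exact: coef_weight Diff_covariant_local i j. Qed.

Lemma Diff_coef_shear i j : Diff_coef i.+1 j != 0 -> lam = 1 - (i.+1 + j)%:R.
Proof. exact: coef_shear Diff_covariant_local i j. Qed.

End Classification.

Theorem theorem4p16 (R : realType) (alpha beta : bool) (lam nu : R[i]) :
  let DiffG' := [set restrJ D | D in Diff alpha beta lam nu] in
  let D_ m l := DD alpha lam m l in
  [/\ forall m : nat,
        (alpha, beta, lam, nu) = lambda1 alpha lam m ->
        ~ Lambda_plus (alpha, beta, lam, nu) ->
        DiffG' = [set c *: D_ m 0%N | c in [set: R[i]]],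
      forall m l : nat, (1 <= l)%N ->
        (alpha, beta, lam, nu) = lambda_plus R alpha m l ->
        DiffG' = [set T | exists a b : R[i],
                    T = a *: D_ (m + 2 * l)%N 0%N + b *: D_ m l] /\
        (forall a b : R[i],
          a *: D_ (m + 2 * l)%N 0%N + b *: D_ m l = 0 -> a = 0 /\ b = 0) &
      ~ Lambda1 (alpha, beta, lam, nu) -> DiffG' = [set 0]].
Proof.
move=> DiffG' D_.
(* The free summand [k] later enlarges the square until it contains the indices to be singled
   out. *)
have order_bound : exists N0 : nat, forall k, complex.Re (nu - lam) + 1 <= (N0 + k)%:R.
  exists (Num.trunc `|complex.Re (nu - lam) + 1|).+1 => k.
  rewrite natrD ler_wpDr ?ler0n //; apply: le_trans (ler_norm _) _.
  by apply: ltW; exact: truncnS_gt.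
have [N0 N0P] := order_bound.
split.
- move=> m [Ebe Enu] nLp; apply/seteqP; split=> [_ [D DP <-]|_ [c _ <-]].
    exists (Diff_coef D 0 m) => //.
    rewrite (Diff_expansion DP (N0P m.+1)); apply/funext => f; apply/funext => x1.
    rewrite (bigD1_seq (0%N, m)) ?square_uniq //=; last first.
      by rewrite mem_square; apply/andP; split; lia.
    rewrite big1 ?addr0 // => -[i j] /= ij.
    have [->|cn0] := eqVneq (Diff_coef D i j) 0; first by rewrite mul0r.
    have [bE nE] := Diff_coef_weight DP cn0.
    have mE : m = (2 * i + j)%N.
      by apply/eqP; rewrite -(eqr_nat R[i]); apply/eqP/(addrI lam); rewrite -nE -Enu.
    (* The weight forces j = m when i = 0, the term already extracted. With i > 0, [Diff_coef_shear]
       would put the parameter in [Lambda_plus]. *)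
    case: i ij cn0 bE nE mE => [|i] ij cn0 bE nE mE; first by move: ij; rewrite mE eqxx.
    have lE := Diff_coef_shear DP cn0; exfalso; apply: nLp; exists alpha, j, i.+1; split=> //.
    rewrite /lambda_plus; congr (_, _, _, _).
    - by rewrite bE /addsgn oddD oddM.
    - by rewrite lE addnC.
    - by rewrite Enu lE mE (natrD _ i.+1 j) (natrD _ (2 * i.+1) j) natrM; ring.
  have adm : admissible alpha beta lam nu m 0.
    by split; [rewrite muln0 addn0|rewrite muln0 addn0|left].
  exists (comb c 0 adm adm); first exact: comb_Diff.
  by rewrite restrJ_comb scale0r addr0.
- move=> m l l1 [Ebe Elam Enu].
  have adm1 : admissible alpha beta lam nu (m + 2 * l) 0.
    split; last by left.
    - by rewrite Ebe /addsgn muln0 addn0 oddD oddM addbF.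
    - by rewrite Enu Elam muln0 addn0 (natrD _ m l) (natrD _ m (2 * l)) natrM; ring.
  have adm2 : admissible alpha beta lam nu m l.
    split; last by right.
    - by rewrite Ebe /addsgn oddD oddM addbF.
    - by rewrite Enu Elam (natrD _ m l) (natrD _ m (2 * l)) natrM; ring.
  have [_ nuE _] := adm2; split.
    apply/seteqP; split=> [_ [D DP <-]|T [a [b ->]]]; last first.
      exists (comb a b adm1 adm2); first exact: comb_Diff.
      exact: restrJ_comb.
    exists (Diff_coef D 0 (m + 2 * l)), (Diff_coef D l m).
    rewrite (Diff_expansion DP (N0P (m + 2 * l).+1)); apply/funext => f; apply/funext => x1.
    rewrite (bigD1_seq (0%N, (m + 2 * l)%N)) ?square_uniq //=; last first.
      by rewrite mem_square; apply/andP; split; lia.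
    (* Since l >= 1, the index [(l, m)] differs from the one already extracted. *)
    rewrite -big_filter (bigD1_seq (l, m)) ?filter_uniq ?square_uniq //=; last first.
      rewrite mem_filter mem_square xpair_eqE; apply/andP; split; [lia|by apply/andP; split; lia].
    rewrite big_filter_cond big1 ?addr0 // => -[i j] /= /andP[ij ij'].
    have [->|cn0] := eqVneq (Diff_coef D i j) 0; first by rewrite mul0r.
    have [_ nE] := Diff_coef_weight DP cn0.
    have mE : (m + 2 * l = 2 * i + j)%N.
      by apply/eqP; rewrite -(eqr_nat R[i]); apply/eqP/(addrI lam); rewrite -nE -nuE.
    case: i ij ij' cn0 nE mE => [|i] ij ij' cn0 nE mE; first by move: ij; rewrite mE eqxx.
    have lE := Diff_coef_shear DP cn0.
    (* Together with [mE] this determines the index: subtracting gives i = l, and then j = m. *)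
    have sE : (m + l = i.+1 + j)%N.
      by apply/eqP; rewrite -(eqr_nat R[i]); apply/eqP/oppr_inj/(addrI 1); rewrite -lE -Elam.
    by move: ij'; rewrite xpair_eqE; lia.
  move=> a b E; have ev f : a * DD alpha lam (m + 2 * l) 0 f 0 + b * DD alpha lam m l f 0 = 0.
    by have := congr1 (fun T : Ind 2 alpha lam -> R -> R[i] => T f 0) E.
  (* The two test sections are dual to the two jets at the origin, and each isolates one
     coefficient. *)
  have := ev (fmono alpha lam 0 (m + 2 * l)); have := ev (fmono alpha lam l m).
  have l0 : (l == 0%N) = false by rewrite eqn0Ngt l1.
  rewrite !DD_fmono !eqxx [0%N == l]eq_sym l0 /= !mulr0 addr0 add0r => /eqP.
  rewrite mulf_eq0 (negPf (fact2_neq0 _ _ _)) orbF => /eqP -> /eqP.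
  by rewrite mulf_eq0 (negPf (fact2_neq0 _ _ _)) orbF => /eqP ->.
- move=> nL1; apply/seteqP; split=> [_ [D DP <-]|_ ->].
    rewrite (Diff_expansion DP (N0P 0%N)); apply/funext => f; apply/funext => x1.
    apply: big1 => -[i j] _ /=.
    have [->|cn0] := eqVneq (Diff_coef D i j) 0; first by rewrite mul0r.
    have [bE nE] := Diff_coef_weight DP cn0; exfalso; apply: nL1.
    by exists alpha, lam, (2 * i + j)%N; rewrite /lambda1 -bE -nE.
  pose Z : {linear Ind 2 alpha lam -> Ind 1 beta nu} := \0.
  exists Z; last by [].
  split; [|move=> h f|move=> f x [g gS _]].
  - exact: cst_continuous.
  - exact: Ind_ext.
  (* The empty set is an admissible closed set for the zero section, so its support is empty. *)
  - exfalso; apply: (gS set0); split=> [||y /=]; [exact: closed0|by []|].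
    by rewrite eqxx.
Qed.
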